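(* Let $T>0$, $\frac13<\gamma\le\frac12$, let $b\in L^\infty([0,T];\mathrm{Lin}(\mathbb R^d))$ with $\operatorname{div} b\in L^\infty([0,T];L^\infty(\mathbb R^d))$, let $\mathbf X\in\mathcal R^\gamma([0,T])$ and $u_0\in L^\infty(\mathbb R^d)$. Then there exists a weak controlled solution $u\in L^\infty([0,T]\times\mathbb R^d)$ to the rough transport equation $$\partial_t u_t(x)+b_t(x)\cdot\nabla u_t(x)+\nabla u_t(x)\cdot \mathrm d\mathbf X_t=0$$ with initial condition $u_0$.
   Context: $\mathrm{Lin}(\mathbb R^d)$ is the Banach space of measurable $b:\mathbb R^d\to\mathbb R^d$ with $\|b\|_{\mathrm{Lin}}=\|b(\cdot)/(1+|\cdot|)\|_\infty<\infty$. For $\gamma\in(0,1]$, $\mathcal C^\gamma([0,T])$ has norm $\|f\|_\gamma=|f_0|+\sup_{s\neq t}|f_t-f_s|/|t-s|^\gamma$. For $\nu\in(0,1]$, $\mathcal C^\nu_2$ is the space of continuous $f:[0,T]^2\to F$ with $f_{t,t}=0$ and $\|f\|_\nu=\sup_{s\ne t}|f_{s,t}|/|t-s|^\nu<\infty$. Rough paths: let $1/3<\gamma\le1/2$ and write $X_{s,t}=X_t-X_s$. Paths start at $0$. A $\gamma$-rough path is a pair $\mathbf X=(X,\mathbb X)$ with $X\in\mathcal C^\gamma([0,T];\mathbb R^d)$, $\mathbb X\in\mathcal C^{2\gamma}_2([0,T]^2;\mathbb R^{d\times d})$ and $\mathbb X_{s,t}-\mathbb X_{s,u}-\mathbb X_{u,t}=X_{s,u}\otimes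 X_{u,t}$ for $s\le u\le t$; the distance between rough paths is $\|\mathbf X-\mathbf Y\|_{\mathcal R^\gamma}=\|X-Y\|_\gamma+\|\mathbb X-\mathbb Y\|_{2\gamma}$. The natural lift of $X\in C^1$ is $(X,\int_s^t X_{s,r}\otimes\dot X_r\,\mathrm dr)$. $\mathcal R^\gamma$ (geometric rough paths) is the set of $\gamma$-rough paths that are limits in this distance of natural lifts of $C^1$ paths. Controlled paths: $y\in\mathcal D^\gamma_X([0,T])$ if $y\in\mathcal C^\gamma$ and $y_t-y_s=y'_sX_{s,t}+y^\#_{s,t}$ with $y'\in\mathcal C^\gamma$, $y^\#\in\mathcal C^{2\gamma}_2$. The rough integral is $\int_s^t y_r\cdot\mathrm d\mathbf X_r=\lim_{|\mathcal P|\to0}\sum_{[t_i,t_{i+1}]\in\mathcal P}(y_{t_i}\cdot X_{t_i,t_{i+1}}+y'_{t_i}\mathbb X_{t_i,t_{i+1}})$, the limit over partitions of $[s,t]$. Pairing: $u_t(\varphi)=\int_{\mathbb R^d}u_t(x)\varphi(x)\,\mathrm dx$. A weak controlled solution with initial condition $u_0$ is a function $u\in L^\infty([0,T]\times\mathbb R^d)$ such that for all $\varphi\in C_c^\infty(\mathbb R^d)$: (i) $u(\varphi)\in\mathcal D^\gamma_X([0,T])$ (identifying $u(\varphi)$ with its continuous version); (ii) for all $t\in[0,T]$, $$u_t(\varphi)=u_0(\varphi)+\int_0^t u_s(b_s\cdot\nabla\varphi+(\operatorname{div} b_s)\varphi)\,\mathrm ds+\int_0^t u_s(\nabla\varphi)\cdot\mathrm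 d\mathbf X_s,$$ the last term being the rough integral of the controlled path $u(\nabla\varphi)$, whose derivative as a controlled path is $u(\nabla^2\varphi)$. *)

(* Defs.v *)
From HB Require Import structures.
From mathcomp Require Import all_boot all_order all_algebra.
From mathcomp Require Import all_classical all_reals all_analysis ess_sup_inf.
Set Implicit Arguments.
Unset Strict Implicit.
Unset Printing Implicit Defensive.
Import Order.TTheory GRing.Theory Num.Theory.
Import numFieldNormedType.Exports.
Local Open Scope classical_set_scope.
Local Open Scope ring_scope.

Definition measure_rV_display : measure_display -> measure_display.
Proof. exact. Qed.

(* The sigma-algebra on row vectors generated by the coordinates; on 'rV[R]_n
   it is the Borel sigma-algebra. *)
Section measurable_rV.
Context {d} {T : sigmaRingType d} (n : nat).

Let coors : 'I_n -> 'rV[T]_n -> T := fun i x => x ord0 i.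

Let rV_set0 : g_sigma_preimage coors set0.
Proof. exact: sigma_algebra0. Qed.

Let rV_setC A : g_sigma_preimage coors A -> g_sigma_preimage coors (~` A).
Proof. exact: sigma_algebraC. Qed.

Let rV_bigcup (F : (set 'rV[T]_n)^nat) :
  (forall i, g_sigma_preimage coors (F i)) ->
  g_sigma_preimage coors (\bigcup_i (F i)).
Proof. exact: sigma_algebra_bigcup. Qed.

HB.instance Definition _ := @isMeasurable.Build (measure_rV_display d)
  'rV[T]_n (g_sigma_preimage coors) rV_set0 rV_setC rV_bigcup.

End measurable_rV.

Lemma measurable_coord d (T : sigmaRingType d) n (i : 'I_n) :
  measurable_fun [set: 'rV[T]_n] (fun x : 'rV[T]_n => x ord0 i).
Proof.
move=> _ Y mY; rewrite setTI; apply: sub_sigma_algebra => /=.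
rewrite -bigcup_seq/=; exists i => /=; first by rewrite mem_index_enum.
by exists Y => //; rewrite setTI.
Qed.

Lemma measurable_fun_rVP d1 d2 (T1 : measurableType d1)
    (T2 : measurableType d2) n (f : T1 -> 'rV[T2]_n) :
  (forall i, measurable_fun [set: T1] (fun x => f x ord0 i)) ->
  measurable_fun [set: T1] f.
Proof.
move=> mf _ A mA; rewrite setTI.
have {mA} : preimage_set_system [set: T1] f measurable (f @^-1` A).
  by exists A => //; rewrite setTI.
rewrite -(g_sigma_preimage_comp (fun (i : 'I_n) (x : 'rV[T2]_n) => x ord0 i) f).
apply: smallest_sub; first exact: sigma_algebra_measurable.
rewrite -bigcup_seq => B [i _] [C mC <-].
exact: mf.
Qed.

Section lebesgue_rV.
Context {R : realType}.

Definition cons_rV n (p : measurableTypeR R * 'rV[R]_n) : 'rV[R]_n.+1 :=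
  \row_i if unlift ord0 i is Some j then p.2 ord0 j else p.1.

Definition uncons_rV n (x : 'rV[R]_n.+1) : measurableTypeR R * 'rV[R]_n :=
  (x ord0 ord0, \row_j x ord0 (lift ord0 j)).

Lemma cons_rVK n : cancel (@cons_rV n) (@uncons_rV n).
Proof.
move=> [r v]; rewrite /uncons_rV /cons_rV !mxE unlift_none /=; congr pair.
by apply/rowP => j; rewrite !mxE liftK.
Qed.

Lemma measurable_cons_rV n : measurable_fun setT (@cons_rV n).
Proof.
apply: measurable_fun_rVP => i; rewrite /cons_rV.
under eq_fun do rewrite mxE.
case: (unlift ord0 i) => [j|]; last exact: measurable_fst.
exact: (measurableT_comp (measurable_coord j) measurable_snd).
Qed.

Lemma measurable_uncons_rV n : measurable_fun setT (@uncons_rV n).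
Proof.
apply: measurable_fun_pair; first exact: measurable_coord.
apply: measurable_fun_rVP => i /=.
under eq_fun do rewrite mxE.
exact: measurable_coord.
Qed.

Section step.
Variables (n : nat) (mu : {sigma_finite_measure set 'rV[R]_n -> \bar R}).

Definition lebesgue_rV_step : set 'rV[R]_n.+1 -> \bar R :=
  pushforward (lebesgue_measure \x mu)%E (@cons_rV n).

HB.instance Definition _ := Measure.copy lebesgue_rV_step
  (measure_function_pushforward__canonical__measure_function_Measure
    (lebesgue_measure \x mu)%E (@measurable_cons_rV n)).

Let lebesgue_rV_step_sigma_finite : sigma_finite setT lebesgue_rV_step.
Proof.
have /sigma_finiteP[F [FT ndF Ffin]] :=
  @sigma_finiteT _ _ _ (@lebesgue_measure R).
have /sigma_finiteP[G [GT ndG Gfin]] := sigma_finiteT mu.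
exists (fun k => @uncons_rV n @^-1` (F k `*` G k)).
  apply/esym; rewrite -subTset => x _.
  have [i _ Fi] : (\bigcup_k F k) (uncons_rV x).1 by rewrite -FT.
  have [j _ Gj] : (\bigcup_k G k) (uncons_rV x).2 by rewrite -GT.
  exists (maxn i j) => //; split.
  - by move: Fi; exact/subsetPset/ndF/leq_maxl.
  - by move: Gj; exact/subsetPset/ndG/leq_maxr.
move=> k; have [mF Fk] := Ffin k; have [mG Gk] := Gfin k; split.
  rewrite -[X in measurable X]setTI; apply: measurable_uncons_rV => //.
  exact: measurableX.
rewrite /lebesgue_rV_step /pushforward -comp_preimage.
rewrite (_ : _ \o _ = id); last by apply/funext => p /=; rewrite cons_rVK.
by rewrite preimage_id product_measure1E// lte_mul_pinfty// ge0_fin_numE.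
Qed.

HB.instance Definition _ := @Measure_isSigmaFinite.Build _ _ _
  lebesgue_rV_step lebesgue_rV_step_sigma_finite.

End step.

Fixpoint lebesgue_rV n : {sigma_finite_measure set 'rV[R]_n -> \bar R} :=
  match n return {sigma_finite_measure set 'rV[R]_n -> \bar R} with
  | 0 => \d_(0 : 'rV[R]_0)
  | m.+1 => lebesgue_rV_step (lebesgue_rV m)
  end.

Lemma lebesgue_rV_box n (A : 'I_n -> set (measurableTypeR R)) :
  (forall i, measurable (A i)) ->
  lebesgue_rV n [set x | forall i, A i (x ord0 i)] =
  (\prod_i lebesgue_measure (A i))%E.
Proof.
elim: n A => [|n IHn] A mA.
  by rewrite big_ord0 /= diracE mem_set// => -[].
pose B := [set v : 'rV[R]_n | forall i, A (lift ord0 i) (v ord0 i)].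
have mB : measurable B.
  have -> : B = \bigcap_(i in [set: 'I_n])
      (fun v : 'rV[R]_n => v ord0 i) @^-1` A (lift ord0 i).
    by apply/seteqP; split=> v vB i; [move=> _; exact: vB|exact: vB].
  apply: fin_bigcap_measurable => // i _.
  rewrite -[X in measurable X]setTI; apply: measurable_coord => //.
  exact: mA.
rewrite big_ord_recl -IHn; last by move=> i; exact: mA.
rewrite -[RHS]product_measure1E//= /lebesgue_rV_step /pushforward.
congr product_measure1; apply/seteqP; split=> [[r v] /= rv|[r v] /= [Ar Bv] i].
  split; first by have := rv ord0; rewrite mxE unlift_none.
  by move=> i; have := rv (lift ord0 i); rewrite mxE liftK.
by rewrite mxE; case: unliftP => [j ->|->] //=; exact: Bv.
Qed.

End lebesgue_rV.

Section functions_on_rV.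
Context {R : realType} {d : nat}.
Implicit Types (f phi : 'rV[R]_d -> R) (v : 'rV[R]_d -> 'rV[R]_d).

Definition dotmul (x y : 'rV[R]_d) : R := \sum_i x ord0 i * y ord0 i.

Definition partial (i : 'I_d) f : 'rV[R]_d -> R :=
  fun x => 'D_(delta_mx ord0 i) f x.

Definition gradient f (x : 'rV[R]_d) : 'rV[R]_d := \row_i partial i f x.

Definition smooth f := forall s : seq 'I_d, let g := foldr partial f s in
  continuous g /\ forall i x, derivable g x (delta_mx ord0 i).

Definition test_function phi :=
  smooth phi /\ compact (closure [set x | phi x != 0]).

Definition pairing f phi : R := \int[lebesgue_rV d]_x (f x * phi x).

Definition lin_norm v : \bar R :=
  ('N[lebesgue_rV d]_(+oo) [(fun x => (`|v x| / (1 + `|x|))%R%:E)])%E.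

Definition weak_div v f := forall phi, test_function phi ->
  \int[lebesgue_rV d]_x dotmul (v x) (gradient phi x) = - pairing f phi.

End functions_on_rV.

Section time_dependent.
Context {R : realType} {d : nat}.
Variable T : R.

Definition ess_bounded_in_time (N : R -> \bar R) :=
  (ess_sup lebesgue_measure (N \_ `[0%R, T]) < +oo)%E.

(* Elements of L^oo([0,T]; Lin(R^d)) and L^oo([0,T]; L^oo(R^d)) are represented
   by jointly measurable functions. *)
Definition Linfty_Lin (b : R -> 'rV[R]_d -> 'rV[R]_d) :=
  measurable_fun (`[0, T] `*` [set: 'rV[R]_d]) (fun p => b p.1 p.2) /\
  ess_bounded_in_time (fun t => lin_norm (b t)).

Definition Linfty_Linfty (f : R -> 'rV[R]_d -> R) :=
  measurable_fun (`[0, T] `*` [set: 'rV[R]_d]) (fun p => f p.1 p.2) /\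
  ess_bounded_in_time (fun t => ('N[lebesgue_rV d]_(+oo) [EFin \o f t])%E).

Definition Linfty_spacetime (f : R -> 'rV[R]_d -> R) :=
  (fun p => f p.1 p.2) \_ (`[0, T] `*` [set: 'rV[R]_d]) \in
    Lfun (lebesgue_measure \x lebesgue_rV d)%E +oo%E.

(* g is the version of f that is continuous on [0,T]. *)
Definition continuous_version (f g : R -> R) :=
  {within `[0, T], continuous g} /\
  {ae lebesgue_measure, forall t, `[0, T]%classic t -> g t = f t}.

End time_dependent.

Section hoelder_spaces.
Context {R : realType} {V : normedModType R}.
Variable T : R.

Definition increment (f : R -> V) : R -> R -> V := fun s t => f t - f s.

(* On R^k and on matrices, `| _ | is the sup norm; being equivalent to the
   Euclidean norm, it defines the same spaces and the same convergence. *)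
Definition hoelder_norm2 (nu : R) (f : R -> R -> V) : \bar R :=
  ereal_sup [set q | exists s t : R,
    [/\ s \in `[0, T], t \in `[0, T], s != t
      & q = (`|f s t| / `|t - s| `^ nu)%:E]].

Definition hoelder_norm (gamma : R) (f : R -> V) : \bar R :=
  (`|f 0%R|%:E + hoelder_norm2 gamma (increment f))%E.

Definition hoelder_path gamma f := (hoelder_norm gamma f < +oo)%E.

Definition hoelder_two_param nu f :=
  [/\ {within `[0, T] `*` `[0, T], continuous (fun p : R * R => f p.1 p.2)},
      forall t, t \in `[0, T] -> f t t = 0
    & (hoelder_norm2 nu f < +oo)%E].

(* Y is C^1 on [0,T] with derivative Y' (one-sided at the endpoints). *)
Definition C1_path (Y Y' : R -> V) :=
  {within `[0, T], continuous Y'} /\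
  forall t, t \in `[0, T] ->
    (s - t)^-1 *: (Y s - Y t) @[s --> within (`[0, T] : set R) t^'] --> Y' t.

End hoelder_spaces.

Section rough_paths.
Context {R : realType} {d : nat}.
Variables (T gamma : R).
Implicit Types (X Y : R -> 'rV[R]_d) (XX YY : R -> R -> 'M[R]_d).

Definition tensor (x y : 'rV[R]_d) : 'M[R]_d := x^T *m y.

Definition rough_path X XX :=
  [/\ X 0 = 0, hoelder_path T gamma X, hoelder_two_param T (2 * gamma) XX
    & forall s u t, s \in `[0, T] -> u \in `[0, T] -> t \in `[0, T] ->
        s <= u <= t ->
        XX s t - XX s u - XX u t = tensor (increment X s u) (increment X u t)].

Definition rough_dist X XX Y YY : \bar R :=
  (hoelder_norm T gamma (fun t => X t - Y t)%R +
   hoelder_norm2 T (2 * gamma) (fun s t => XX s t - YY s t)%R)%E.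

Definition oriented_int (s t : R) (f : R -> R) : R :=
  if s <= t then \int[lebesgue_measure]_(r in `[s, t]) f r
  else - \int[lebesgue_measure]_(r in `[t, s]) f r.

(* Second level of the natural lift of a C^1 path Y with derivative Y'. *)
Definition natural_lift Y Y' (s t : R) : 'M[R]_d :=
  \matrix_(i, j) oriented_int s t
    (fun r => tensor (increment Y s r) (Y' r) i j).

Definition geometric_rough_path X XX :=
  rough_path X XX /\
  exists Y Y' : nat -> R -> 'rV[R]_d,
    (forall n, Y n 0 = 0 /\ C1_path T (Y n) (Y' n)) /\
    rough_dist X XX (Y n) (natural_lift (Y n) (Y' n)) @[n --> \oo] --> 0%E.

(* y is a path in R^k controlled by X, and y' t is the matrix of the linear map
   x |-> y'_t x from R^d to R^k. *)
Definition controlled X k (y : R -> 'rV[R]_k) (y' : R -> 'M[R]_(k, d)) :=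
  [/\ hoelder_path T gamma y, hoelder_path T gamma y'
    & exists2 r : R -> R -> 'rV[R]_k, hoelder_two_param T (2 * gamma) r &
        forall s t, s \in `[0, T] -> t \in `[0, T] ->
          y t - y s = (y' s *m (increment X s t)^T)^T + r s t].

(* With y_i(r) ~ y_i(a) + sum_j y'_ij(a) X^j_{a,r}, the second-order term of the
   integral of y against dX is sum_ij y'_ij(a) XX^{ji}_{a,b}, a trace. *)
Definition rough_sum X XX (y : R -> 'rV[R]_d) (y' : R -> 'M[R]_d)
    (s : R) (P : seq R) : R :=
  \sum_(0 <= k < size P)
    (let a := nth 0 (s :: P) k in let b := nth 0 (s :: P) k.+1 in
     dotmul (y a) (increment X a b) + \tr (y' a *m XX a b)).

Definition is_rough_integral X XX y y' (s t I : R) :=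
  forall e, 0 < e -> exists2 delta, 0 < delta &
    forall P, itv_partition s t P ->
      (forall k, (k < size P)%N ->
         nth 0 (s :: P) k.+1 - nth 0 (s :: P) k < delta) ->
      `|rough_sum X XX y y' s P - I| < e.

End rough_paths.

(* In U, U phi is the continuous version of t |-> u_t(phi). *)
Definition weak_controlled_solution (R : realType) (d : nat) (T gamma : R)
    (b : R -> 'rV[R]_d -> 'rV[R]_d) (divb : R -> 'rV[R]_d -> R)
    (X : R -> 'rV[R]_d) (XX : R -> R -> 'M[R]_d)
    (u0 : 'rV[R]_d -> R) (u : R -> 'rV[R]_d -> R) :=
  Linfty_spacetime T u /\
  exists U : ('rV[R]_d -> R) -> R -> R,
    let U1 phi t : 'rV[R]_d := \row_i U (partial i phi) t in
    let U2 phi t : 'M[R]_d :=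
      \matrix_(i, j) U (partial j (partial i phi)) t in
    forall phi, test_function phi ->
    [/\ continuous_version T (fun t => pairing (u t) phi) (U phi),
        exists y', controlled T gamma X (fun t => (U phi t)%:M : 'rV[R]_1) y',
        controlled T gamma X (U1 phi) (U2 phi)
      & forall t, t \in `[0, T] ->
          exists2 I, is_rough_integral X XX (U1 phi) (U2 phi) 0 t I &
            U phi t = pairing u0 phi
              + \int[lebesgue_measure]_(s in `[0, t])
                  pairing (u s) (fun x => dotmul (b s x) (gradient phi x)
                                          + divb s x * phi x)
              + I].

(* Main.v *)
(* In the frame moving with X the rough term disappears: formally
   v_t(y) = u_t(y + X_t) solves dv/dt + b_t(y + X_t) . grad v = 0, a transport
   equation with bounded divergence.  No flow is needed to solve it: a bounded u
   is a continuous functional on L^1, so by Hahn-Banach and the duality of L^1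
   and L^oo it exists as soon as the backward equation satisfies
   |psi_0|_1 <= |(d/dt + div(b .)) psi|_1 on test functions; this follows by
   testing the weak divergence against a smooth approximation of |psi|.

   For a test function phi, the duality gives, for almost every t,
   u_t(phi(. - X_t)) = Lam_t(phi) with Lam_t(phi) Lipschitz in t, and the
   continuous version of u_t(phi) is U_t(phi) = Lam_t(phi(. + X_t)).  A Taylor
   expansion of phi(. + X_t) around phi(. + X_s) shows that U(phi) is controlled
   by X, with derivative U(grad phi), and to third order that
   U_t(phi) - U_s(phi) - drift agrees with the germ of the rough integral up to
   |t - s|^(3 gamma): the second-order term only sees the symmetric part of XX,
   which is X (x) X / 2 because X is geometric.  As 3 gamma > 1 the errors sum
   to zero over fine partitions. *)

Require Import Defs.
From HB Require Import structures.
From mathcomp Require Import all_boot all_order all_algebra.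
From mathcomp Require Import all_classical all_reals all_analysis.
From mathcomp Require Import measurable_realfun ess_sup_inf ring lra.
Import Order.TTheory GRing.Theory Num.Theory.
Import numFieldNormedType.Exports.
Set Implicit Arguments.
Unset Strict Implicit.
Unset Printing Implicit Defensive.
Local Open Scope classical_set_scope.
Local Open Scope ring_scope.

(** * The Hahn-Banach theorem and the dual of L^1 *)

(** The only derivative of b under control is its divergence, so no commutator estimate is available
    for u itself. The duality asks for an estimate on smooth curves psi only, where, up to
    smoothing, sign(psi) b . grad psi = b . grad |psi| holds pointwise. Testing div b against |psi|
    then cancels both terms that contain b: the estimate has constant 1 and u inherits the bound of
    u_0. In time psi is only Lipschitz, with bounded measurable derivative. The class must contain
    phi times the integral of theta over [t, T] for rough theta, because theta is later chosen as
    the defect of the equation. Hence differentiation of |psi| in time is replaced by convexity,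
    with errors quadratic in the length of a time step. Null sets of times are the other obstacle:
    they depend on the test function, while phi(. + X_t) changes with t. Rational translates and
    continuity in the translation remove this dependence. Lam is given at every t by an integral
    formula and not through u_t. *)

Section hahn_banach.
Context {R : realType} {V : lmodType R}.
Variables (D : set V) (p : V -> R).

(* Partial linear functionals dominated by p on D, represented by their graphs. *)
Definition dominated_graph (G : set (V * R)) :=
  [/\ G (0, 0),
      forall a v w, G v -> G w -> G (a *: v.1 + w.1, a * v.2 + w.2)
    & forall v, G v -> D v.1 /\ v.2 <= p v.1].

Hypothesis DL : forall a x y, D x -> D y -> D (a *: x + y).
Hypothesis pD : forall x y, D x -> D y -> p (x + y) <= p x + p y.
Hypothesis pZ : forall a x, 0 <= a -> D x -> p (a *: x) = a * p x.

Let D0 x : D x -> D 0.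
Proof. by move=> Dx; have := DL (-1) Dx Dx; rewrite scaleN1r addNr. Qed.

Let DZ a x : D x -> D (a *: x).
Proof. by move=> Dx; have := DL a Dx (D0 Dx); rewrite addr0. Qed.

(** The difference of two values over x lies over 0, where [p] vanishes by homogeneity, so
    domination alone forces single-valuedness. *)
Lemma dominated_graph_fun G x r s : dominated_graph G ->
  G (x, r) -> G (x, s) -> r = s.
Proof.
move=> [G0 GL GD].
have le u v : G (x, u) -> G (x, v) -> u <= v.
  move=> Gu Gv; have := GD _ (GL (-1) _ _ Gv Gu); rewrite /= scaleN1r addNr.
  move=> [D00]; have := pZ (lexx 0) D00; rewrite scaler0 mul0r => ->.
  by rewrite mulN1r addrC subr_le0.
by move=> Gr Gs; apply/eqP; rewrite eq_le !le.
Qed.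

(** The value [al] at x0 must satisfy v.2 - p (v.1 - x0) <= al <= p (x0 + w.1) - w.2 for all v, w in
    G, and subadditivity puts every lower bound below every upper one. The new graph is dominated
    even when x0 is already in the domain of G, hence single-valued in all cases. *)
Lemma dominated_graph_extend G x0 : dominated_graph G -> D x0 ->
  exists H, [/\ dominated_graph H, G `<=` H & exists r, H (x0, r)].
Proof.
move=> [G0 GL GD] Dx0.
have GZ a v : G v -> G (a *: v.1, a * v.2).
  by move=> Gv; have := GL a _ _ Gv G0; rewrite /= !addr0.
have D1 x : D x -> D (x0 + x) by move=> Dx; rewrite -[x0]scale1r; exact: DL.
have DB x : D x -> D (x - x0).
  by move=> Dx; rewrite addrC -scaleN1r; exact: DL.
pose S := [set v.2 - p (v.1 - x0) | v in G].
have Sle v w : G v -> G w -> v.2 - p (v.1 - x0) <= p (x0 + w.1) - w.2.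
  move=> Gv Gw; have [_] := GD _ (GL 1 _ _ Gv Gw).
  rewrite /= scale1r mul1r => le1.
  have [Dv _] := GD _ Gv; have [Dw _] := GD _ Gw.
  have := pD (DB _ Dv) (D1 _ Dw).
  rewrite addrA subrK => le2.
  by rewrite lerBrDr addrAC lerBlDr (le_trans le1)// (le_trans le2)// addrC.
have hsS : has_sup S.
  split; first by exists (0 - p (0 - x0)); exists (0, 0).
  exists (p (x0 + 0) - 0) => _ [v Gv <-]; exact: (Sle _ (0, 0)).
pose al := sup S.
have al1 v : G v -> v.2 - p (v.1 - x0) <= al.
  by move=> Gv; apply: sup_upper_bound => //; exists v.
have al2 w : G w -> al <= p (x0 + w.1) - w.2.
  move=> Gw; apply: ge_sup; first by case: hsS.
  by move=> _ [v Gv <-]; exact: Sle.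
pose H := [set v | exists a w, G w /\ v = (a *: x0 + w.1, a * al + w.2)].
exists H; split; last 2 first.
- by move=> [y s] Gy; exists 0, (y, s); split=> //=; rewrite scale0r mul0r !add0r.
- by exists al, 1, (0, 0); split=> //=; rewrite scale1r mul1r !addr0.
split.
- by exists 0, (0, 0); split=> //=; rewrite scale0r mul0r !add0r.
- move=> a _ _ [b1 [w1 [Gw1 ->]]] [b2 [w2 [Gw2 ->]]] /=.
  exists (a * b1 + b2), (a *: w1.1 + w2.1, a * w1.2 + w2.2); split.
    exact: GL.
  congr (_, _) => /=; last by ring.
  by rewrite scalerDr scalerDl -!addrA scalerA; congr (_ + _); rewrite addrCA.
move=> _ [a [w [Gw ->]]] /=; have [Dw wp] := GD _ Gw.
split; first exact: DL.
(* Dividing by |a| reduces a general multiple of x0 to the two inequalities [al1] and [al2]. *)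
have [a0|a0|->] := ltgtP a 0; last by rewrite scale0r mul0r !add0r.
- have c0 : 0 < - a by rewrite oppr_gt0.
  have := al1 _ (GZ (- a)^-1 _ Gw) => /=.
  rewrite lerBlDr -lerBlDl -(ler_pM2l c0) mulrBr -pZ//; last 2 first.
  - exact: ltW.
  - by apply: DB; exact: DZ.
  rewrite scalerBr scalerA mulrA divff ?gt_eqF// scale1r mul1r.
  by rewrite mulNr opprK scaleNr opprK addrC [w.1 + _]addrC.
- have := al2 _ (GZ a^-1 _ Gw) => /=.
  rewrite lerBrDr -(ler_pM2l a0) mulrDr -pZ//; last 2 first.
  - exact: ltW.
  - by apply: D1; exact: DZ.
  by rewrite scalerDr scalerA mulrA divff ?gt_eqF// scale1r mul1r.
Qed.

Theorem hahn_banach (G0 : set (V * R)) : dominated_graph G0 ->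
  exists F : V -> R, [/\ forall v, G0 v -> F v.1 = v.2,
    forall x, D x -> F x <= p x
    & forall a x y, D x -> D y -> F (a *: x + y) = a * F x + F y].
Proof.
move=> dG0.
have [|A [dA Amax]] := @Zorn_bigcup _ [set G | dominated_graph (G0 `|` G)].
  move=> F FP Ftot.
  (* Linearity involves two pairs at a time, and any two pairs of the union lie together in one
     member of the chain. *)
  have key u v : (G0 `|` \bigcup_(X in F) X) u ->
      (G0 `|` \bigcup_(X in F) X) v ->
      exists G, [/\ dominated_graph (G0 `|` G), (G0 `|` G) u, (G0 `|` G) v &
        G `<=` G0 `|` \bigcup_(X in F) X].
    move=> [u0|[X FX Xu]] [v0|[Y FY Yv]].
    - exists set0; rewrite setU0; split=> //; exact: sub0set.
    - exists Y; split; [exact: FP|by left|by right|].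
      by move=> z Yz; right; exists Y.
    - exists X; split; [exact: FP|by right|by left|].
      by move=> z Xz; right; exists X.
    - have [XY|YX] := Ftot _ _ FX FY.
        exists Y; split; [exact: FP|right; exact: XY|by right|].
        by move=> z Yz; right; exists Y.
      exists X; split; [exact: FP|by right|right; exact: YX|].
      by move=> z Xz; right; exists X.
  split.
  - by left; case: dG0.
  - move=> a u v Uu Uv; have [G [[_ GL _] Gu Gv GU]] := key _ _ Uu Uv.
    by have [?|/GU] := GL a _ _ Gu Gv; [left|].
  - by move=> v Uv; have [G [[_ _ GD] Gv _ _]] := key _ _ Uv Uv; exact: GD.
set G := G0 `|` A in dA.
have Gtot x : D x -> exists r, G (x, r).
  move=> Dx; apply: contrapT => nG.
  have [H [dH GH [r Hr]]] := dominated_graph_extend dA Dx.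
  apply: (Amax H).
    split; first by move=> z Az; apply: GH; right.
    by move=> HA; apply: nG; exists r; right; exact: HA.
  by rewrite /= (_ : G0 `|` H = H)//; apply/setUidr => z G0z; apply: GH; left.
have [F FE] : exists F : V -> R, forall x, D x -> G (x, F x).
  have /choice[F FP] : forall x, exists r, D x -> G (x, r).
    by move=> x; have [/Gtot[r]|nD] := pselect (D x); [exists r|exists 0].
  by exists F.
have [_ GL GD] := dA.
exists F; split.
- move=> [x r] G0x /=; have Gx : G (x, r) by left.
  apply: (dominated_graph_fun dA _ Gx); apply: FE.
  by have [] := GD _ Gx.
- by move=> x /FE/GD[].
- move=> a x y Dx Dy.
  apply: (dominated_graph_fun dA (FE _ _)); first exact: DL.
  exact: (GL a _ _ (FE _ Dx) (FE _ Dy)).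
Qed.

End hahn_banach.

(** * Real-valued integrable functions *)

Section real_integral.
Context d (T : measurableType d) (R : realType) (mu : {measure set T -> \bar R}).
Implicit Types f g : T -> R.

Definition rintegrable f := mu.-integrable setT (EFin \o f).

Lemma rintegrable_measurable f : rintegrable f -> measurable_fun setT f.
Proof. by move=> /measurable_int/measurable_EFinP. Qed.

Lemma rintegrableZD a f g : rintegrable f -> rintegrable g ->
  rintegrable (fun x => a * f x + g x).
Proof.
move=> intf intg; rewrite /rintegrable.
rewrite (_ : _ \o _ = (fun x => a%:E * (f x)%:E) \+ (EFin \o g))%E.
  by apply: integrableD => //; exact: integrableZl.
by apply/funext => x /=.
Qed.

Lemma rintegrable0 : rintegrable (fun=> 0).
Proof. exact: integrable0. Qed.

Lemma rintegrableZ a f : rintegrable f -> rintegrable (fun x => a * f x).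
Proof.
move=> intf; have := rintegrableZD a intf rintegrable0.
by rewrite /rintegrable; under eq_fun do rewrite addr0.
Qed.

Lemma rintegrableD f g : rintegrable f -> rintegrable g ->
  rintegrable (fun x => f x + g x).
Proof.
move=> intf intg; have := rintegrableZD 1 intf intg.
by rewrite /rintegrable; under eq_fun do rewrite mul1r.
Qed.

Lemma rintegrableN f : rintegrable f -> rintegrable (fun x => - f x).
Proof.
move=> intf; have := rintegrableZ (-1) intf.
by rewrite /rintegrable; under eq_fun do rewrite mulN1r.
Qed.

Lemma rintegrableB f g : rintegrable f -> rintegrable g ->
  rintegrable (fun x => f x - g x).
Proof. by move=> intf /rintegrableN; exact: rintegrableD. Qed.

Lemma rintegrable_sum I (s : seq I) (F : I -> T -> R) :
  (forall i, rintegrable (F i)) -> rintegrable (fun x => \sum_(i <- s) F i x).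
Proof.
move=> intF; elim: s => [|i s IH].
  by under eq_fun do rewrite big_nil; exact: rintegrable0.
by under eq_fun do rewrite big_cons; exact: rintegrableD.
Qed.

Lemma le_rintegrable f g : measurable_fun setT f ->
  (forall x, `|f x| <= `|g x|) -> rintegrable g -> rintegrable f.
Proof.
move=> mf fg; apply: le_integrable => //; first exact/measurable_EFinP.
by move=> x _; rewrite /= lee_fin.
Qed.

Lemma rintegrable_norm f : rintegrable f -> rintegrable (fun x => `|f x|).
Proof. exact: integrable_norm. Qed.

Lemma rintegrable_bddM f g M : measurable_fun setT f ->
  (forall x, `|f x| <= M) -> rintegrable g -> rintegrable (fun x => f x * g x).
Proof.
move=> mf fM intg; apply: (@le_rintegrable _ (fun x => M * g x)).
- by apply: measurable_funM => //; exact: rintegrable_measurable.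
- by move=> x; rewrite !normrM ler_wpM2r// (le_trans (fM x))// ler_norm.
- exact: rintegrableZ.
Qed.

Lemma rintegralZD a f g : rintegrable f -> rintegrable g ->
  \int[mu]_x (a * f x + g x) = a * \int[mu]_x f x + \int[mu]_x g x.
Proof.
by move=> intf intg; rewrite RintegralD ?RintegralZl//; exact: rintegrableZ.
Qed.

Lemma rintegral0 : \int[mu]_x (0 : R) = 0.
Proof. by rewrite /Rintegral integral0. Qed.

Lemma rintegralZ a f : rintegrable f ->
  \int[mu]_x (a * f x) = a * \int[mu]_x f x.
Proof. by move=> intf; rewrite RintegralZl. Qed.

Lemma rintegralN f : rintegrable f -> \int[mu]_x (- f x) = - \int[mu]_x f x.
Proof.
move=> intf; rewrite -mulN1r -rintegralZ//.
by apply: eq_Rintegral => x _; rewrite mulN1r.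
Qed.

Lemma rintegral_sum I (s : seq I) (F : I -> T -> R) :
  (forall i, rintegrable (F i)) ->
  \int[mu]_x (\sum_(i <- s) F i x) = \sum_(i <- s) \int[mu]_x F i x.
Proof.
move=> intF; elim: s => [|i s IH].
  by under eq_Rintegral do rewrite big_nil; rewrite big_nil rintegral0.
under eq_Rintegral do rewrite big_cons.
rewrite RintegralD ?IH ?big_cons//; first exact: intF.
exact: (rintegrable_sum s intF).
Qed.

Lemma le_rintegral f g : rintegrable f -> rintegrable g ->
  (forall x, f x <= g x) -> \int[mu]_x f x <= \int[mu]_x g x.
Proof. by move=> intf intg fg; apply: le_Rintegral. Qed.

Lemma rintegralE f : rintegrable f -> (\int[mu]_x f x)%:E = (\int[mu]_x (f x)%:E)%E.
Proof. by move=> intf; rewrite /Rintegral fineK//; exact: integrable_fin_num. Qed.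

Lemma ae_rintegral f g : measurable_fun setT f -> measurable_fun setT g ->
  {ae mu, forall x, f x = g x} -> \int[mu]_x f x = \int[mu]_x g x.
Proof.
move=> mf mg fg; rewrite /Rintegral; congr fine.
apply: ae_eq_integral => //; try exact/measurable_EFinP.
by apply: filterS fg => x /= -> _.
Qed.

End real_integral.
Arguments rintegrable {d T R} mu f.

(** * Representation of bounded functionals on L^1 *)

Section positive_integrable.
Context d (T : measurableType d) (R : realType)
  (mu : {sigma_finite_measure set T -> \bar R}).

Lemma ex_positive_rintegrable :
  exists w : T -> R, (forall x, 0 < w x) /\ rintegrable mu w.
Proof.
have [F FT Ffin] := @sigma_finiteT _ _ _ mu.
have mF n : measurable (F n) by have [] := Ffin n.
pose m n := fine (mu (F n)).
have m0 n : 0 <= m n by exact: fine_ge0.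
have muF n : mu (F n) = (m n)%:E.
  by rewrite fineK// ge0_fin_numE//; have [] := Ffin n.
pose g n : R := 1 / (2 ^ (n + 1))%:R.
have g0 n : 0 < g n by rewrite divr_gt0.
(* Dividing by 1 + m n keeps both c n and c n * m n below g n = 2^-(n+1), whose sum is 1: the first
   makes the series finite at each point, the second makes its integral finite. *)
pose c n : R := g n / (1 + m n).
have c0 n : 0 < c n by rewrite divr_gt0// ltr_pwDl.
have cm n : c n * m n <= g n.
  rewrite /c mulrAC -mulrA ler_piMr ?(ltW (g0 n))//.
  by rewrite ler_pdivrMr ?mul1r ?lerDr// ltr_pwDl.
have c1 n : c n <= g n.
  by rewrite /c ler_piMr ?(ltW (g0 n))// invf_le1 ?lerDl// ltr_pwDl.
pose W x : \bar R := (\sum_(n <oo) (c n * \1_(F n) x)%:E)%E.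
have W0 x : (0 <= W x)%E.
  by apply: nneseries_ge0 => n _ _; rewrite lee_fin mulr_ge0// ltW.
have geo2 : (\sum_(n <oo) (g n)%:E = 1%:E)%E.
  by have := @cvg_geometric_eseries_half R 1 0; rewrite expr0 divr1 => /cvg_lim ->.
have Wfin x : (W x <= 1%:E)%E.
  rewrite -geo2; apply: lee_nneseries => n _.
    by rewrite lee_fin mulr_ge0// ltW.
  rewrite lee_fin (le_trans _ (c1 n))// ler_piMr ?(ltW (c0 n))//.
have WE x : W x = (fine (W x))%:E.
  by rewrite fineK// ge0_fin_numE// (le_lt_trans (Wfin x))// ltry.
have mW : measurable_fun setT W.
  apply: ge0_emeasurable_sum => [n x _ _|n _]; first by rewrite lee_fin mulr_ge0// ltW.
  by apply/measurable_EFinP; apply: measurable_funM.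
exists (fine \o W); split.
  move=> x; have [n _ Fnx] : (\bigcup_n F n) x by rewrite -FT.
  rewrite fine_gt0// (le_lt_trans (Wfin x)) ?ltry// andbT.
  apply: (@lt_le_trans _ _ (c n * \1_(F n) x)%:E).
    by rewrite lte_fin indicE mem_set// mulr1.
  rewrite /W (@nneseriesD1 _ _ n)//; last by move=> k _; rewrite lee_fin mulr_ge0// ltW.
  by rewrite leeDl// nneseries_ge0// => k _ _; rewrite lee_fin mulr_ge0// ltW.
have -> : rintegrable mu (fine \o W) = mu.-integrable setT W.
  by rewrite /rintegrable; congr integrable; apply/funext => x /=; rewrite -WE.
apply/integrableP; split=> //.
apply: (@le_lt_trans _ _ 1%:E); last exact: ltry.
under eq_integral do rewrite gee0_abs//.
rewrite integral_nneseries//; last 2 first.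
- by move=> n; apply/measurable_EFinP; apply: measurable_funM.
- by move=> n x _; rewrite lee_fin mulr_ge0// ltW.
rewrite -geo2; apply: lee_nneseries => n _.
  by move=> _; apply: integral_ge0 => x _; rewrite lee_fin mulr_ge0// ltW.
under eq_integral do rewrite EFinM.
rewrite ge0_integralZl//.
- rewrite integral_indic// setIT.
  by rewrite [X in (_ * X)%E](muF n) -EFinM lee_fin.
- exact/measurable_EFinP.
- by rewrite lee_fin ltW.
Qed.

End positive_integrable.

Section L1_dual.
Context d (T : measurableType d) (R : realType)
  (mu : {sigma_finite_measure set T -> \bar R}).
Variables (F : (T -> R) -> R) (C : R).
Hypothesis FL : forall a f g, rintegrable mu f -> rintegrable mu g ->
  F (fun x => a * f x + g x) = a * F f + F g.
Hypothesis FC : forall f, rintegrable mu f -> F f <= C * \int[mu]_x `|f x|.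

Let F0 : F (fun=> 0) = 0.
Proof.
have := FL 1 (rintegrable0 mu) (rintegrable0 mu).
under eq_fun do rewrite mulr0 addr0.
by rewrite mul1r => /esym/eqP; rewrite addrC -subr_eq0 addrK => /eqP.
Qed.

Let FZ a f : rintegrable mu f -> F (fun x => a * f x) = a * F f.
Proof.
move=> intf; have := FL a intf (rintegrable0 mu).
by under eq_fun do rewrite addr0; rewrite F0 addr0.
Qed.

Let FD f g : rintegrable mu f -> rintegrable mu g ->
  F (fun x => f x + g x) = F f + F g.
Proof.
move=> intf intg; have := FL 1 intf intg.
by under eq_fun do rewrite mul1r; rewrite mul1r.
Qed.

Let FB f g : rintegrable mu f -> rintegrable mu g ->
  F (fun x => f x - g x) = F f - F g.
Proof.
move=> intf intg; have := FL (-1) intg intf.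
by under eq_fun do rewrite mulN1r addrC; rewrite mulN1r addrC.
Qed.

Let Fnorm f : rintegrable mu f -> `|F f| <= C * \int[mu]_x `|f x|.
Proof.
move=> intf; rewrite ler_norml FC// andbT lerNl -mulN1r -FZ//.
rewrite (le_trans (FC (rintegrableZ _ intf)))//.
by under eq_Rintegral do rewrite mulN1r normrN.
Qed.

Variable w : T -> R.
Hypothesis w0 : forall x, 0 < w x.
Hypothesis intw : rintegrable mu w.

(* As w is positive and integrable, this finite charge determines F even when mu
   is infinite. *)
Definition weighted_charge (A : set T) : \bar R :=
  if pselect (measurable A) is left _ then (F (fun x => \1_A x * w x))%:E
  else 0%E.

Let intwA A : measurable A -> rintegrable mu (fun x => \1_A x * w x).
Proof.
move=> mA; apply: (@rintegrable_bddM _ _ _ _ _ _ 1) => //.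
by move=> x; rewrite indicE; case: (_ \in _); rewrite ?normr1 ?normr0.
Qed.

Let wcE A : measurable A -> weighted_charge A = (F (fun x => \1_A x * w x))%:E.
Proof. by rewrite /weighted_charge; case: pselect. Qed.

Let wc0 : weighted_charge set0 = 0%E.
Proof.
by rewrite wcE//; under eq_fun do rewrite indic0 mul0r; rewrite F0.
Qed.

Let wcfin A : measurable A -> weighted_charge A \is a fin_num.
Proof. by move=> mA; rewrite wcE. Qed.

Let iw A : measurable A ->
  (\int[mu]_x (\1_A x * w x))%:E = induced_charge intw A.
Proof.
move=> mA; rewrite /induced_charge (rintegralE (intwA mA)) [RHS]integral_mkcond.
apply: eq_integral => x _; rewrite /patch indicE.
by case: (x \in A); rewrite ?mul1r ?mul0r.
Qed.

Let wc_sigma : semi_sigma_additive weighted_charge.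
Proof.
move=> A mA tA mUA.
have disj n x : \1_(\big[setU/set0]_(i < n) A i) x =
    \sum_(i < n) \1_(A i) x :> R.
  elim: n => [|n IHn]; first by rewrite !big_ord0 indic0.
  rewrite !big_ord_recr/= -IHn !indicE in_setU.
  have [xA|] := boolP (x \in A n); last by rewrite orbF addr0.
  rewrite (_ : (x \in \big[setU/set0]_(i < n) A i) = false) ?add0r//.
  apply/negP; rewrite inE -bigcup_mkord => -[k /= kn Akx].
  by move/trivIsetP: tA => /(_ k n I I); rewrite ltn_eqF// => /(_ isT)/seteqP[/(_ x)+ _];
    apply; split=> //; rewrite inE in xA.
(* The remainder after n sets. Its charge is at most C times the integral of [w] over it, which
   tends to 0 because [w] induces a sigma-additive charge. *)
pose B n := \bigcup_i A i `\` \big[setU/set0]_(i < n) A i.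
have mUn n : measurable (\big[setU/set0]_(i < n) A i).
  by apply: bigsetU_measurable.
have mB n : measurable (B n) by apply: measurableD.
have indB n x : \1_(B n) x = \1_(\bigcup_i A i) x - \sum_(i < n) \1_(A i) x :> R.
  rewrite -disj !indicE in_setD.
  have [xn|xn] := boolP (x \in \big[setU/set0]_(i < n) A i); last first.
    by rewrite andbT subr0.
  rewrite andbF mem_set ?subrr//.
  by move: xn; rewrite inE -bigcup_mkord => -[k _ Ak]; exists k.
have wB n : (fun x => \1_(B n) x * w x) = (fun x => \1_(\bigcup_i A i) x * w x -
    \sum_(i < n) \1_(A i) x * w x).
  by apply/funext => x; rewrite indB mulrBl mulr_suml.
have Fsum n : F (fun x => \sum_(i < n) \1_(A i) x * w x) =
    \sum_(i < n) F (fun x => \1_(A i) x * w x).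
  elim: n => [|n IHn].
    by rewrite big_ord0; under eq_fun do rewrite big_ord0.
  under eq_fun do rewrite big_ord_recr/=.
  rewrite FD ?IHn ?big_ord_recr//; last exact: intwA.
  by apply: rintegrable_sum => i; exact: intwA.
rewrite wcE// [X in X @ _](_ : _ =
    EFin \o (fun n => \sum_(i < n) F (fun x => \1_(A i) x * w x))); last first.
  apply/funext => n /=; rewrite big_mkord -sumEFin.
  by apply: eq_bigr => i _; exact: wcE.
apply: cvg_EFin; first exact: nearW.
rewrite (_ : fine \o _ = (fun n => \sum_(i < n) F (fun x => \1_(A i) x * w x)))//.
have : (\int[mu]_x (\1_(B n) x * w x)) @[n --> \oo] --> 0.
  have := @charge_semi_sigma_additive _ _ _ (induced_charge intw) _ mA tA mUA.
  rewrite -[X in _ --> X](iw mUA) => /fine_cvgP[_ cvgi].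
  rewrite -[X in _ --> X](subrr (\int[mu]_x (\1_(\bigcup_n A n) x * w x))).
  apply: cvg_trans (cvgB (cvg_cst _) cvgi).
  apply: near_eq_cvg; apply: nearW => n /=.
  rewrite wB RintegralB//; last 2 first.
  - exact: intwA.
  - by apply: rintegrable_sum => i; exact: intwA.
  rewrite rintegral_sum; last by move=> i; exact: intwA.
  congr (_ - _); rewrite /= big_mkord.
  by rewrite -(eq_bigr _ (fun (i : 'I_n) _ => iw (mA i))) sumEFin.
move=> /(cvgM (cvg_cst C)); rewrite mulr0 => cvgC.
apply/subr_cvg0; apply/norm_cvg0P.
apply: (@squeeze_cvgr _ _ _ _ (cst 0) (fun n => C * \int[mu]_x (\1_(B n) x * w x))) => //.
- apply: nearW => n; rewrite normr_ge0/=.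
  rewrite -normrN opprB -Fsum -FB; last 2 first.
  - exact: intwA.
  - by apply: rintegrable_sum => i; exact: intwA.
  rewrite -wB (le_trans (Fnorm (intwA _)))//.
  under eq_Rintegral do rewrite ger0_norm ?mulr_ge0 ?(ltW (w0 _))//.
  by [].
- exact: cvg_cst.
Qed.

HB.instance Definition _ := isCharge.Build _ _ _ weighted_charge
  wc0 wcfin wc_sigma.

Lemma weighted_charge_dominated : weighted_charge `<< mu.
Proof.
apply/null_content_dominatesP => A mA muA0.
rewrite wcE//; congr EFin; apply/eqP; rewrite -normr_le0.
rewrite (le_trans (Fnorm (intwA mA)))// (_ : \int[mu]_x _ = 0) ?mulr0//.
rewrite -[RHS](rintegral0 mu).
have mw := rintegrable_measurable intw.
apply: ae_rintegral => //; first exact/measurableT_comp/measurable_funM.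
exists A; split => // x; apply: contra_notP => nAx.
by rewrite /= indicE memNset// mul0r normr0.
Qed.

(** The charge is absolutely continuous with respect to [mu], so g is its Radon-Nikodym density; the
    function that represents F will be g / w. *)
Lemma L1_dual_density : exists g : T -> R, rintegrable mu g /\
  forall A, measurable A -> F (fun x => \1_A x * w x) = \int[mu]_x (\1_A x * g x).
Proof.
have numu := weighted_charge_dominated.
pose g := fine \o Radon_Nikodym weighted_charge mu.
have gE : EFin \o g = Radon_Nikodym weighted_charge mu.
  by apply/funext => x; rewrite /= fineK// Radon_Nikodym_fin_num.
have intg : rintegrable mu g by rewrite /rintegrable gE; exact: Radon_Nikodym_integrable.
exists g; split=> // A mA; apply: EFin_inj; rewrite -wcE//.
rewrite [LHS](Radon_Nikodym_integral numu mA) -gE rintegralE; last first.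
  apply: (@rintegrable_bddM _ _ _ _ _ _ 1) => //.
  by move=> x; rewrite indicE; case: (_ \in _); rewrite ?normr1 ?normr0.
rewrite [LHS]integral_mkcond; apply: eq_integral => x _; rewrite /patch indicE/=.
by case: (x \in A); rewrite ?mul1r ?mul0r.
Qed.

End L1_dual.

Section L1_dual_repr.
Context d (T : measurableType d) (R : realType)
  (mu : {sigma_finite_measure set T -> \bar R}).

Lemma ae_le_of_integrals (g h : T -> R) : rintegrable mu g -> rintegrable mu h ->
  (forall A, measurable A ->
     \int[mu]_x (\1_A x * g x) <= \int[mu]_x (\1_A x * h x)) ->
  {ae mu, forall x, g x <= h x}.
Proof.
move=> intg inth gh.
have mg := rintegrable_measurable intg; have mh := rintegrable_measurable inth.
have mgh : measurable_fun setT (fun x => g x - h x) by exact: measurable_funB.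
(* On the set where g exceeds h the positive function g - h has integral at most 0, so this set is
   null. *)
pose A := [set x | 0 < g x - h x].
have mA : measurable A.
  rewrite (_ : A = (fun x => g x - h x) @^-1` `]0, +oo[); last first.
    by apply/seteqP; split=> x /=; rewrite in_itv/= andbT.
  by rewrite -[X in measurable X]setTI; exact: mgh.
have intA f : rintegrable mu f -> rintegrable mu (fun x => \1_A x * f x).
  move=> intf; apply: (@rintegrable_bddM _ _ _ _ _ _ 1) => //.
  by move=> x; rewrite indicE; case: (_ \in _); rewrite ?normr1 ?normr0.
have k0 x : 0 <= \1_A x * (g x - h x).
  rewrite indicE; have [|] := boolP (x \in A); last by rewrite mul0r.
  by rewrite inE mul1r => /ltW.
have intk := intA _ (rintegrableB intg inth).
have : \int[mu]_x (\1_A x * (g x - h x)) = 0.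
  apply/eqP; rewrite eq_le Rintegral_ge0 ?andbT//.
  under eq_Rintegral do rewrite mulrBr.
  by rewrite RintegralB ?subr_le0 ?gh//; exact: intA.
move=> keq; have keq0 : (\int[mu]_x (\1_A x * (g x - h x))%:E = 0)%E.
  by rewrite -rintegralE// keq.
have mk := measurable_int _ intk.
have : (\int[mu]_x `|(\1_A x * (g x - h x))%:E| = 0)%E.
  by rewrite -keq0; apply: eq_integral => x _; rewrite gee0_abs ?lee_fin.
move=> keq1; have := (ae_eq_integral_abs mu measurableT mk).1 keq1.
apply: filterS => x /= /(_ I) [] kx; rewrite leNgt; apply/negP => hg.
have xA : A x by rewrite /A/= subr_gt0.
by move: kx; rewrite indicE mem_set// mul1r => /subr0_eq gx; rewrite gx ltxx in hg.
Qed.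


Import HBNNSimple.

(** With g the density of the charge, u = g / w gives the right value on simple functions multiplied
    by [w]. These are dense in L^1, where both sides are continuous. *)
Theorem L1_dual_representation (F : (T -> R) -> R) (C : R) :
  (forall a f g, rintegrable mu f -> rintegrable mu g ->
     F (fun x => a * f x + g x) = a * F f + F g) ->
  (forall f, rintegrable mu f -> F f <= C * \int[mu]_x `|f x|) ->
  exists u : T -> R, [/\ measurable_fun setT u, forall x, `|u x| <= `|C|
    & forall f, rintegrable mu f -> F f = \int[mu]_x (u x * f x)].
Proof.
move=> FL FC; have [w [w0 intw]] := ex_positive_rintegrable mu.
have [g [intg gE]] := L1_dual_density FL FC w0 intw.
have mg := rintegrable_measurable intg; have mw := rintegrable_measurable intw.
have F0 : F (fun=> 0) = 0.
  have := FL 1 _ _ (rintegrable0 mu) (rintegrable0 mu).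
  under eq_fun do rewrite mulr0 addr0.
  by rewrite mul1r => /esym/eqP; rewrite addrC -subr_eq0 addrK => /eqP.
have FZ a f : rintegrable mu f -> F (fun x => a * f x) = a * F f.
  move=> intf; have := FL a _ _ intf (rintegrable0 mu).
  by under eq_fun do rewrite addr0; rewrite F0 addr0.
have indle A x : `|\1_A x : R| <= 1.
  by rewrite indicE; case: (_ \in _); rewrite ?normr1 ?normr0.
have intA A f : measurable A -> rintegrable mu f ->
    rintegrable mu (fun x => \1_A x * f x).
  by move=> mA intf; exact: (@rintegrable_bddM _ _ _ _ _ _ 1).
have normA A : measurable A ->
    C * \int[mu]_x `|\1_A x * w x| = \int[mu]_x (\1_A x * (C * w x)).
  move=> mA; rewrite -rintegralZ; last exact/rintegrable_norm/intA.
  apply: eq_Rintegral => x _; rewrite ger0_norm ?mulr_ge0 ?(ltW (w0 _))//.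
  by rewrite mulrCA.
have gle1 : {ae mu, forall x, g x <= C * w x}.
  apply: ae_le_of_integrals => //; first exact: rintegrableZ.
  by move=> A mA; rewrite -gE// -normA// FC//; exact: intA.
have gle2 : {ae mu, forall x, - g x <= C * w x}.
  apply: ae_le_of_integrals; [exact: rintegrableN|exact: rintegrableZ|].
  move=> A mA; rewrite -normA//.
  under eq_Rintegral do rewrite mulrN.
  rewrite rintegralN ?intA// -gE// -mulN1r -FZ ?intA//.
  rewrite (le_trans (FC _ (rintegrableZ _ (intA _ _ mA intw))))//.
  by under eq_Rintegral do rewrite mulN1r normrN.
(* Clamping makes the bound hold everywhere; by [gle1] and [gle2] it alters g / w only on a null
   set. *)
pose u x := Num.max (- `|C|) (Num.min `|C| (g x / w x)).
have mwV : measurable_fun setT (fun x => (w x)^-1).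
  under eq_fun do rewrite -powR_inv1 ?ltW//.
  exact: (measurableT_comp (measurable_powR _)).
have mu_ : measurable_fun setT u.
  apply: measurable_maxr => //; apply: measurable_minr => //.
  exact: measurable_funM.
have uC x : `|u x| <= `|C|.
  by rewrite /u ler_norml le_max lexx/= ge_max ge_min lexx/= ge0_cp.
exists u; split=> //.
have ug : {ae mu, forall x, u x * w x = g x}.
  apply: filterS2 gle1 gle2 => x g1 g2.
  (* Adding the two bounds gives 0 <= 2 C w x at any point where both hold. *)
  have C0 : 0 <= C.
    have : 0 <= C * w x.
      by rewrite -(@pmulr_rge0 _ 2)// mulr_natl mulr2n (le_trans _ (lerD g1 g2))// subrr.
    by rewrite pmulr_lge0.
  rewrite /u (ger0_norm C0) min_r ?ler_pdivrMr// max_r ?mulfVK ?gt_eqF//.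
  by rewrite ler_pdivlMr// mulNr lerNl.
have Fsum (s : seq R) (A : R -> set T) : (forall y, measurable (A y)) ->
    F (fun x => (\sum_(y <- s) y * \1_(A y) x) * w x) =
    \int[mu]_x ((\sum_(y <- s) y * \1_(A y) x) * g x).
  move=> mA.
  have intB f s' : rintegrable mu f ->
      rintegrable mu (fun x => (\sum_(y <- s') y * \1_(A y) x) * f x).
    move=> intf; under eq_fun do rewrite mulr_suml.
    apply: rintegrable_sum => y; under eq_fun do rewrite -mulrA.
    by apply: rintegrableZ; exact: intA.
  elim: s => [|y s IH].
    under eq_fun do rewrite big_nil mul0r.
    by under eq_Rintegral do rewrite big_nil mul0r; rewrite F0 rintegral0.
  under eq_fun do rewrite big_cons mulrDl -mulrA.
  under eq_Rintegral do rewrite big_cons mulrDl -mulrA.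
  rewrite FL ?IH ?gE//; [|exact: intA|exact: intB].
  by rewrite rintegralZD//; [exact: intA|exact: intB].
have pos f : rintegrable mu f -> (forall x, 0 <= f x) -> F f = \int[mu]_x (u x * f x).
  move=> intf f0; have mf := rintegrable_measurable intf.
  (* Simple functions increase to f / w and not to f: multiplied by [w] they converge to f in L^1
     and have the form treated by [Fsum]. *)
  pose k x := (f x / w x)%:E.
  have mk : measurable_fun setT k by apply/measurable_EFinP; exact: measurable_funM.
  have k0 x : setT x -> (0 <= k x)%E by rewrite lee_fin divr_ge0// ltW.
  pose h := nnsfun_approx measurableT mk.
  have hk n x : h n x <= f x / w x.
    rewrite -lee_fin nnsfun_approxE.
    exact: (le_approx (D := setT)).
  have hwf n x : h n x * w x <= f x by rewrite -ler_pdivlMr.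
  have inth n : rintegrable mu (fun x => h n x * w x).
    apply: (le_rintegrable _ _ intf); first exact: measurable_funM.
    by move=> x; rewrite !ger0_norm// mulr_ge0// ltW.
  have Fh n : F (fun x => h n x * w x) = \int[mu]_x (u x * (h n x * w x)).
    under eq_fun do rewrite fimfunE fsbig_finite//=.
    rewrite Fsum//.
    apply: ae_rintegral.
    - apply: measurable_funM => //.
      under eq_fun do rewrite -fsbig_finite//= -fimfunE.
      exact: measurable_funP.
    - apply: measurable_funM => //; exact: measurable_funM.
    apply: filterS ug => x ux.
    by rewrite [in RHS]fimfunE fsbig_finite//= mulrCA ux.
  pose e n := \int[mu]_x `|f x - h n x * w x|.
  have int_e n : rintegrable mu (fun x => f x - h n x * w x) by exact: rintegrableB.
  have e_cvg : e n @[n --> \oo] --> 0.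
    have [|||||_ + _] := @dominated_convergence _ _ _ mu setT measurableT
      (fun n x => (h n x * w x)%:E) (EFin \o f) (EFin \o f).
    - by move=> n; apply/measurable_EFinP; exact: measurable_funM.
    - exact/measurable_EFinP.
    - apply: aeW => x _.
      have := cvg_nnsfun_approx measurableT mk k0 (I : setT x).
      move=> /fine_cvgP[_ /(cvgM (cvg_cst (w x)))]; rewrite mulrC divfK ?gt_eqF// => hf.
      apply: cvg_EFin; first exact: nearW.
      apply: cvg_trans hf; apply: near_eq_cvg; apply: nearW => n /=.
      by rewrite mulrC.
    - exact: intf.
    - by apply: aeW => x n _; rewrite /= lee_fin ger0_norm// mulr_ge0// ltW.
    move=> /fine_cvgP[_ +]; apply: cvg_trans; apply: near_eq_cvg; apply: nearW => n /=.
    by congr fine; apply: eq_integral => x _; rewrite /= distrC.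
  have Fe n : `|F f - \int[mu]_x (u x * f x)| <= (C + `|C|) * e n.
    have -> : F f - \int[mu]_x (u x * f x) = F (fun x => f x - h n x * w x) -
        \int[mu]_x (u x * (f x - h n x * w x)).
      have -> : F (fun x => f x - h n x * w x) = F f - F (fun x => h n x * w x).
        have := FL (-1) _ _ (inth n) intf.
        by under eq_fun do rewrite mulN1r addrC; rewrite mulN1r addrC.
      under [X in _ = _ - X]eq_Rintegral do rewrite mulrBr.
      rewrite RintegralB//; [|exact: (rintegrable_bddM mu_ uC)..].
      by rewrite Fh; ring.
    rewrite (le_trans (ler_normB _ _))// mulrDl lerD//.
      rewrite ler_norml FC// andbT lerNl -mulN1r -FZ//.
      rewrite (le_trans (FC _ (rintegrableZ _ (int_e n))))//.
      by under eq_Rintegral do rewrite mulN1r normrN.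
    rewrite (le_trans (le_normr_Rintegral _ _))//; first exact: (rintegrable_bddM mu_ uC).
    rewrite -rintegralZ ?rintegrable_norm//; apply: le_rintegral.
    - exact/rintegrable_norm/(rintegrable_bddM mu_ uC).
    - exact/rintegrableZ/rintegrable_norm.
    - by move=> x; rewrite normrM ler_wpM2r.
  apply/eqP; rewrite -subr_eq0 -normr_le0.
  have /cvg_lim <-// : (C + `|C|) * e n @[n --> \oo] --> (0 : R).
    by rewrite -[X in _ --> X](mulr0 (C + `|C|)); apply: cvgM => //; exact: cvg_cst.
  apply: limr_ge; last exact: nearW.
  by apply/cvg_ex; exists ((C + `|C|) * 0); apply: cvgM => //; exact: cvg_cst.
move=> f intf.
have mf := rintegrable_measurable intf.
have intp : rintegrable mu (fun x => `|f x| + f x).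
  by apply: rintegrableD => //; exact: rintegrable_norm.
have intn := rintegrable_norm intf.
have fE : f = (fun x => -1 * `|f x| + (`|f x| + f x)).
  by apply/funext => x; rewrite mulN1r addKr.
rewrite {1}fE FL// pos// pos//; last by move=> x; rewrite -lerBlDl sub0r lerNl ler_normr lexx orbT.
rewrite -rintegralZD; [|exact: (rintegrable_bddM mu_ uC)..].
by apply: eq_Rintegral => x _; ring.
Qed.

End L1_dual_repr.

Section L1_extension.
Context d (T : measurableType d) (R : realType)
  (mu : {sigma_finite_measure set T -> \bar R}).

(** The subspace and the functional on it are both given by an index i. That l depends on f i only
    follows from the bound, which makes the graph of the pairs (f i, l i) dominated and hence
    single-valued. *)
Theorem L1_bounded_functional (I : Type) (f : I -> T -> R) (l : I -> R) (C : R) :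
  0 <= C -> (forall i, rintegrable mu (f i)) ->
  (exists i, f i = (fun=> 0) /\ l i = 0) ->
  (forall a i j, exists k, f k = (fun x => a * f i x + f j x) /\
     l k = a * l i + l j) ->
  (forall i, l i <= C * \int[mu]_x `|f i x|) ->
  exists u : T -> R, [/\ measurable_fun setT u, forall x, `|u x| <= C
    & forall i, \int[mu]_x (u x * f i x) = l i].
Proof.
move=> C0 intf [z [fz lz]] flin lC.
pose D : set (T -> R^o) := [set g | rintegrable mu g].
pose p (g : T -> R^o) := C * \int[mu]_x `|g x : R|.
pose G : set ((T -> R^o) * R) := [set v | exists i, v = (f i, l i)].
have [||||F [FG Fp FL]] := @hahn_banach R (T -> R^o) D p _ _ _ G.
- by move=> a g h Dg Dh; exact: rintegrableZD.
- move=> g h Dg Dh; rewrite /p -mulrDr ler_wpM2l//.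
  rewrite -RintegralD//; [|exact: rintegrable_norm..].
  apply: le_rintegral => [|| x].
  - exact/rintegrable_norm/rintegrableD.
  - by apply: rintegrableD; exact: rintegrable_norm.
  - exact: ler_normD.
- move=> a g a0 Dg; rewrite /p mulrCA; congr (_ * _).
  rewrite -rintegralZ ?rintegrable_norm//.
  by apply: eq_Rintegral => x _; rewrite normrM ger0_norm.
- split.
  + by exists z; rewrite fz lz.
  + move=> a _ _ [i ->] [j ->]; have [k [fk lk]] := flin a i j.
    by exists k; rewrite fk lk.
  + by move=> _ [i ->]; split; [exact: intf|exact: lC].
have [u [mu_ uC uE]] := L1_dual_representation (F := F) FL Fp.
exists u; split=> //; first by rewrite (ger0_norm C0) in uC.
by move=> i; rewrite -uE// (FG (f i, l i))//; exists i.
Qed.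

End L1_extension.

(** * Calculus of test functions *)

Section smooth_closure.
Context {R : realType} {d : nat}.
Implicit Types (f g : 'rV[R]_d -> R) (i j : 'I_d) (x h : 'rV[R]_d).

Local Notation e_ i := (delta_mx ord0 i : 'rV[R]_d).

(** Smoothness quantifies over all iterated derivatives; a class of functions that is stable under
    one derivative is a coinductive witness for it. *)
Lemma smooth_coind (P : ('rV[R]_d -> R) -> Prop) :
  (forall g, P g -> [/\ continuous g, forall i x, derivable g x (e_ i)
    & forall i, P (partial i g)]) ->
  forall g, P g -> smooth g.
Proof.
move=> PP g Pg s; suff /PP[? ? _] : P (foldr partial g s) by [].
by elim: s => //= i s /PP[_ _]; exact.
Qed.

Lemma smooth_continuous f : smooth f -> continuous f.
Proof. by move=> /(_ [::])[]. Qed.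

Lemma smooth_derivable f i x : smooth f -> derivable f x (e_ i).
Proof. by move=> /(_ [::])[_]; apply. Qed.

Lemma smooth_partial f i : smooth f -> smooth (partial i f).
Proof. by move=> sf s; have := sf (rcons s i); rewrite foldr_rcons. Qed.

Lemma partialE i f x : partial i f x = 'D_(e_ i) f x.
Proof. by []. Qed.

(* Otherwise the closing tactics unfold these definitions and diverge. *)
Opaque smooth partial.

Inductive gen_alg (Q : set ('rV[R]_d -> R)) : ('rV[R]_d -> R) -> Prop :=
| gen_base f : Q f -> gen_alg Q f
| gen_cst c : gen_alg Q (cst c)
| gen_add f g : gen_alg Q f -> gen_alg Q g -> gen_alg Q (f + g)
| gen_mul f g : gen_alg Q f -> gen_alg Q g -> gen_alg Q (f * g).

(** By the Leibniz rule the generated algebra is stable under derivatives as soon as the derivatives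
    of the generators stay in it, so only generators have to be checked. *)
Lemma gen_alg_smooth (Q : set ('rV[R]_d -> R)) :
  (forall g, Q g -> [/\ continuous g, forall i x, derivable g x (e_ i)
    & forall i, gen_alg Q (partial i g)]) ->
  forall g, gen_alg Q g -> smooth g.
Proof.
move=> QP; apply: smooth_coind => g; elim=> {g}.
- by move=> g /QP.
- move=> c; split=> [x|i x|i]; [exact: cst_continuous|exact: derivable_cst|].
  rewrite (_ : partial i _ = cst 0); first exact: gen_cst.
  by apply/funext => x; rewrite partialE; exact: derive_cst.
- move=> f g gf [cf df pf] gg [cg dg pg]; split=> [x|i x|i].
  + exact: (continuousD (cf x) (cg x)).
  + exact: derivableD.
  + rewrite (_ : partial i _ = partial i f + partial i g); first exact: gen_add.
    by apply/funext => x; rewrite !partialE; exact: deriveD.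
- move=> f g gf [cf df pf] gg [cg dg pg]; split=> [x|i x|i].
  + exact: (continuousM (cf x) (cg x)).
  + exact: derivableM.
  + rewrite (_ : partial i _ = f * partial i g + g * partial i f).
      by apply: gen_add; exact: gen_mul.
    by apply/funext => x; rewrite partialE deriveM.
Qed.

Lemma smooth_gen f : gen_alg smooth f -> smooth f.
Proof.
apply: gen_alg_smooth => g sg; split=> [|i x|i].
- exact: smooth_continuous.
- exact: smooth_derivable.
- exact/gen_base/smooth_partial.
Qed.

Lemma smooth_cst (c : R) : smooth (cst c : 'rV[R]_d -> R).
Proof. exact/smooth_gen/gen_cst. Qed.

Lemma smoothD f g : smooth f -> smooth g -> smooth (fun x => f x + g x).
Proof. by move=> sf sg; apply/smooth_gen/gen_add; exact: gen_base. Qed.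

Lemma smoothM f g : smooth f -> smooth g -> smooth (fun x => f x * g x).
Proof. by move=> sf sg; apply/smooth_gen/gen_mul; exact: gen_base. Qed.

Lemma smoothZ c f : smooth f -> smooth (fun x => c * f x).
Proof. by move=> sf; exact: (smoothM (smooth_cst c) sf). Qed.

Lemma partialD i f g x : smooth f -> smooth g ->
  partial i (fun x => f x + g x) x = partial i f x + partial i g x.
Proof. by move=> sf sg; rewrite !partialE; apply: deriveD; exact: smooth_derivable. Qed.

Lemma partialZ i c f x : smooth f ->
  partial i (fun x => c * f x) x = c * partial i f x.
Proof. by move=> sf; rewrite !partialE; apply: deriveZ; exact: smooth_derivable. Qed.

Lemma partial_cst i c x : partial i (cst c) x = 0.
Proof. rewrite partialE; exact: derive_cst. Qed.

Definition shiftf (a : 'rV[R]_d) f := fun x => f (x + a).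

Lemma derivable_shiftf a f i x :
  derivable f (x + a) (e_ i) -> derivable (shiftf a f) x (e_ i).
Proof. by rewrite /derivable /shiftf/=; under [in X in _ -> X]eq_fun do rewrite -addrA. Qed.

Lemma partial_shiftf a f i : partial i (shiftf a f) = shiftf a (partial i f).
Proof.
apply/funext => x; rewrite /shiftf !partialE /derive/=.
by under [in LHS]eq_fun do rewrite -addrA.
Qed.

Lemma smooth_shiftf a f : smooth f -> smooth (shiftf a f).
Proof.
move=> sf; apply: (@smooth_coind [set h | exists2 g, smooth g & h = shiftf a g]); last by exists f.
move=> _ [g sg ->]; split=> [x|i x|i].
- apply: (@continuous_comp _ _ _ (fun x => x + a)).
    by apply: (@continuousD _ _ _ id (cst a)); [exact: cvg_id|exact: cst_continuous].
  exact: smooth_continuous.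
- exact/derivable_shiftf/smooth_derivable.
- by exists (partial i g); [exact: smooth_partial|exact: partial_shiftf].
Qed.

End smooth_closure.
Arguments shiftf {R d} a f.

(** * The mean value theorem along the coordinate axes *)

Section coordinate_mean_value.
Context {R : realType} {d : nat}.
Implicit Types (f g : 'rV[R]_d -> R) (i j : 'I_d) (x h : 'rV[R]_d).

Local Notation e_ i := (delta_mx ord0 i : 'rV[R]_d).

Lemma is_derive_coord f i x (t : R) : derivable f (x + t *: e_ i) (e_ i) ->
  is_derive t (1 : R) (fun s : R => f (x + s *: e_ i)) (partial i f (x + t *: e_ i)).
Proof.
move=> df.
have E : (fun h : R => h^-1 *: (((fun s => f (x + s *: e_ i)) \o shift t) (h *: 1) -
    f (x + t *: e_ i))) =
    (fun h : R => h^-1 *: ((f \o shift (x + t *: e_ i)) (h *: e_ i) - f (x + t *: e_ i))).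
  apply/funext => h /=; congr (_ *: (f _ - _)).
  by rewrite scalerDl addrCA [h *: 1]mulr1.
by split; rewrite ?partialE /derivable /derive E.
Qed.

Lemma mean_value_coord f i x (a : R) : (forall y, derivable f y (e_ i)) ->
  exists2 t, `|t| <= `|a| & f (x + a *: e_ i) - f x = a * partial i f (x + t *: e_ i).
Proof.
move=> df; pose F (s : R) := f (x + s *: e_ i).
have dF (s : R) : is_derive s (1 : R) F (partial i f (x + s *: e_ i)) by exact: is_derive_coord.
have cF : continuous F.
  move=> s; apply: differentiable_continuous; apply/derivable1_diffP.
  by have [] := dF s.
have F0 : F 0 = f x by rewrite /F scale0r addr0.
rewrite -/(F a) -F0; have [a0|a0] := leP 0 a.
  have [|t] := @MVT_segment _ F (fun s => partial i f (x + s *: e_ i)) 0 a a0 (fun s _ => dF s).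
    exact: continuous_subspaceT.
  rewrite in_itv/= subr0 => /andP[t0 ta] ->; exists t; last by rewrite mulrC.
  by rewrite !ger0_norm.
have [|t] := @MVT_segment _ F (fun s => partial i f (x + s *: e_ i)) a 0 (ltW a0) (fun s _ => dF s).
  exact: continuous_subspaceT.
rewrite in_itv/= => /andP[at0 t0] E; exists t; last by rewrite -opprB E; ring.
by rewrite !ler0_norm ?lerN2// ltW.
Qed.

Definition head_coords (h : 'rV[R]_d) (k : nat) : 'rV[R]_d :=
  \row_i (if (i < k)%N then h ord0 i else 0).

(** Only coordinate derivatives are given, so the segment from x to x + h is replaced by d moves
    along the axes. On the way each coordinate of the displacement is at most that of h in absolute
    value, which is the box where the derivatives are bounded. *)
Lemma mean_value_box f x h (A : R) : (forall y i, derivable f y (e_ i)) ->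
  (forall i (k : 'rV[R]_d), (forall j, `|k ord0 j| <= `|h ord0 j|) -> `|partial i f (x + k)| <= A) ->
  `|f (x + h) - f x| <= A * \sum_i `|h ord0 i|.
Proof.
move=> df fA.
have H0 : head_coords h 0 = 0 by apply/rowP => i; rewrite !mxE.
have Hd : head_coords h d = h by apply/rowP => i; rewrite !mxE ltn_ord.
have HS (k : 'I_d) : head_coords h k.+1 = head_coords h k + h ord0 k *: e_ k.
  apply/rowP => i; rewrite !mxE ltnS eqxx/=.
  have [->|ik] := eqVneq i k; first by rewrite leqnn ltnn mulr1 add0r.
  by rewrite mulr0 addr0 ltn_neqAle (negbTE ik : (i == k :> nat) = false).
rewrite -[in f (x + h)]Hd -[in f x](addr0 x) -H0.
have <- : \sum_(0 <= k < d) (f (x + head_coords h k.+1) - f (x + head_coords h k)) =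
    f (x + head_coords h d) - f (x + head_coords h 0).
  by rewrite (telescope_sumr (fun k => f (x + head_coords h k))).
rewrite big_mkord mulr_sumr (le_trans (ler_norm_sum _ _ _))//.
apply: ler_sum => k _; rewrite HS addrA.
have [t th ->] := mean_value_coord (x + head_coords h k) (h ord0 k) (fun y => df y k).
rewrite normrM mulrC ler_wpM2r// -addrA; apply: fA => j.
rewrite !mxE eqxx/=; have [->|jk] := eqVneq j k; first by rewrite ltnn add0r mulr1.
by rewrite mulr0 addr0; case: ifP => //; rewrite normr0.
Qed.

End coordinate_mean_value.

Section sup_norm.
Context {R : realType} {d : nat}.
Implicit Types (x : 'rV[R]_d).

Lemma coord_le_norm x i : `|x ord0 i| <= `|x|.
Proof.
rewrite [leRHS]/Num.Def.normr /= mx_normrE.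
by apply: le_trans (le_bigmax _ _ (ord0, i)).
Qed.

Lemma rV_norm_le x (a : R) : 0 <= a -> (forall i, `|x ord0 i| <= a) -> `|x| <= a.
Proof.
move=> a0 xa; rewrite [leLHS]/Num.Def.normr /= mx_normrE.
by apply: bigmax_le => // -[i j] _ /=; rewrite ord1.
Qed.

Lemma sum_norm_coord_le x : \sum_i `|x ord0 i| <= d%:R * `|x|.
Proof.
rewrite (@le_trans _ _ (\sum_(i < d) `|x|))//.
  by apply: ler_sum => i _; exact: coord_le_norm.
by rewrite sumr_const card_ord mulr_natl.
Qed.

Lemma rV_norm_le_mono x (y : 'rV[R]_d) :
  (forall i, `|x ord0 i| <= `|y ord0 i|) -> `|x| <= `|y|.
Proof.
by move=> xy; apply: rV_norm_le => // i; rewrite (le_trans (xy i))// coord_le_norm.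
Qed.

Lemma norm_delta_le (i : 'I_d) : `|delta_mx ord0 i : 'rV[R]_d| <= 1.
Proof.
apply: rV_norm_le => // j; rewrite mxE eqxx/=.
by case: (_ == _); rewrite ?normr1 ?normr0.
Qed.

End sup_norm.

Section second_order.
Context {R : realType} {d : nat}.
Implicit Types (f g : 'rV[R]_d -> R) (i j : 'I_d) (x h : 'rV[R]_d).

Local Notation e_ i := (delta_mx ord0 i : 'rV[R]_d).

(** The mean value theorem is applied to f (x + s e_j) - f x in direction i, then to [partial i f]
    in direction j. Each use moves the point by at most s, whence the radius 2 * s. *)
Lemma second_difference f i j x (s : R) : smooth f -> 0 < s ->
  exists2 y : 'rV[R]_d, `|y - x| <= 2 * s &
    f (x + s *: e_ i + s *: e_ j) - f (x + s *: e_ i) - (f (x + s *: e_ j) - f x) =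
    s ^+ 2 * partial j (partial i f) y.
Proof.
move=> sf s0; pose g y := shiftf (s *: e_ j) f y + (-1) * f y.
have ssf := smooth_shiftf (s *: e_ j) sf.
have sg : smooth g := smoothD ssf (smoothZ (-1) sf).
have [t ts Et] := mean_value_coord x s (fun y => @smooth_derivable _ _ _ i y sg).
have [u us Eu] := mean_value_coord (x + t *: e_ i) s
  (fun y => @smooth_derivable _ _ _ j y (smooth_partial i sf)).
exists (x + t *: e_ i + u *: e_ j).
  rewrite -(addrA x) addrAC subrr add0r (le_trans (ler_normD _ _))// mulr_natl mulr2n.
  rewrite (gtr0_norm s0) in ts us.
  have key (r : R) (k : 'I_d) : `|r| <= s -> `|r *: e_ k| <= s.
    by move=> rs; rewrite normrZ (le_trans _ rs)// ler_piMr// norm_delta_le.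
  by rewrite lerD// key.
rewrite (_ : _ - _ = g (x + s *: e_ i) - g x); last by rewrite /g /shiftf; ring.
rewrite Et /g (partialD i _ ssf (smoothZ (-1) sf)).
rewrite (partialZ i (-1) _ sf) partial_shiftf /shiftf mulN1r Eu.
ring.
Qed.

(** The second difference is symmetric in i and j, so the two mixed derivatives share a value at two
    points as close to x as desired, and they are continuous. The definition of [smooth] provides
    iterated partial derivatives without any symmetry. *)
Theorem partialC f i j x : smooth f ->
  partial i (partial j f) x = partial j (partial i f) x.
Proof.
move=> sf; apply/eqP; rewrite eq_sym; apply/negPn/negP => neq.
(* Half of the gap: two errors below e add up to less than the gap. *)
pose e := `|partial j (partial i f) x - partial i (partial j f) x| / 2.
have e0 : 0 < e by rewrite divr_gt0// normr_gt0 subr_eq0.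
have near_ k l : exists2 r : R, 0 < r &
    forall y, `|y - x| <= r -> `|partial k (partial l f) y - partial k (partial l f) x| < e.
  have cf : continuous (partial k (partial l f)).
    exact/smooth_continuous/smooth_partial/smooth_partial.
  have /cvgr_dist_lt/(_ _ e0) := cf x.
  move=> /nbhs_ballP[r /= r0 rP]; exists (r / 2); first exact: divr_gt0.
  move=> y yx; rewrite distrC; apply: rP.
  rewrite -ball_normE /ball_/= distrC (le_lt_trans yx)// ltr_pdivrMr// ltr_pMr//.
  by rewrite ltr1n.
have [r1 r10 P1] := near_ j i; have [r2 r20 P2] := near_ i j.
pose s := Num.min r1 r2 / 2.
have s0 : 0 < s by rewrite divr_gt0// lt_min r10.
have [y yx Ey] := second_difference i j x sf s0.
have [z zx Ez] := second_difference j i x sf s0.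
have yz : partial j (partial i f) y = partial i (partial j f) z.
  have s2 : s ^+ 2 != 0 by rewrite expf_eq0/= gt_eqF.
  apply: (mulfI s2); apply: (etrans (esym Ey)); apply: (etrans _ Ez).
  by rewrite [x + s *: e_ i + _]addrAC; ring.
have s2E : 2 * s = Num.min r1 r2 by rewrite /s mulrC divfK.
have y1 : `|y - x| <= r1 by apply: (le_trans yx); rewrite s2E ge_min lexx.
have z2 : `|z - x| <= r2 by apply: (le_trans zx); rewrite s2E ge_min lexx orbT.
have H1 := P1 y y1; have H2 := P2 z z2.
rewrite -yz in H2; rewrite distrC in H1.
have := le_lt_trans (ler_normD _ _) (ltrD H1 H2).
by rewrite addrA subrK /e -splitr ltxx.
Qed.

End second_order.

(** * Test functions with an explicit radius of support *)

Section test_functions.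
Context {R : realType} {d : nat}.
Implicit Types (f g phi : 'rV[R]_d -> R) (i j : 'I_d) (x h : 'rV[R]_d) (K : R).

Local Notation e_ i := (delta_mx ord0 i : 'rV[R]_d).

Definition vanish_out K f := forall x, K < `|x| -> f x = 0.

Lemma vanish_out_le K K' f : K <= K' -> vanish_out K f -> vanish_out K' f.
Proof. by move=> KK' Kf x K'x; apply: Kf; exact: le_lt_trans K'x. Qed.

(** Later estimates need a radius K of support, which can be uniform in a parameter and grows by |a|
    under a shift by a. *)
Lemma test_functionP f :
  test_function f <-> smooth f /\ exists K, vanish_out K f.
Proof.
split=> [[sf /compact_bounded[M [_ MP]]]|[sf [K Kf]]].
  split=> //; exists (M + 1) => x Mx; apply/eqP/negPn/negP => fx.
  have /MP MP1 : M < M + 1 by rewrite ltrDl.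
  have : `|x| <= M + 1 by apply: MP1; exact: subset_closure.
  by rewrite leNgt Mx.
split=> //.
pose B := [set x : 'rV[R]_d | `|x| <= K].
have cB : closed B.
  rewrite (_ : B = (fun x : 'rV[R]_d => `|x|) @^-1` [set r | r <= K])//.
  apply: closed_comp; last exact: closed_le.
  by move=> x _; exact: norm_continuous.
have sB : closure [set x | f x != 0] `<=` B.
  rewrite [B](_ : _ = closure B); last exact/closure_id.
  by apply: closure_subset => x /= /eqP fx; rewrite /B/= leNgt; apply/negP => /Kf.
apply: bounded_closed_compact; last exact: closed_closure.
exists K; split; first exact: num_real.
by move=> M KM x /sB /= xK; rewrite (le_trans xK)// ltW.
Qed.

Lemma test_smooth f : test_function f -> smooth f.
Proof. by case. Qed.

Lemma test_vanish f : test_function f -> exists2 K, 0 < K & vanish_out K f.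
Proof.
move=> /test_functionP[_ [K Kf]]; exists (Num.max K 1); first by rewrite lt_max ltr01 orbT.
by apply: vanish_out_le Kf; rewrite le_max lexx.
Qed.

Lemma vanish_partial K f i : vanish_out K f -> vanish_out K (partial i f).
Proof.
move=> Kf x Kx.
have : \forall y \near x, f y = (cst 0 : 'rV[R]_d -> R) y.
  have : \forall y \near x, K < `|y|.
    exact: (cvgr_gt (`|x|) (@norm_continuous _ _ x)).
  by apply: filterS => y /Kf.
by move=> /near_eq_derive; rewrite !partialE => ->; exact: derive_cst.
Qed.

Lemma test_partial i f : test_function f -> test_function (partial i f).
Proof.
move=> /test_functionP[sf [K Kf]]; apply/test_functionP; split.
  exact: smooth_partial.
by exists K; exact: vanish_partial.
Qed.

Lemma testD f g : test_function f -> test_function g ->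
  test_function (fun x => f x + g x).
Proof.
move=> /test_functionP[sf [K Kf]] /test_functionP[sg [L Lg]].
apply/test_functionP; split; first exact: smoothD.
exists (Num.max K L) => x; rewrite gt_max => /andP[/Kf -> /Lg ->].
by rewrite addr0.
Qed.

Lemma testMl f g : smooth f -> test_function g -> test_function (fun x => f x * g x).
Proof.
move=> sf /test_functionP[sg [L Lg]]; apply/test_functionP; split; first exact: smoothM.
by exists L => x /Lg ->; rewrite mulr0.
Qed.

Lemma testZ c f : test_function f -> test_function (fun x => c * f x).
Proof. by move=> tf; apply: testMl => //; exact: smooth_cst. Qed.

Lemma test0 : test_function (cst 0 : 'rV[R]_d -> R).
Proof. by apply/test_functionP; split; [exact: (smooth_cst 0)|exists 0]. Qed.

Lemma vanish_shiftf K a f : vanish_out K f -> vanish_out (K + `|a|) (shiftf a f).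
Proof.
move=> Kf x Kx; apply: Kf; move: Kx; rewrite -ltrBrDr => /lt_le_trans; apply.
by rewrite lerBlDr -[x in `|x|](addrK a) ler_normB.
Qed.

Lemma test_shiftf a f : test_function f -> test_function (shiftf a f).
Proof.
move=> /test_functionP[sf [K Kf]]; apply/test_functionP; split.
  exact: smooth_shiftf.
by exists (K + `|a|); exact: vanish_shiftf.
Qed.

Lemma test_bounded f : test_function f -> exists2 M, 0 < M & forall x, `|f x| <= M.
Proof.
move=> tf; have [sf cf] := tf.
have cabs : {within closure [set x | f x != 0], continuous (fun x => `|f x|)}.
  apply: continuous_subspaceT => x; apply: continuous_comp; last exact: norm_continuous.
  exact: smooth_continuous.
have [M [_ MP]] := compact_bounded (continuous_compact cabs cf).
exists (Num.max 0 M + 1); first by rewrite ltr_wpDl// le_max lexx.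
move=> x; have [->|fx] := eqVneq (f x) 0.
  by rewrite normr0 addr_ge0// le_max lexx.
have := MP (Num.max 0 M + 1); rewrite (le_lt_trans (_ : M <= Num.max 0 M)) ?ltrDl//; last first.
  by rewrite le_max lexx orbT.
move=> /(_ isT) MP1; rewrite -[`|f x|]normr_id; apply: MP1.
by exists x => //; exact: subset_closure.
Qed.

Lemma test_family_bound (I : finType) (F : I -> 'rV[R]_d -> R) :
  (forall k, test_function (F k)) -> exists2 A, 0 <= A & forall k x, `|F k x| <= A.
Proof.
move=> tF; have /choice[A' HA'] : forall k, exists A', forall x, `|F k x| <= A'.
  by move=> k; have [A' _ HA'] := test_bounded (tF k); exists A'.
exists (\sum_k `|A' k|) => [|k x]; first exact: sumr_ge0.
rewrite (le_trans (HA' k x))// (le_trans (ler_norm _))// (bigD1 k)//= lerDl.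
exact: sumr_ge0.
Qed.

Lemma test_C1_bound f : test_function f -> exists2 A, 0 <= A &
  (forall x, `|f x| <= A) /\ (forall i x, `|partial i f x| <= A).
Proof.
move=> tf; have [A A0 fA] := test_bounded tf.
have [A' A'0 dfA] := test_family_bound (fun i => test_partial i tf).
exists (A + A'); first by rewrite addr_ge0 ?(ltW A0).
split=> [x|i x]; first by rewrite (le_trans (fA x))// lerDl.
by rewrite (le_trans (dfA i x))// lerDr ltW.
Qed.

End test_functions.

(** * Taylor remainders of orders two and three *)

Section taylor.
Context {R : realType} {d : nat}.
Implicit Types (f g phi : 'rV[R]_d -> R) (i j : 'I_d) (x h : 'rV[R]_d).

Local Notation e_ i := (delta_mx ord0 i : 'rV[R]_d).

Lemma lipschitz_bound f (A : R) : smooth f -> 0 <= A ->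
  (forall i y, `|partial i f y| <= A) ->
  forall x h, `|f (x + h) - f x| <= A * d%:R * `|h|.
Proof.
move=> sf A0 fA x h.
rewrite (le_trans (@mean_value_box _ _ f x h A _ _))//.
- by move=> y i; exact: smooth_derivable.
- by rewrite -mulrA ler_wpM2l// sum_norm_coord_le.
Qed.

Definition taylor1 f x h := f (x + h) - f x - \sum_i h ord0 i * partial i f x.

Definition taylor2 f x h := taylor1 f x h -
  2^-1 * \sum_i \sum_j h ord0 i * h ord0 j * partial j (partial i f) x.

Lemma is_derive_coord_fun i j (h : 'rV[R]_d) :
  is_derive h (e_ j) (fun k : 'rV[R]_d => k ord0 i) ((i == j)%:R).
Proof.
have E : (fun t : R => t^-1 *: (((fun k : 'rV[R]_d => k ord0 i) \o shift h) (t *: e_ j) - h ord0 i))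
   @ 0^' --> ((i == j)%:R : R).
  apply: cvg_near_cst; near=> t.
  have t0 : t != 0 by near: t; exact: nbhs_dnbhs_neq.
  by rewrite /= !mxE addrK eqxx/= [LHS]mulrA mulVf// mul1r.
split; first by apply/cvg_ex; exists ((i == j)%:R).
by rewrite /derive; apply/cvg_lim.
Unshelve. all: by end_near. Qed.

Lemma is_derive_shift_arg f x h i : smooth f ->
  is_derive h (e_ i) (fun k => f (x + k)) (partial i f (x + h)).
Proof.
move=> sf; rewrite (_ : (fun k => _) = shiftf x f).
  rewrite addrC -[partial i f _]/(shiftf x (partial i f) h) -partial_shiftf.
  by apply/derivableP/derivable_shiftf/smooth_derivable.
by apply/funext => k; rewrite /shiftf addrC.
Qed.

Lemma is_derive_taylor1 f x h j : smooth f ->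
  is_derive h (e_ j) (taylor1 f x) (partial j f (x + h) - partial j f x).
Proof.
move=> sf; pose F (i : 'I_d) := (fun k : 'rV[R]_d => k ord0 i * partial i f x).
have dF i : is_derive h (e_ j) (F i) ((i == j)%:R * partial i f x).
  rewrite (_ : F i = (partial i f x) *: (fun k : 'rV[R]_d => k ord0 i)).
    by apply: is_derive_eq; [exact/is_deriveZ/is_derive_coord_fun|rewrite /= mulrC].
  by apply/funext => k; rewrite /F mulrC.
rewrite (_ : taylor1 f x = (fun k => f (x + k)) - cst (f x) - \sum_i F i).
  apply: is_derive_eq.
    by apply: is_deriveB; apply: is_deriveB; exact: is_derive_shift_arg.
  rewrite /= subr0; congr (_ - _); rewrite (bigD1 j)//= eqxx mul1r big1 ?addr0//.
  by move=> i /negbTE ->; rewrite mul0r.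
by apply/funext => k; rewrite /taylor1 /= !fctE fct_sumE.
Qed.

(** As a function of h the remainder vanishes at 0 and its derivatives are first differences of
    [partial i f], so the mean value inequality raises the order by one. Each use costs a factor d,
    from the sum of the |h_i|. *)
Lemma taylor1_bound f (A : R) : smooth f -> 0 <= A ->
  (forall i j y, `|partial j (partial i f) y| <= A) ->
  forall x h, `|taylor1 f x h| <= A * d%:R ^+ 2 * `|h| ^+ 2.
Proof.
move=> sf A0 fA x h.
have T0 : taylor1 f x 0 = 0.
  by rewrite /taylor1 addr0 subrr sub0r big1 ?oppr0// => i _; rewrite mxE mul0r.
have Td y i := is_derive_taylor1 x y i sf.
have := @mean_value_box _ _ (taylor1 f x) 0 h (A * d%:R * `|h|) _ _.
rewrite add0r T0 subr0 => H; apply: (le_trans (H _ _)).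
- by move=> y i; have [] := Td y i.
- move=> i k kh; rewrite add0r partialE; have [_ ->] := Td k i.
  rewrite (le_trans (lipschitz_bound (smooth_partial i sf) A0 _ x k))//.
  by rewrite ler_wpM2l ?mulr_ge0// rV_norm_le_mono.
- rewrite (le_trans (ler_wpM2l _ (sum_norm_coord_le _)))// ?mulr_ge0//.
  by rewrite le_eqVlt; apply/orP; left; apply/eqP; ring.
Qed.

(** Differentiating the quadratic term gives two sums, equal by symmetry of the second derivatives,
    which cancels the factor 1/2. This lets the third-order bound be deduced from the second-order
    one for [partial l f]. *)
Lemma is_derive_taylor2 f x h l : smooth f ->
  is_derive h (e_ l) (taylor2 f x) (taylor1 (partial l f) x h).
Proof.
move=> sf.
pose G (i : 'I_d) := \sum_(j < d)
  (partial j (partial i f) x *: ((fun k : 'rV[R]_d => k ord0 i) * (fun k : 'rV[R]_d => k ord0 j))).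
have dG i : is_derive h (e_ l) (G i)
    (\sum_j partial j (partial i f) x *: (h ord0 i *: (j == l)%:R + h ord0 j *: (i == l)%:R)).
  apply: is_derive_sum => j.
  have Dij := is_deriveM (is_derive_coord_fun i l h) (is_derive_coord_fun j l h).
  exact: (is_deriveZ (partial j (partial i f) x) Dij).
rewrite (_ : taylor2 f x = taylor1 f x - (2^-1 : R) *: (\sum_i G i)).
  apply: is_derive_eq.
    by apply: is_deriveB; exact: is_derive_taylor1.
  rewrite /taylor1 /=; congr (_ - _).
  transitivity (2^-1 * \sum_i (h ord0 i * partial i (partial l f) x +
      \sum_j (i == l)%:R * (h ord0 j * partial j (partial i f) x))).
    congr (_ * _); apply: eq_bigr => i _.
    rewrite (eq_bigr (fun j => (j == l)%:R * (h ord0 i * partial j (partial i f) x) +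
        (i == l)%:R * (h ord0 j * partial j (partial i f) x))); last first.
      by move=> j _; rewrite /GRing.scale/=; ring.
    rewrite big_split/=; congr (_ + _); rewrite (bigD1 l)//= eqxx mul1r big1 ?addr0.
      exact: (congr1 (fun z => h ord0 i * z) (@partialC _ _ f l i x sf)).
    by move=> j /negbTE ->; rewrite mul0r.
  rewrite big_split/= [X in _ * (_ + X)](bigD1 l)//= [X in _ * (_ + (_ + X))]big1; last first.
    by move=> i /negbTE ->; rewrite big1// => j _; rewrite mul0r.
  rewrite addr0 eqxx; under [X in _ * (_ + X)]eq_bigr do rewrite mul1r.
  by set S := \sum_(i < d) _; field.
apply/funext => k; rewrite /taylor2 /= !fctE; congr (_ - _).
rewrite /GRing.scale/= fct_sumE; congr (_ * _).
apply: eq_bigr => i _; rewrite /G fct_sumE; apply: eq_bigr => j _.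
by rewrite /GRing.scale/= mulrC.
Qed.

Lemma taylor2_bound f (A : R) : smooth f -> 0 <= A ->
  (forall i j l y, `|partial l (partial j (partial i f)) y| <= A) ->
  forall x h, `|taylor2 f x h| <= A * d%:R ^+ 3 * `|h| ^+ 3.
Proof.
move=> sf A0 fA x h.
have T0 : taylor2 f x 0 = 0.
  rewrite /taylor2 /taylor1 addr0 subrr sub0r big1 ?oppr0; last first.
    by move=> i _; rewrite mxE mul0r.
  rewrite big1 ?mulr0 ?subr0// => i _; rewrite big1// => j _.
  by rewrite mxE !mul0r.
have Td y i := is_derive_taylor2 x y i sf.
have := @mean_value_box _ _ (taylor2 f x) 0 h (A * d%:R ^+ 2 * `|h| ^+ 2) _ _.
rewrite add0r T0 subr0 => H; apply: (le_trans (H _ _)).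
- by move=> y i; have [] := Td y i.
- move=> i k kh; rewrite add0r partialE; have [_ ->] := Td k i.
  rewrite (le_trans (taylor1_bound (smooth_partial i sf) A0 _ x k))//.
  rewrite ler_wpM2l ?mulr_ge0// ?exprn_ge0// lerXn2r ?nnegrE//.
  exact: rV_norm_le_mono.
- rewrite (le_trans (ler_wpM2l _ (sum_norm_coord_le _)))// ?mulr_ge0// ?exprn_ge0//.
  by rewrite le_eqVlt; apply/orP; left; apply/eqP; ring.
Qed.

End taylor.

(** * A smooth approximation of the absolute value *)

Section soft_absolute_value.
Context {R : realType}.
Variable e : R.
Hypothesis e0 : 0 < e.

(** [soft_abs] is sqrt(y^2 + e^2) - e and [soft_sign] is its derivative. Both are polynomials in y
    and [rsqrt_shift], whose own derivative is again such a polynomial, so smoothness follows by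
    closure. Subtracting e gives the value 0 at 0, which preserves supports. *)
Definition rsqrt_shift (y : R) := (Num.sqrt (y ^+ 2 + e ^+ 2))^-1.
Definition soft_abs (y : R) := (y ^+ 2 + e ^+ 2) * rsqrt_shift y - e.
Definition soft_sign (y : R) := y * rsqrt_shift y.

Let pos (y : R) : 0 < y ^+ 2 + e ^+ 2.
Proof. by rewrite ltr_wpDl ?sqr_ge0// exprn_gt0. Qed.

Let spos (y : R) : 0 < Num.sqrt (y ^+ 2 + e ^+ 2).
Proof. by rewrite sqrtr_gt0. Qed.

Let absE (y : R) : soft_abs y = Num.sqrt (y ^+ 2 + e ^+ 2) - e.
Proof.
rewrite /soft_abs /rsqrt_shift -[X in X * _]sqr_sqrtr ?(ltW (pos y))//.
by rewrite expr2 mulfK// gt_eqF.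
Qed.

Let le_sqrt (y : R) : `|y| <= Num.sqrt (y ^+ 2 + e ^+ 2).
Proof. by rewrite -sqrtr_sqr ler_wsqrtr// lerDl sqr_ge0. Qed.

Lemma soft_abs0 : soft_abs 0 = 0.
Proof. by rewrite absE expr0n/= add0r sqrtr_sqr gtr0_norm// subrr. Qed.

Lemma soft_sign0 : soft_sign 0 = 0.
Proof. by rewrite /soft_sign mul0r. Qed.

Lemma soft_abs_ge (y : R) : `|y| - e <= soft_abs y.
Proof. by rewrite absE lerD2r. Qed.

Lemma soft_abs_ge0 (y : R) : 0 <= soft_abs y.
Proof.
rewrite absE subr_ge0 -[leLHS]gtr0_norm// -sqrtr_sqr ler_wsqrtr//.
by rewrite lerDr sqr_ge0.
Qed.

Lemma soft_sign_le1 (y : R) : `|soft_sign y| <= 1.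
Proof.
rewrite normrM /rsqrt_shift normfV (ger0_norm (sqrtr_ge0 _)).
by rewrite ler_pdivrMr// mul1r.
Qed.

(** The difference equals e - e^2 / sqrt(y^2 + e^2). It measures how far smoothing breaks y sign(y)
    = |y|, and it is what the divergence term leaves in the energy estimate. *)
Lemma soft_sign_abs_le (y : R) : soft_sign y * y - soft_abs y <= e.
Proof.
rewrite /soft_sign mulrAC -expr2 /soft_abs mulrDl opprB addrC opprD addrA.
have : 0 <= e ^+ 2 * rsqrt_shift y by rewrite mulr_ge0 ?sqr_ge0// invr_ge0 sqrtr_ge0.
lra.
Qed.

Lemma soft_sign_abs_ge0 (y : R) : 0 <= soft_sign y * y - soft_abs y.
Proof.
rewrite /soft_sign mulrAC -expr2 /soft_abs mulrDl.
suff : e ^+ 2 * rsqrt_shift y <= e by lra.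
rewrite /rsqrt_shift ler_pdivrMr// expr2 ler_pM2l//.
by rewrite -[leLHS]gtr0_norm// -sqrtr_sqr ler_wsqrtr// lerDr sqr_ge0.
Qed.

(** The tangent inequality reduces to Cauchy-Schwarz for the vectors (y, e) and (z, e), where the
    gap between the squares is (e (y - z))^2. *)
Lemma soft_abs_convex (y z : R) : soft_abs y - soft_abs z <= soft_sign y * (y - z).
Proof.
rewrite !absE /soft_sign /rsqrt_shift opprB addrA subrK mulrAC ler_pdivlMr//.
rewrite mulrBl -expr2 sqr_sqrtr ?(ltW (pos y))//.
suff : y * z + e ^+ 2 <= Num.sqrt (z ^+ 2 + e ^+ 2) * Num.sqrt (y ^+ 2 + e ^+ 2).
  by rewrite mulrBr -expr2; lra.
rewrite -sqrtrM ?(ltW (pos z))// (le_trans (ler_norm _))//.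
rewrite -sqrtr_sqr ler_wsqrtr//.
have : 0 <= (e * (y - z)) ^+ 2 by exact: sqr_ge0.
by nra.
Qed.

Let is_derive_sqrD (y : R) :
  is_derive y (1 : R) (fun z => z ^+ 2 + e ^+ 2) (2 * y).
Proof.
rewrite (_ : (fun z => _) = (@id R) ^+ 2 + cst (e ^+ 2)).
  by apply: is_derive_eq; rewrite addr0 [_ *: _]mulr1 expr1.
by apply/funext => z; rewrite !fctE.
Qed.

Lemma is_derive_rsqrt_shift (y : R) :
  is_derive y (1 : R) rsqrt_shift (- y * rsqrt_shift y ^+ 3).
Proof.
pose p (y : R) := y ^+ 2 + e ^+ 2.
have dp := is_derive_sqrD y : is_derive y (1 : R) p (2 * y).
have ds : is_derive y (1 : R) (Num.sqrt \o p) ((2 * Num.sqrt (p y))^-1 * (2 * y)).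
  have dsq : is_derive (p y) (1 : R) Num.sqrt (2 * Num.sqrt (p y))^-1.
    exact: is_derive1_sqrt (pos y).
  exact: (@is_derive1_comp _ Num.sqrt p y _ _ dsq dp).
have s0 : (Num.sqrt \o p) y != 0 by rewrite gt_eqF//; exact: spos.
rewrite (_ : rsqrt_shift = (fun z => ((Num.sqrt \o p) z)^-1))//.
apply: (is_derive_eq (is_deriveV s0 ds)).
rewrite /rsqrt_shift -/(p y) /= /GRing.scale/=.
by field; rewrite gt_eqF//=; exact: spos.
Qed.

Context {d : nat}.
Implicit Types (psi : 'rV[R]_d -> R).

Local Notation e_ i := (delta_mx ord0 i : 'rV[R]_d).

Lemma is_derive_comp_coord (g dg : R -> R) psi i (x : 'rV[R]_d) : smooth psi ->
  (forall y, is_derive y (1 : R) g (dg y)) ->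
  is_derive x (e_ i) (g \o psi) (dg (psi x) * partial i psi x).
Proof.
move=> spsi Dg.
have Dl : is_derive (0 : R) (1 : R) (fun t : R => psi (x + t *: e_ i)) (partial i psi x).
  have := @is_derive_coord _ _ psi i x 0 (smooth_derivable spsi).
  by rewrite scale0r addr0.
have Dc : is_derive (0 : R) (1 : R) (g \o (fun t : R => psi (x + t *: e_ i)))
    (dg (psi x) * partial i psi x).
  have := @is_derive1_comp _ g (fun t : R => psi (x + t *: e_ i)) 0 _ _ (Dg _) Dl.
  by rewrite scale0r addr0.
have E : (fun h : R => h^-1 *: (((g \o (fun t : R => psi (x + t *: e_ i))) \o shift (0:R)) (h *: (1:R)) -
   (g \o (fun t : R => psi (x + t *: e_ i))) 0)) =
  (fun h : R => h^-1 *: (((g \o psi) \o shift x) (h *: e_ i) - (g \o psi) x)).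
  by apply/funext => h /=; rewrite scale0r !addr0 [x + _]addrC [h *: (1 : R)]mulr1.
by case: Dc; rewrite /derivable /derive E => ? ?; split.
Qed.

Lemma smooth_soft psi : smooth psi ->
  smooth (soft_abs \o psi) /\ smooth (soft_sign \o psi).
Proof.
move=> spsi; pose q := rsqrt_shift \o psi.
(* Besides the smooth functions q is the only generator; its derivative - psi q^3 [partial i psi]
   stays in the algebra. *)
pose Q := [set g : 'rV[R]_d -> R | smooth g \/ g = q].
have Dq i x := is_derive_comp_coord i x spsi is_derive_rsqrt_shift.
have cq : continuous q.
  move=> x; apply: continuous_comp; first exact: smooth_continuous.
  apply: differentiable_continuous; apply/derivable1_diffP.
  by have [] := is_derive_rsqrt_shift (psi x).
have qQ : gen_alg Q q by apply: gen_base; right.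
have sQ f : smooth f -> gen_alg Q f by move=> sf; apply: gen_base; left.
have QP g : Q g -> [/\ continuous g, forall i x, derivable g x (e_ i)
    & forall i, gen_alg Q (partial i g)].
  move=> [sg|->]; split=> [|i x|i].
  - exact: smooth_continuous.
  - exact: smooth_derivable.
  - exact/sQ/smooth_partial.
  - exact: cq.
  - by have [] := Dq i x.
  - rewrite (_ : partial i q = cst (-1) * psi * (q * q * q) * partial i psi).
      apply: gen_mul; last exact/sQ/smooth_partial.
      apply: gen_mul; last by do 2 apply: gen_mul => //.
      by apply: gen_mul; [exact: gen_cst|exact: sQ].
    apply/funext => x; rewrite [LHS]partialE; have [_ ->] := Dq i x.
    by rewrite /q !fctE /=; ring.
split; apply: (gen_alg_smooth QP).
  rewrite (_ : _ \o _ = (psi * psi + cst (e ^+ 2)) * q + cst (- e)).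
    apply: gen_add; last exact: gen_cst.
    apply: gen_mul => //; apply: gen_add; last exact: gen_cst.
    by apply: gen_mul; exact: sQ.
  by apply/funext => x; rewrite !fctE /= /soft_abs expr2.
rewrite (_ : _ \o _ = psi * q); first by apply: gen_mul => //; exact: sQ.
by apply/funext => x; rewrite !fctE.
Qed.

Lemma is_derive_soft_abs (y : R) : is_derive y (1 : R) soft_abs (soft_sign y).
Proof.
pose p (y : R) := y ^+ 2 + e ^+ 2.
have dp := is_derive_sqrD y : is_derive y (1 : R) p (2 * y).
have Dr := is_derive_rsqrt_shift y.
rewrite (_ : soft_abs = p * rsqrt_shift - cst e).
  apply: is_derive_eq.
  rewrite subr0 /GRing.scale/= /soft_sign /p /rsqrt_shift.
  have E : y ^+ 2 + e ^+ 2 = Num.sqrt (y ^+ 2 + e ^+ 2) ^+ 2.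
    by rewrite sqr_sqrtr// ltW.
  by rewrite [X in X * (- y * _)]E; field; rewrite gt_eqF.
by apply/funext.
Qed.

Lemma partial_soft_abs psi i x : smooth psi ->
  partial i (soft_abs \o psi) x = soft_sign (psi x) * partial i psi x.
Proof.
move=> spsi; rewrite [LHS]partialE.
by have [_ ->] := is_derive_comp_coord i x spsi is_derive_soft_abs.
Qed.

Lemma test_soft_abs psi : test_function psi -> test_function (soft_abs \o psi).
Proof.
move=> /test_functionP[spsi [K Kpsi]]; apply/test_functionP; split.
  by have [] := smooth_soft spsi.
by exists K => x /Kpsi /= ->; exact: soft_abs0.
Qed.

Lemma test_soft_sign psi : test_function psi -> test_function (soft_sign \o psi).
Proof.
move=> /test_functionP[spsi [K Kpsi]]; apply/test_functionP; split.
  by have [] := smooth_soft spsi.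
by exists K => x /Kpsi /= ->; exact: soft_sign0.
Qed.

End soft_absolute_value.

(** * Integration on R^d and in time *)

Section continuous_measurable_rV.
Context {R : realType} {d : nat}.

Let grid (n : nat) (x : 'rV[R]_d) : 'rV[int]_d :=
  \row_i Num.floor (x ord0 i * n.+1%:R).

Let ungrid (n : nat) (v : 'rV[int]_d) : 'rV[R]_d :=
  \row_i ((v ord0 i)%:~R / n.+1%:R).

Let measurable_grid n (v : 'rV[int]_d) : measurable [set x | grid n x = v].
Proof.
rewrite (_ : [set _ | _] = \bigcap_(i in [set: 'I_d])
  (fun x : 'rV[R]_d => x ord0 i * n.+1%:R) @^-1` `[(v ord0 i)%:~R, (v ord0 i + 1)%:~R[).
  apply: fin_bigcap_measurable => // i _.
  rewrite -[X in measurable X]setTI.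
  by apply: measurable_funM => //; exact: measurable_coord.
apply/seteqP; split=> x /= xv.
  by move=> i _ /=; rewrite in_itv/= -xv mxE floor_itv.
apply/rowP => i; rewrite mxE; apply/floor_def.
by have := xv i I; rewrite /= in_itv.
Qed.

Let ungrid_cvg x : ungrid n (grid n x) @[n --> \oo] --> x.
Proof.
apply/cvgrPdist_le => e e0; near=> n.
apply: rV_norm_le; first exact: ltW.
move=> i; rewrite !mxE.
have /andP[le1 lt2] := floor_itv (x ord0 i * n.+1%:R).
have n0 : 0 < n.+1%:R :> R by [].
have ne : 1 <= e * n.+1%:R.
  rewrite -ler_pdivrMl// mulr1 (@le_trans _ _ n%:R)//; last by rewrite ler_nat.
  by near: n; exact: nbhs_infty_ger.
rewrite -(ler_pM2r n0) -[X in _ * X <= _]ger0_norm// -normrM mulrBl divfK ?gt_eqF//.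
rewrite ger0_norm ?subr_ge0// (le_trans _ ne)// lerBlDl.
by rewrite intrD1 in lt2; exact: ltW.
Unshelve. all: by end_near. Qed.

(** The sigma-algebra is generated by the coordinates, not by the open sets. A continuous f is the
    limit of its values at points rounded down to the grid of mesh 1/(n+1), and each of these
    approximations takes countably many values, on measurable cells. *)
Lemma continuous_measurable_rV (f : 'rV[R]_d -> R) :
  continuous f -> measurable_fun setT f.
Proof.
move=> cf; apply: (@measurable_fun_cvg _ _ _ setT (fun n x => f (ungrid n (grid n x)))); last first.
  by move=> x _; apply: continuous_cvg; [exact: cf|exact: ungrid_cvg].
move=> n _ B mB; rewrite setTI.
pose S := [set v | B (f (ungrid n v))].
rewrite (_ : _ @^-1` _ = \bigcup_(v in [set: 'rV[int]_d])
    (if v \in S then [set x | grid n x = v] else set0)).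
  apply: countable_bigcupT_measurable; first exact: countableP.
  by move=> v; case: ifP => _; [exact: measurable_grid|].
apply/seteqP; split=> x /= => [Bx|[v _]].
  by exists (grid n x) => //; rewrite ifT// inE.
by case: ifPn => //; rewrite inE => Sv /= gx; move: Sv; rewrite -gx.
Qed.

End continuous_measurable_rV.

(** * Translation invariance of Lebesgue measure *)

Section translation_invariance.
Context {R : realType}.

Local Notation push m mf :=
  (measure_function_pushforward__canonical__measure_function_Measure m mf).

Lemma measurable_addr (a : R) :
  measurable_fun [set: measurableTypeR R] (fun x : measurableTypeR R => x + a : measurableTypeR R).
Proof. by apply: measurable_funD. Qed.

Lemma lebesgue_measure_translate (a : R) (A : set (measurableTypeR R)) :
  measurable A -> lebesgue_measure ((fun x : R => x + a) @^-1` A) = lebesgue_measure A.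
Proof.
move=> mA; symmetry.
apply: (@lebesgue_measure_unique R (push (@lebesgue_measure R) (measurable_addr a))) => //.
move=> _ [[x y] _ <-] /=; rewrite /pushforward.
rewrite (_ : _ @^-1` _ = `]x - a, y - a]%classic); last first.
  by apply/seteqP; split=> z /=; rewrite !in_itv/= ltrBlDr lerBrDr.
by rewrite !lebesgue_measure_itv/= !lte_fin ltrD2r; case: ifP => // _; rewrite -!EFinD; congr EFin; ring.
Qed.

Lemma measurable_addr_rV d (a : 'rV[R]_d) :
  measurable_fun [set: 'rV[R]_d] (fun x => x + a).
Proof.
apply: measurable_fun_rVP => i; under eq_fun do rewrite mxE.
by apply: measurable_funD => //; exact: measurable_coord.
Qed.

(** Induction on the dimension: through [cons_rV] a translation splits into one of the first
    coordinate and one of the others, and a product measure is determined by its values on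
    rectangles. *)
Lemma lebesgue_rV_translate d (a : 'rV[R]_d) (A : set 'rV[R]_d) :
  measurable A -> lebesgue_rV d ((fun x => x + a) @^-1` A) = lebesgue_rV d A.
Proof.
elim: d a A => [|n IH] a A mA.
  congr (lebesgue_rV 0 _); apply/seteqP.
  by split=> x; rewrite /= (_ : x + a = x)//; apply/rowP => -[].
pose b := uncons_rV a.
pose sh (p : measurableTypeR R * 'rV[R]_n) : measurableTypeR R * 'rV[R]_n := (p.1 + b.1, p.2 + b.2).
have msh : measurable_fun setT sh.
  apply: measurable_fun_pair.
    exact: (measurableT_comp (measurable_addr b.1) measurable_fst).
  exact: (measurableT_comp (measurable_addr_rV b.2) measurable_snd).
have shE p : cons_rV p + a = cons_rV (sh p).
  apply/rowP => i; rewrite !mxE; case: unliftP => [j ->|->] /=; by rewrite ?mxE.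
have mB : measurable (@cons_rV R n @^-1` A).
  by rewrite -[X in measurable X]setTI; exact: measurable_cons_rV.
rewrite /= /lebesgue_rV_step /pushforward.
rewrite (_ : _ @^-1` _ = sh @^-1` (@cons_rV R n @^-1` A)); last first.
  by apply/seteqP; split=> p /=; rewrite shE.
symmetry; apply: (@product_measure_unique _ _ _ _ _ (@lebesgue_measure R) (lebesgue_rV n)
  (push (lebesgue_measure \x lebesgue_rV n)%E msh)) => //.
move=> C D mC mD; rewrite /= /pushforward.
rewrite (_ : sh @^-1` _ = ((fun x => x + b.1) @^-1` C) `*` ((fun x => x + b.2) @^-1` D))//.
have mC' : measurable ((fun x : measurableTypeR R => x + b.1 : measurableTypeR R) @^-1` C).
  by rewrite -[X in measurable X]setTI; exact: measurable_addr.
have mD' : measurable ((fun x : 'rV[R]_n => x + b.2) @^-1` D).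
  by rewrite -[X in measurable X]setTI; exact: measurable_addr_rV.
rewrite product_measure1E //.
by congr (_ * _)%E; [exact: lebesgue_measure_translate|exact: IH].
Qed.

Lemma rintegral_translate d (a : 'rV[R]_d) (f : 'rV[R]_d -> R) :
  rintegrable (lebesgue_rV d) f -> rintegrable (lebesgue_rV d) (fun x => f (x + a)) ->
  \int[lebesgue_rV d]_x f (x + a) = \int[lebesgue_rV d]_x f x.
Proof.
move=> intf intfa; rewrite /Rintegral; congr fine.
have <- := @integral_pushforward _ _ _ _ R _ (measurable_addr_rV a) (lebesgue_rV d) setT
  (EFin \o f) (measurable_int _ intf) intfa measurableT.
apply: (@eq_measure_integral _ _ _ setT (lebesgue_rV d)
  (push (lebesgue_rV d) (measurable_addr_rV a))) => A mA _.
exact: lebesgue_rV_translate.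
Qed.

End translation_invariance.

(** * Bounded functions that vanish outside a cube *)

Section bounded_support_integrals.
Context {R : realType} {d : nat}.
Local Notation lam := (@lebesgue_rV R d).
Implicit Types (f g : 'rV[R]_d -> R) (K M : R).

Definition cube K : set 'rV[R]_d := [set x | `|x| <= K].

Lemma measurable_norm_rV : measurable_fun [set: 'rV[R]_d] (fun x => `|x|).
Proof. by apply: continuous_measurable_rV; exact: norm_continuous. Qed.

Lemma measurable_cube K : measurable (cube K).
Proof.
rewrite (_ : cube K = (fun x : 'rV[R]_d => `|x|) @^-1` `]-oo, K]).
  by rewrite -[X in measurable X]setTI; exact: measurable_norm_rV.
by apply/seteqP; split=> x /=; rewrite in_itv.
Qed.

Lemma lebesgue_cube_lty K : (lam (cube K) < +oo)%E.
Proof.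
apply: (@le_lt_trans _ _ (lam [set x | forall i : 'I_d, `[- K, K]%classic (x ord0 i)])).
  apply: le_measure; rewrite ?inE.
  - exact: measurable_cube.
  - rewrite (_ : (fun x => _) = \bigcap_(i in [set: 'I_d])
      (fun x : 'rV[R]_d => x ord0 i) @^-1` `[- K, K]).
      apply: fin_bigcap_measurable => // i _.
      by rewrite -[X in measurable X]setTI; exact: measurable_coord.
    by apply/seteqP; split=> x H i; [move=> _; exact: H|exact: (H i I)].
  - move=> x xK i; rewrite /= in_itv/= -ler_norml.
    by rewrite (le_trans (coord_le_norm _ _)).
rewrite (@lebesgue_rV_box R d (fun=> `[- K, K]%classic)) => [|i]; last exact: measurable_itv.
rewrite -ge0_fin_numE; last by apply: prode_ge0.
by apply: prode_fin_num => i _; rewrite lebesgue_measure_itv/=; case: ifP.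
Qed.

Definition vol K := fine (lam (cube K)).

Lemma vol_ge0 K : 0 <= vol K.
Proof. exact: fine_ge0. Qed.

Lemma rintegrable_cube K : rintegrable lam (fun x => \1_(cube K) x).
Proof.
have mK := measurable_cube K.
apply/integrableP; split; first by apply/measurable_EFinP; exact: measurable_indic.
under eq_integral do rewrite gee0_abs ?lee_fin//.
by rewrite integral_indic// setIT; exact: lebesgue_cube_lty.
Qed.

Lemma bounded_support_integrable f M K : measurable_fun setT f ->
  (forall x, `|f x| <= M) -> vanish_out K f -> rintegrable lam f.
Proof.
move=> mf fM fK; apply: (@le_rintegrable _ _ _ _ _ (fun x => M * \1_(cube K) x)) => //.
  move=> x; rewrite indicE; have [xK|xK] := boolP (x \in cube K).
    by rewrite mulr1 (le_trans (fM x))// ler_norm.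
  rewrite mulr0 normr0 fK ?normr0//.
  by rewrite notin_setE/= /cube/= in xK; rewrite ltNge; exact/negP.
exact/rintegrableZ/rintegrable_cube.
Qed.

Lemma bounded_support_le f M K : measurable_fun setT f ->
  (forall x, `|f x| <= M) -> vanish_out K f -> `|\int[lam]_x f x| <= M * vol K.
Proof.
move=> mf fM fK.
have M0 : 0 <= M by rewrite (le_trans _ (fM 0)).
have intf := bounded_support_integrable mf fM fK.
have intK := rintegrable_cube K.
apply: (le_trans (le_normr_Rintegral _ intf)) => //.
apply: (@le_trans _ _ (\int[lam]_x (M * \1_(cube K) x))).
  apply: le_rintegral; [exact: rintegrable_norm|exact: rintegrableZ|].
  move=> x; rewrite indicE; have [xK|xK] := boolP (x \in cube K).
    by rewrite mulr1.
  rewrite mulr0 fK ?normr0//.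
  by rewrite notin_setE/= /cube/= in xK; rewrite ltNge; exact/negP.
rewrite rintegralZ// ler_wpM2l//.
rewrite /Rintegral integral_indic//; last exact: measurable_cube.
by rewrite setIT.
Qed.

Lemma test_measurable phi : test_function phi -> measurable_fun [set: 'rV[R]_d] phi.
Proof. by move=> /test_smooth/smooth_continuous; exact: continuous_measurable_rV. Qed.

Lemma test_integrable phi : test_function phi -> rintegrable lam phi.
Proof.
move=> tphi; have [M _ phiM] := test_bounded tphi.
have [K _ phiK] := test_vanish tphi.
exact: (bounded_support_integrable (test_measurable tphi) phiM phiK).
Qed.

End bounded_support_integrals.

(** * Fubini's theorem for bounded functions supported in a box *)

Section boxed_functions.
Context d1 d2 (T1 : measurableType d1) (T2 : measurableType d2) (R : realType).
Variables (m1 : {sigma_finite_measure set T1 -> \bar R})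
  (m2 : {sigma_finite_measure set T2 -> \bar R}).
Variables (S1 : set T1) (S2 : set T2).
Hypotheses (mS1 : measurable S1) (mS2 : measurable S2)
  (fS1 : (m1 S1 < +oo)%E) (fS2 : (m2 S2 < +oo)%E).
Implicit Types (F : T1 -> T2 -> R) (M : R).

(** This class makes integrability on the product and on every section automatic, so that Fubini's
    theorem applies without further checks. *)
Definition boxed M F :=
  [/\ measurable_fun setT (fun p : T1 * T2 => F p.1 p.2),
      forall x y, `|F x y| <= M & forall x y, F x y != 0 -> S1 x /\ S2 y].

Lemma boxed_section F x M : boxed M F -> measurable_fun setT (F x).
Proof.
by case=> mF _ _; exact: (measurableT_comp mF (measurable_pair1 x)).
Qed.

Lemma boxed_section2 F y M : boxed M F -> measurable_fun setT (F^~ y).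
Proof.
by case=> mF _ _; exact: (measurableT_comp mF (measurable_pair2 y)).
Qed.

Lemma support_integrable d (T : measurableType d) (m : {measure set T -> \bar R})
  (S : set T) (f : T -> R) M : measurable S -> (m S < +oo)%E ->
  measurable_fun setT f -> (forall x, `|f x| <= M) -> (forall x, f x != 0 -> S x) ->
  rintegrable m f /\ \int[m]_x `|f x| <= M * fine (m S).
Proof.
move=> mS fS mf fM fsupp.
have intS : rintegrable m (\1_S).
  apply/integrableP; split; first by apply/measurable_EFinP; exact: measurable_indic.
  under eq_integral do rewrite gee0_abs ?lee_fin//.
  by rewrite integral_indic// setIT.
have fle x : `|f x| <= M * \1_S x.
  have [->|f0] := eqVneq (f x) 0.
    by rewrite normr0 mulr_ge0// (le_trans _ (fM x)).
  by rewrite indicE mem_set ?mulr1//; exact: fsupp.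
have intf : rintegrable m f.
  apply: (le_rintegrable mf _ (rintegrableZ M intS)) => x.
  by rewrite (le_trans (fle x))// ler_norm.
split=> //; rewrite (@le_trans _ _ (\int[m]_x (M * \1_S x)))//.
  by apply: le_rintegral => //; [exact: rintegrable_norm|exact: rintegrableZ].
by rewrite rintegralZ// /Rintegral integral_indic// setIT.
Qed.

Lemma boxed_integrable F M : boxed M F -> rintegrable (m1 \x m2)%E (fun p => F p.1 p.2).
Proof.
case=> mF FM Fsupp.
have mS : measurable (S1 `*` S2) by exact: measurableX.
have fS : ((m1 \x m2) (S1 `*` S2) < +oo)%E.
  rewrite [X in (X < _)%E](_ : _ = (m1 S1 * m2 S2)%E); last exact: product_measure1E.
  by rewrite lte_mul_pinfty// ge0_fin_numE.
by have [] := support_integrable mS fS mF (fun p => FM p.1 p.2) (fun p => @Fsupp p.1 p.2).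
Qed.

Lemma boxed_section_bound F x M : boxed M F ->
  rintegrable m2 (F x) /\ \int[m2]_y `|F x y| <= M * fine (m2 S2).
Proof.
move=> bF; have [mF FM Fsupp] := bF.
exact: (support_integrable mS2 fS2 (boxed_section x bF) (FM x) (fun y => fun h => proj2 (@Fsupp x y h))).
Qed.

Lemma boxed_section_integrable F x M : boxed M F -> rintegrable m2 (F x).
Proof. by move=> /(boxed_section_bound x)[]. Qed.

Lemma boxed_section_integrable2 F y M : boxed M F -> rintegrable m1 (F^~ y).
Proof.
move=> bF; have [mF FM Fsupp] := bF.
by have [] := support_integrable mS1 fS1 (boxed_section2 y bF) (FM^~ y)
  (fun x => fun h => proj1 (@Fsupp x y h)).
Qed.

Lemma boxed_section_le F x M : boxed M F -> `|\int[m2]_y F x y| <= M * fine (m2 S2).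
Proof.
move=> bF; rewrite (le_trans (le_normr_Rintegral _ (boxed_section_integrable x bF)))//.
by have [] := boxed_section_bound x bF.
Qed.

Lemma boxed_integral_rintegrable F M : boxed M F ->
  rintegrable m1 (fun x => \int[m2]_y F x y).
Proof.
move=> bF; have := integrable_fubini_F (boxed_integrable bF).
rewrite /rintegrable /fubini_F; congr integrable; apply/funext => x /=.
by rewrite rintegralE//; exact: (boxed_section_integrable x bF).
Qed.

Lemma boxed_fubini F M : boxed M F ->
  \int[(m1 \x m2)%E]_p F p.1 p.2 = \int[m1]_x \int[m2]_y F x y.
Proof.
move=> bF; rewrite /Rintegral; congr fine.
rewrite -(integral12_prod_meas1 (boxed_integrable bF)) /fubini_F.
apply: eq_integral => x _ /=.
by rewrite [RHS]rintegralE//; exact: (boxed_section_integrable x bF).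
Qed.

Lemma boxed_fubini2 F M : boxed M F ->
  \int[(m1 \x m2)%E]_p F p.1 p.2 = \int[m2]_y \int[m1]_x F x y.
Proof.
move=> bF; rewrite /Rintegral; congr fine.
rewrite -(integral21_prod_meas1 (boxed_integrable bF)) /fubini_G.
apply: eq_integral => y _ /=.
by rewrite [RHS]rintegralE//; exact: (boxed_section_integrable2 y bF).
Qed.

Lemma boxed_norm F M : boxed M F -> boxed M (fun x y => `|F x y|).
Proof.
case=> mF FM Fs; split.
- exact: measurableT_comp.
- by move=> x y; rewrite normr_id.
- by move=> x y; rewrite normr_eq0; exact: Fs.
Qed.

End boxed_functions.

(** * Integrals over time intervals *)

Section time_integrals.
Context {R : realType}.
Local Notation leb := (@lebesgue_measure R).
Implicit Types (h k : R -> R) (s t : R).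

Lemma integral_itv_integrable h (i : interval R) :
  rintegrable leb h -> leb.-integrable [set` i] (EFin \o h).
Proof. by move=> inth; apply: integrableS inth => //; exact: measurable_itv. Qed.

Lemma integral_itv_split h a s t : rintegrable leb h -> a <= s -> s <= t ->
  \int[leb]_(r in `[a, t]) h r =
  \int[leb]_(r in `[a, s]) h r + \int[leb]_(r in `[s, t]) h r.
Proof.
move=> inth as_ st; apply/eqP; rewrite addrC -subr_eq; apply/eqP.
rewrite Rintegral_itvB ?bnd_simp//; last exact: integral_itv_integrable.
by rewrite Rintegral_itv_obnd_cbnd//; exact: integral_itv_integrable.
Qed.

Lemma integral_itv_splity h s t : rintegrable leb h -> s <= t ->
  \int[leb]_(r in `[s, +oo[) h r =
  \int[leb]_(r in `[s, t]) h r + \int[leb]_(r in `[t, +oo[) h r.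
Proof.
move=> inth st; apply/eqP; rewrite addrC -subr_eq; apply/eqP.
rewrite Rintegral_itvB ?bnd_simp//; last exact: integral_itv_integrable.
by rewrite Rintegral_itv_obnd_cbnd//; exact: integral_itv_integrable.
Qed.

Lemma itv_cst_integral (M s t : R) : s <= t ->
  \int[leb]_(r in `[s, t]) M = M * (t - s).
Proof.
move=> st; rewrite Rintegral_cst; last exact: measurable_itv.
rewrite /= [X in fine X]lebesgue_measure_itv/= lte_fin; congr (_ * _).
by have [//|ts] := ltP s t; apply/esym/eqP; rewrite subr_eq0 eq_le st ts.
Qed.

Lemma itv_cst_integrable (M s t : R) :
  leb.-integrable `[s, t] (EFin \o (fun=> M)).
Proof.
apply: measurable_bounded_integrable => //.
- by rewrite /= [X in (X < _)%E]lebesgue_measure_itv/=; case: ifP => _; rewrite ltry.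
- by exists `|M|; split; [exact: num_real|move=> x Mx r _ /=; exact: ltW].
Qed.

Lemma integral_itv_le h k s t : rintegrable leb h ->
  leb.-integrable `[s, t] (EFin \o k) ->
  {ae leb, forall r, r \in `[s, t] -> h r <= k r} ->
  \int[leb]_(r in `[s, t]) h r <= \int[leb]_(r in `[s, t]) k r.
Proof.
move=> inth intk hk.
have inth' := integral_itv_integrable `[s, t] inth.
have mh := rintegrable_measurable inth.
have mk : measurable_fun `[s, t]%classic k.
  by apply/measurable_EFinP; exact: (measurable_int _ intk).
(* The minimum equals h almost everywhere on the interval and turns the almost sure inequality into
   a pointwise one. *)
have -> : \int[leb]_(r in `[s, t]) h r = \int[leb]_(r in `[s, t]) Num.min (h r) (k r).
  rewrite /Rintegral; congr fine; apply: ae_eq_integral => //.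
  - exact/measurable_EFinP/measurable_funTS.
  - by apply/measurable_EFinP; apply: measurable_minr => //; exact: measurable_funTS.
  - have fae : Filter (almost_everywhere leb) by exact: ae_filter_ringOfSetsType.
    apply: filterS hk => r hkr rst.
    by rewrite min_l//; apply: hkr; rewrite inE in rst *.
apply: le_Rintegral => //.
- have inthk : leb.-integrable `[s, t] ((EFin \o (fun r => `|h r|%R)) \+ (EFin \o (fun r => `|k r|%R)))%E.
    by apply: integrableD => //; exact: integrable_norm.
  apply: le_integrable inthk => //.
  + by apply/measurable_EFinP; apply: measurable_minr => //; exact: measurable_funTS.
  + move=> r _ /=; rewrite lee_fin [leRHS]ger0_norm ?addr_ge0//.
    by rewrite /Num.min; case: ifP => _; rewrite ?lerDl ?lerDr.
- by move=> r _; rewrite ge_min lexx orbT.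
Qed.

Lemma integral_itv_bound h (M : R) s t : rintegrable leb h -> s <= t ->
  (forall r, s <= r <= t -> `|h r| <= M) ->
  `|\int[leb]_(r in `[s, t]) h r| <= M * (t - s).
Proof.
move=> inth st hM; rewrite -itv_cst_integral// ler_norml; apply/andP; split.
  rewrite itv_cst_integral// -mulNr -itv_cst_integral//.
  apply: le_Rintegral => //; [exact: itv_cst_integrable|exact: integral_itv_integrable|].
  by move=> r; rewrite /= in_itv/= => /hM; rewrite ler_norml => /andP[].
apply: le_Rintegral => //; [exact: integral_itv_integrable|exact: itv_cst_integrable|].
by move=> r; rewrite /= in_itv/= => /hM; rewrite ler_norml => /andP[].
Qed.

Lemma integral_itv_linear (a : R) h k s t : rintegrable leb h -> rintegrable leb k ->
  \int[leb]_(r in `[s, t]) (a * h r + k r) =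
  a * \int[leb]_(r in `[s, t]) h r + \int[leb]_(r in `[s, t]) k r.
Proof.
move=> inth intk; rewrite RintegralD ?RintegralZl//; try exact: integral_itv_integrable.
by apply: (@integral_itv_integrable (fun r => a * h r)); exact: rintegrableZ.
Qed.

Lemma integral_itv_full h (T : R) : (forall r, ~~ (0 <= r <= T) -> h r = 0) ->
  \int[leb]_(r in `[0, T]) h r = \int[leb]_r h r.
Proof.
move=> h0; rewrite Rintegral_mkcond; apply: eq_Rintegral => r _.
rewrite patchE; case: ifPn => //; rewrite notin_setE/= in_itv/= => /negP/h0 ->//.
Qed.

(** Over n equal steps the quadratic errors add up to C T^2 / n, which is as small as desired. This
    stands in for differentiating N. *)
Lemma nonincreasing_of_quadratic (N : R -> R) (C T : R) : 0 <= T ->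
  (forall s t, 0 <= s -> s <= t -> t <= T -> N s <= N t + C * (t - s) ^+ 2) ->
  N 0 <= N T.
Proof.
move=> T0 NC; apply/ler_addgt0Pl => e e0.
have C0 : 0 <= `|C| by [].
have [n [n0 ne]] : exists n : nat, (0 < n)%N /\ `|C| * T ^+ 2 <= e * n%:R.
  exists (Num.truncn (`|C| * T ^+ 2 / e)).+1; split=> //.
  by rewrite [e * _]mulrC -ler_pdivrMr// ltW// truncnS_gt.
pose p (k : nat) := k%:R * (T / n%:R).
have nR : 0 < n%:R :> R by rewrite ltr0n.
have pS (k : nat) : p k.+1 - p k = T / n%:R by rewrite /p -natr1; ring.
have Tn : 0 <= T / n%:R by rewrite divr_ge0// ltW.
have pn : p n = T by rewrite /p mulrC divfK// gt_eqF.
have step (k : nat) : (k <= n)%N -> N 0 <= N (p k) + k%:R * (`|C| * (T / n%:R) ^+ 2).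
  elim: k => [_|k IH kn]; first by rewrite /p !mul0r addr0.
  apply: (le_trans (IH (ltnW kn))).
  have p0 : 0 <= p k by rewrite mulr_ge0.
  have pk : p k <= p k.+1 by rewrite -subr_ge0 pS.
  have pT : p k.+1 <= T by rewrite -pn /p ler_wpM2r// ler_nat.
  have := NC _ _ p0 pk pT; rewrite pS -natr1 mulrDl mul1r.
  have : C * (T / n%:R) ^+ 2 <= `|C| * (T / n%:R) ^+ 2.
    by rewrite ler_wpM2r ?sqr_ge0// ler_norm.
  lra.
apply: (le_trans (step n (leqnn n))); rewrite pn addrC lerD2r.
rewrite (_ : n%:R * _ = `|C| * T ^+ 2 / n%:R); last by field; rewrite gt_eqF.
by rewrite ler_pdivrMr.
Qed.

End time_integrals.

Lemma rintegralB d (T : measurableType d) (R : realType)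
    (mu : {measure set T -> \bar R}) (f g : T -> R) :
  rintegrable mu f -> rintegrable mu g ->
  \int[mu]_x (f x - g x) = \int[mu]_x f x - \int[mu]_x g x.
Proof.
move=> intf intg; transitivity (\int[mu]_x (-1 * g x + f x)).
  by apply: eq_Rintegral => x _; ring.
by rewrite rintegralZD//; ring.
Qed.

Lemma L1_bounded_functional_prod d1 d2 (T1 : measurableType d1) (T2 : measurableType d2)
    (R : realType) (m1 : {sigma_finite_measure set T1 -> \bar R})
    (m2 : {sigma_finite_measure set T2 -> \bar R})
    (I : Type) (f : I -> T1 * T2 -> R) (l : I -> R) (C : R) :
  0 <= C -> (forall i, rintegrable (m1 \x m2)%E (f i)) ->
  (exists i, f i = (fun=> 0) /\ l i = 0) ->
  (forall a i j, exists k, f k = (fun x => a * f i x + f j x) /\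
     l k = a * l i + l j) ->
  (forall i, l i <= C * \int[(m1 \x m2)%E]_x `|f i x|) ->
  exists u : T1 * T2 -> R, [/\ measurable_fun setT u, forall x, `|u x| <= C
    & forall i, \int[(m1 \x m2)%E]_x (u x * f i x) = l i].
Proof.

have sf : sigma_finite setT (m1 \x m2)%E.
  have /sigma_finiteP[F [FT ndF Ffin]] := sigma_finiteT m1.
  have /sigma_finiteP[G [GT ndG Gfin]] := sigma_finiteT m2.
  exists (fun k => F k `*` G k).
    apply/esym; rewrite -subTset => x _.
    have [i _ Fi] : (\bigcup_k F k) x.1 by rewrite -FT.
    have [j _ Gj] : (\bigcup_k G k) x.2 by rewrite -GT.
    exists (maxn i j) => //; split.
    - by move: Fi; exact/subsetPset/ndF/leq_maxl.
    - by move: Gj; exact/subsetPset/ndG/leq_maxr.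
  move=> k; have [mF Fk] := Ffin k; have [mG Gk] := Gfin k; split.
    exact: measurableX.
  by rewrite product_measure1E// lte_mul_pinfty// ge0_fin_numE.
(* The instance inferred on a product is that of a product of subprobabilities. *)
pose m : {sigma_finite_measure set (T1 * T2)%type -> \bar R} :=
  HB.pack (m1 \x m2)%E (Measure_isSigmaFinite.Build _ _ _ (m1 \x m2)%E sf).
exact: (@L1_bounded_functional _ _ _ m I f l C).
Qed.

(** * The transport equation in the moving frame *)

Section transport.
Context {R : realType} {d : nat}.
Local Notation leb := (@lebesgue_measure R).
Local Notation lam := (@lebesgue_rV R d).
Variables (T B Xm : R) (X : R -> 'rV[R]_d).
Variables (b : R -> 'rV[R]_d -> 'rV[R]_d) (c : R -> 'rV[R]_d -> R).
Hypotheses (T0 : 0 <= T) (B0 : 0 <= B) (cX : continuous X)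
  (X_le : forall t, `|X t| <= Xm)
  (mb : forall i, measurable_fun setT
    (fun p : measurableTypeR R * 'rV[R]_d => b p.1 p.2 ord0 i))
  (mc : measurable_fun setT (fun p : measurableTypeR R * 'rV[R]_d => c p.1 p.2))
  (b_le : forall t x, `|b t x| <= B * (1 + `|x|))
  (c_le : forall t x, `|c t x| <= B)
  (b_out : forall t x, ~~ (0 <= t <= T) -> b t x = 0)
  (c_out : forall t x, ~~ (0 <= t <= T) -> c t x = 0)
  (bc_div : {ae leb, forall t, t \in `[0, T] -> weak_div (b t) (c t)}).

Implicit Types (phi chi : 'rV[R]_d -> R) (g psi : R -> 'rV[R]_d -> R) (K A : R).

(** With c the divergence of b this is div(phi b), the opposite of the formal adjoint of b .
    grad. *)
Definition adv t phi x := dotmul (b t x) (gradient phi x) + c t x * phi x.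

(** On the cube of radius K each of the d coordinates of b is at most B (1 + K), and c is at most
    B. *)
Definition adv_const K := B * (1 + K) * d%:R + B.

Let Xm0 : 0 <= Xm. Proof. exact: le_trans (X_le 0). Qed.

Lemma adv_const_ge0 K : 0 <= K -> 0 <= adv_const K.
Proof. by move=> K0; rewrite addr_ge0// !mulr_ge0// addr_ge0. Qed.

Lemma advE t phi x :
  adv t phi x = \sum_i b t x ord0 i * partial i phi x + c t x * phi x.
Proof. by rewrite /adv /dotmul; under eq_bigr do rewrite mxE. Qed.

Lemma adv_vanish K t phi : vanish_out K phi -> vanish_out K (adv t phi).
Proof.
move=> Kphi x Kx; rewrite advE Kphi// mulr0 addr0 big1// => i _.
by rewrite (vanish_partial i Kphi)// mulr0.
Qed.

Lemma adv_out t phi x : ~~ (0 <= t <= T) -> adv t phi x = 0.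
Proof.
move=> tT; rewrite advE c_out// mul0r addr0 big1// => i _.
by rewrite b_out// mxE mul0r.
Qed.

Lemma adv_linear t a phi chi x : smooth phi -> smooth chi ->
  adv t (fun x => a * phi x + chi x) x = a * adv t phi x + adv t chi x.
Proof.
move=> sphi schi; rewrite !advE.
rewrite (eq_bigr (fun i => a * (b t x ord0 i * partial i phi x) + b t x ord0 i * partial i chi x)).
  by rewrite big_split/= -mulr_sumr; ring.
move=> i _; rewrite (partialD i x (smoothZ a sphi) schi) (partialZ i a x sphi); ring.
Qed.

Lemma adv_pointwise K A t phi x : 0 <= K -> `|x| <= K ->
  `|phi x| <= A -> (forall i, `|partial i phi x| <= A) ->
  `|adv t phi x| <= adv_const K * A.
Proof.
move=> K0 xK pA dA; rewrite advE (le_trans (ler_normD _ _))// mulrDl lerD//; last first.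
  by rewrite normrM ler_pM.
rewrite (le_trans (ler_norm_sum _ _ _))//.
rewrite (@le_trans _ _ (\sum_(i < d) B * (1 + K) * A))//.
  apply: ler_sum => i _; rewrite normrM ler_pM// (le_trans (coord_le_norm _ _))//.
  by rewrite (le_trans (b_le _ _))// ler_wpM2l// lerD2l.
rewrite sumr_const card_ord -mulr_natr le_eqVlt; apply/orP; left; apply/eqP.
ring.
Qed.

Lemma adv_bound K A t phi : 0 <= K -> 0 <= A -> vanish_out K phi ->
  (forall x, `|phi x| <= A) -> (forall i x, `|partial i phi x| <= A) ->
  forall x, `|adv t phi x| <= adv_const K * A.
Proof.
move=> K0 A0 Kphi pA dA x; have [xK|Kx] := leP `|x| K; first exact: adv_pointwise.
by rewrite (adv_vanish t Kphi Kx) normr0 mulr_ge0// adv_const_ge0.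
Qed.

Lemma measurable_X i : measurable_fun [set: measurableTypeR R] (fun t => X t ord0 i).
Proof.
have cXi : continuous (fun t : R => X t ord0 i).
  by move=> t; apply: (@continuous_comp _ _ _ X (fun v : 'rV[R]_d => v ord0 i));
    [exact: cX|exact: coord_continuous].
exact: (continuous_measurable_fun cXi).
Qed.

Lemma measurable_moving_frame : measurable_fun setT
  (fun p : measurableTypeR R * 'rV[R]_d =>
     (p.1, p.2 + - X p.1) : measurableTypeR R * 'rV[R]_d).
Proof.
apply: measurable_fun_pair; first exact: measurable_fst.
apply: measurable_fun_rVP => i; under eq_fun do rewrite !mxE.
apply: measurable_funB.
  exact: (measurableT_comp (measurable_coord i) measurable_snd).
exact: (measurableT_comp (measurable_X i) measurable_fst).
Qed.

Lemma measurable_adv psi :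
  measurable_fun setT (fun p : measurableTypeR R * 'rV[R]_d => psi p.1 p.2) ->
  (forall i, measurable_fun setT
    (fun p : measurableTypeR R * 'rV[R]_d => partial i (psi p.1) p.2)) ->
  measurable_fun setT (fun p : measurableTypeR R * 'rV[R]_d =>
    adv p.1 (shiftf (- X p.1) (psi p.1)) p.2).
Proof.
move=> mpsi mdpsi; under eq_fun do rewrite advE.
apply: measurable_funD; last first.
  apply: measurable_funM => //.
  exact: (measurableT_comp mpsi measurable_moving_frame).
apply: measurable_sum => i; apply: measurable_funM => //.
under eq_fun do rewrite partial_shiftf.
exact: (measurableT_comp (mdpsi i) measurable_moving_frame).
Qed.

(** Lipschitz dependence on time is asked of the gradient too, since [adv] differentiates psi. Of g
    only boundedness is asked, because its dependence on time will be merely measurable. *)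
Record admissible_bound g psi A K : Prop := {
  adm_A0 : 0 <= A; adm_K0 : 0 <= K;
  adm_vanish : forall t, vanish_out K (psi t);
  adm_gvanish : forall t, vanish_out K (g t);
  adm_g_le : forall t x, `|g t x| <= A;
  adm_psi_le : forall t x, `|psi t x| <= A;
  adm_dpsi_le : forall t i x, `|partial i (psi t) x| <= A;
  adm_lip : forall s t x, 0 <= s <= T -> 0 <= t <= T ->
    `|psi s x - psi t x| <= A * `|s - t|;
  adm_dlip : forall s t i x, 0 <= s <= T -> 0 <= t <= T ->
    `|partial i (psi s) x - partial i (psi t) x| <= A * `|s - t| }.

(* psi is a curve of test functions with psi_T = 0 and -dpsi/dt = g, the
   derivative being taken in the weak sense. *)
Record admissible g psi : Prop := {
  adm_test : forall t, test_function (psi t);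
  adm_bnd : exists A K, admissible_bound g psi A K;
  adm_end : forall x, psi T x = 0;
  adm_mg : measurable_fun setT (fun p : measurableTypeR R * 'rV[R]_d => g p.1 p.2);
  adm_mpsi : measurable_fun setT (fun p : measurableTypeR R * 'rV[R]_d => psi p.1 p.2);
  adm_mdpsi : forall i, measurable_fun setT
    (fun p : measurableTypeR R * 'rV[R]_d => partial i (psi p.1) p.2);
  adm_out : forall t x, ~~ (0 <= t <= T) -> g t x = 0;
  adm_int : forall chi s t, test_function chi -> 0 <= s -> s <= t -> t <= T ->
    \int[lam]_x ((psi s x - psi t x) * chi x) =
    \int[leb]_(r in `[s, t]) \int[lam]_x (g r x * chi x) }.

(* This is (d/dt + b . grad + div b) applied to psi_t(x - X_t), without the term
   in dX_t: that one cancels against the rough term of the equation. *)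
Definition dual_rhs g psi (t : R) (x : 'rV[R]_d) :=
  adv t (shiftf (- X t) (psi t)) x - g t (x + - X t).

Local Notation box M K F := (boxed (T1 := measurableTypeR R) (T2 := 'rV[R]_d)
  (`[0, T]%classic : set (measurableTypeR R)) (cube K) M F).

Lemma time_finite : (leb (`[0%R, T]%classic : set (measurableTypeR R)) < +oo)%E.
Proof. by rewrite lebesgue_measure_itv/=; case: ifP => _; rewrite ltry. Qed.

Lemma measurable_time : measurable (`[0, T]%classic : set (measurableTypeR R)).
Proof. exact: measurable_itv. Qed.

Lemma boxedP M K (F : R -> 'rV[R]_d -> R) :
  measurable_fun setT (fun p : measurableTypeR R * 'rV[R]_d => F p.1 p.2) ->
  (forall t x, `|F t x| <= M) -> (forall t, vanish_out K (F t)) ->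
  (forall t x, ~~ (0 <= t <= T) -> F t x = 0) -> box M K F.
Proof.
move=> mF FM FK Fout; split=> // t x F0; split.
  by rewrite /= in_itv/=; apply: contraNT F0 => tT; apply/eqP; exact: Fout.
by rewrite /cube/= leNgt; apply: contraNN F0 => Kx; apply/eqP; exact: FK.
Qed.

Lemma vanish_moving K t phi : vanish_out K phi -> vanish_out (K + Xm) (shiftf (- X t) phi).
Proof.
move=> Kphi; apply: (vanish_out_le _ (vanish_shiftf (a := - X t) Kphi)).
by rewrite lerD2l normrN.
Qed.

Lemma boxed_dual_rhs g psi : admissible g psi ->
  exists M K, box M K (dual_rhs g psi).
Proof.
move=> adm; have [A [K Hb]] := adm_bnd adm.
have A0 := adm_A0 Hb; have K0 := adm_K0 Hb.
exists (adv_const (K + Xm) * A + A), (K + Xm); apply: boxedP.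
- apply: measurable_funB.
    exact: (measurable_adv (adm_mpsi adm) (adm_mdpsi adm)).
  exact: (measurableT_comp (adm_mg adm) measurable_moving_frame).
- move=> t x; rewrite (le_trans (ler_normB _ _))// lerD//; last exact: (adm_g_le Hb).
  apply: adv_bound; [exact: addr_ge0|by []| | |].
  + exact/vanish_moving/(adm_vanish Hb).
  + by move=> y; exact: (adm_psi_le Hb).
  + by move=> i y; rewrite partial_shiftf; exact: (adm_dpsi_le Hb).
- move=> t x Kx; rewrite /dual_rhs (adv_vanish t (vanish_moving t (adm_vanish Hb t)) Kx).
  rewrite -[g t _]/(shiftf (- X t) (g t) x) (vanish_moving t (adm_gvanish Hb t) Kx) subr0.
  by [].
- by move=> t x tT; rewrite /dual_rhs adv_out// (adm_out adm)// subr0.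
Qed.

Lemma dual_rhs_integrable g psi r : admissible g psi -> rintegrable lam (dual_rhs g psi r).
Proof.
move=> adm; have [M [K bF]] := boxed_dual_rhs adm.
exact: (boxed_section_integrable (measurable_cube K) (lebesgue_cube_lty K) r bF).
Qed.

Lemma measurable_adv_frozen r phi : test_function phi ->
  measurable_fun setT (adv r (shiftf (- X r) phi)).
Proof.
move=> tphi; have /= := @measurable_adv (fun=> phi).
have m1 := measurableT_comp (test_measurable tphi) (@measurable_snd _ _ (measurableTypeR R) 'rV[R]_d).
have m2 i := measurableT_comp (test_measurable (test_partial i tphi))
  (@measurable_snd _ _ (measurableTypeR R) 'rV[R]_d).
move=> /(_ m1 m2) m; exact: (measurableT_comp m (measurable_pair1 r)).
Qed.

(* The weak divergence is tested against soft_abs(psi_s(. - X_r)). *)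
Lemma energy_slope (e s : R) g psi A K : 0 < e -> admissible g psi ->
  admissible_bound g psi A K -> 0 <= s <= T ->
  {ae leb, forall r, 0 <= r <= T ->
    \int[lam]_x (g r x * soft_sign e (psi s x)) <=
    \int[lam]_x `|dual_rhs g psi r x| + B * e * vol (K + Xm) (d := d)
    + adv_const (K + Xm) * (A * `|r - s|) * vol (K + Xm) (d := d)}.
Proof.
move=> e0 adm Hb sT.
have fae : Filter (almost_everywhere leb) by exact: ae_filter_ringOfSetsType.
apply: filterS bc_div => r wd rT.
have {}wd : weak_div (b r) (c r) by apply: wd; rewrite in_itv.
have A0 := adm_A0 Hb; have K0 := adm_K0 Hb; have KX0 : 0 <= K + Xm := addr_ge0 K0 Xm0.
pose a := - X r; pose psi' := shiftf a (psi s); pose phi' := shiftf a (psi r).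
have ts := adm_test adm s; have tr := adm_test adm r.
have tpsi' : test_function psi' := test_shiftf a ts.
have spsi' := test_smooth tpsi'.
have sphi' := test_smooth (test_shiftf a tr).
have Kpsi' : vanish_out (K + Xm) psi' := vanish_moving r (adm_vanish Hb s).
have Kphi' : vanish_out (K + Xm) phi' := vanish_moving r (adm_vanish Hb r).
pose chi x := soft_sign e (psi' x).
have mchi : measurable_fun setT chi := test_measurable (test_soft_sign e0 tpsi').
have chi1 x : `|chi x| <= 1 := soft_sign_le1 e0 _.
have intf := dual_rhs_integrable r adm.
have mpsi' := test_measurable tpsi'.
have madv1 : measurable_fun setT (adv r psi') := measurable_adv_frozen r ts.
have madv2 : measurable_fun setT (adv r phi') := measurable_adv_frozen r tr.
have mg : measurable_fun setT (g r) := measurableT_comp (adm_mg adm) (measurable_pair1 r).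
have mcr : measurable_fun setT (c r) := measurableT_comp mc (measurable_pair1 r).
have mga : measurable_fun setT (fun x : 'rV[R]_d => g r (x + a)).
  exact: (measurableT_comp mg (measurable_addr_rV a)).
(* Translation invariance moves the integral to the frame in which [dual_rhs] is written. *)
have -> : \int[lam]_x (g r x * soft_sign e (psi s x)) =
    \int[lam]_x (g r (x + a) * chi x).
  symmetry; apply: (@rintegral_translate _ _ a (fun x => g r x * soft_sign e (psi s x))).
    apply: (@bounded_support_integrable _ _ _ A K).
    - by apply: measurable_funM => //; exact: (test_measurable (test_soft_sign e0 ts)).
    - move=> x; rewrite normrM -[leRHS]mulr1 ler_pM//; first exact: (adm_g_le Hb).
      exact: soft_sign_le1.
    - by move=> x Kx; rewrite (adm_gvanish Hb)// mul0r.
  apply: (@bounded_support_integrable _ _ _ A (K + Xm)).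
  - exact: measurable_funM.
  - by move=> x; rewrite normrM -[leRHS]mulr1 ler_pM//; [exact: (adm_g_le Hb)|exact: soft_sign_le1].
  - by move=> x Kx; rewrite -[g r (x + a)]/(shiftf (- X r) (g r) x)
      (vanish_moving r (adm_gvanish Hb r) Kx) mul0r.
(* By definition g_r(x - X_r) is the transport term of psi_r minus [dual_rhs]. P1 carries the
   right-hand side, P2 the transport term with psi frozen at time s, and P3 the price of freezing,
   of order |r - s|. *)
pose P1 x := - dual_rhs g psi r x * chi x.
pose P2 x := adv r psi' x * chi x.
pose P3 x := (adv r phi' x - adv r psi' x) * chi x.
have intP1 : rintegrable lam P1.
  rewrite (_ : P1 = fun x => chi x * - dual_rhs g psi r x); last by apply/funext => x; rewrite mulrC.
  exact: (rintegrable_bddM mchi chi1 (rintegrableN intf)).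
have advb phi1 A1 : 0 <= A1 -> vanish_out (K + Xm) phi1 -> (forall x, `|phi1 x| <= A1) ->
    (forall i x, `|partial i phi1 x| <= A1) ->
    forall x, `|adv r phi1 x * chi x| <= adv_const (K + Xm) * A1.
  move=> A10 Kphi1 phi1A dphi1A x; rewrite normrM -[leRHS]mulr1 ler_pM//.
  exact: adv_bound.
have P2b : forall x, `|P2 x| <= adv_const (K + Xm) * A.
  apply: advb => // [x|i x]; first exact: (adm_psi_le Hb).
  by rewrite partial_shiftf; exact: (adm_dpsi_le Hb).
have P2v : vanish_out (K + Xm) P2 by move=> x Kx; rewrite /P2 (adv_vanish r Kpsi' Kx) mul0r.
have intP2 : rintegrable lam P2.
  exact: (bounded_support_integrable (measurable_funM madv1 mchi) P2b P2v).
have P3b x : `|P3 x| <= adv_const (K + Xm) * (A * `|r - s|).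
  have -> : P3 x = adv r (fun x => -1 * psi' x + phi' x) x * chi x.
    by rewrite /P3 (adv_linear r (-1) x spsi' sphi') mulN1r addrC.
  apply: advb => [|y Ky|y|i y].
  - by rewrite mulr_ge0.
  - by rewrite Kpsi'// Kphi'// mulr0 addr0.
  - by rewrite mulN1r addrC; exact: (adm_lip Hb).
  - rewrite (partialD i y (smoothZ (-1) spsi') sphi') (partialZ i (-1) y spsi').
    by rewrite !partial_shiftf mulN1r addrC; exact: (adm_dlip Hb).
have P3v : vanish_out (K + Xm) P3.
  by move=> x Kx; rewrite /P3 (adv_vanish r Kpsi' Kx) (adv_vanish r Kphi' Kx) subrr mul0r.
have mP3 : measurable_fun setT P3 := measurable_funM (measurable_funB madv2 madv1) mchi.
have intP3 := bounded_support_integrable mP3 P3b P3v.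
have E x : g r (x + a) * chi x = P1 x + P2 x + P3 x.
  rewrite /P1 /P2 /P3 /dual_rhs -/a -/phi'; ring.
under eq_Rintegral do rewrite E.
have intP12 := rintegrableD intP1 intP2.
rewrite (RintegralD _ intP12 intP3)// (RintegralD _ intP1 intP2)//.
apply: lerD; last exact: (le_trans (ler_norm _) (bounded_support_le mP3 P3b P3v)).
apply: lerD.
  apply: le_rintegral => //; first exact: rintegrable_norm.
  move=> x; rewrite /P1 (le_trans (ler_norm _))// normrM normrN -[leRHS]mulr1 ler_wpM2l//.
pose Phi := soft_abs e \o psi'.
have tPhi : test_function Phi := test_soft_abs e0 tpsi'.
pose Q x := c r x * (chi x * psi' x).
pose dt x := dotmul (b r x) (gradient Phi x).
have mPhi := test_measurable tPhi.
have [M M0 psiM] := test_bounded tpsi'.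
have intQ : rintegrable lam Q.
  apply: (@bounded_support_integrable _ _ _ (B * M) (K + Xm)).
  - by apply: measurable_funM => //; exact: measurable_funM.
  - move=> x; rewrite normrM ler_pM// normrM -[leRHS]mul1r ler_pM//.
  - by move=> x Kx; rewrite /Q Kpsi'// !mulr0.
have dtE x : P2 x = dt x + Q x.
  rewrite /P2 /dt /Q advE mulrDl /dotmul mulr_suml; congr (_ + _); last by ring.
  apply: eq_bigr => i _; rewrite mxE (partial_soft_abs e0 i x spsi') -/(chi x); ring.
have intdt : rintegrable lam dt.
  have := rintegrableB intP2 intQ; rewrite /rintegrable; congr integrable.
  by apply/funext => x /=; rewrite dtE addrK.
have intcPhi : rintegrable lam (fun x => c r x * Phi x).
  exact: (rintegrable_bddM mcr (c_le r) (test_integrable tPhi)).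
under eq_Rintegral do rewrite dtE.
(* The weak divergence turns the integral of b . grad Phi into minus that of c Phi. What is left is
   c (chi psi' - Phi), at most B e and supported in a cube. *)
rewrite (RintegralD _ intdt intQ)// (wd _ tPhi) addrC /pairing -RintegralB//.
pose S x := c r x * (chi x * psi' x - Phi x).
rewrite (_ : \int[lam]_x _ = \int[lam]_x S x); last first.
  by apply: eq_Rintegral => x _; rewrite /S /Q; ring.
apply: (le_trans (ler_norm _)); apply: bounded_support_le.
- apply: measurable_funM => //; apply: measurable_funB => //; exact: measurable_funM.
- move=> x; rewrite normrM ler_pM// ger0_norm; first exact: soft_sign_abs_le.
  exact: soft_sign_abs_ge0.
- by move=> x Kx; rewrite /S /Phi /= Kpsi'// mulr0 soft_abs0// subrr mulr0.
Qed.

Lemma soft_abs_psi_integrable e g psi s : 0 < e -> admissible g psi ->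
  rintegrable lam (fun x => soft_abs e (psi s x)).
Proof. by move=> e0 adm; exact: (test_integrable (test_soft_abs e0 (adm_test adm s))). Qed.

(** The time derivative of psi is known only when integrated against a fixed test function.
    Convexity replaces the increment of [soft_abs] by its tangent at psi_s, and the test function
    becomes [soft_sign] of psi_s, which does not vary with r. *)
Lemma energy_increment e s t g psi : 0 < e -> admissible g psi ->
  0 <= s -> s <= t -> t <= T ->
  \int[lam]_x soft_abs e (psi s x) - \int[lam]_x soft_abs e (psi t x) <=
  \int[leb]_(r in `[s, t]) \int[lam]_x (g r x * soft_sign e (psi s x)).
Proof.
move=> e0 adm s0 st tT.
have tchi := test_soft_sign e0 (adm_test adm s).
have chi1 x : `|soft_sign e (psi s x)| <= 1 := soft_sign_le1 e0 _.
rewrite -(adm_int adm tchi s0 st tT) -RintegralB//; try exact: (soft_abs_psi_integrable _ e0 adm).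
have intpsi r := test_integrable (adm_test adm r).
apply: le_rintegral.
- by apply: rintegrableB; exact: (soft_abs_psi_integrable _ e0 adm).
- rewrite (_ : (fun x => _) = (fun x => soft_sign e (psi s x) * (psi s x - psi t x))).
    by apply: (rintegrable_bddM (test_measurable tchi) chi1); exact: rintegrableB.
  by apply/funext => x; rewrite mulrC.
- by move=> x; rewrite [leRHS]mulrC; exact: soft_abs_convex.
Qed.

(** As e tends to 0 the divergence leaves no exponential factor: the constant is 1, and this is the
    bound to which Hahn-Banach is applied. *)
Theorem energy_estimate g psi : admissible g psi ->
  \int[lam]_x `|psi 0 x| <= \int[(leb \x lam)%E]_p `|dual_rhs g psi p.1 p.2|.
Proof.
move=> adm; have [A [K Hb]] := adm_bnd adm; have [M [K' bF]] := boxed_dual_rhs adm.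
have K0 := adm_K0 Hb; have A0 := adm_A0 Hb; have KX0 : 0 <= K + Xm := addr_ge0 K0 Xm0.
have mK' := @measurable_cube R d K'; have fK' := @lebesgue_cube_lty R d K'.
have bN := boxed_norm bF.
rewrite (boxed_fubini measurable_time mK' time_finite fK' bN).
pose L r := \int[lam]_x `|dual_rhs g psi r x|.
have intL : rintegrable leb L.
  exact: (boxed_integral_rintegrable measurable_time mK' time_finite fK' bN).
have L_out r : ~~ (0 <= r <= T) -> L r = 0.
  move=> rT; rewrite /L -[RHS](rintegral0 lam); apply: eq_Rintegral => x _.
  by rewrite /dual_rhs adv_out// (adm_out adm)// subr0 normr0.
rewrite -/(L _) -(integral_itv_full L_out).
pose V : R := vol (K + Xm) (d := d).
have V0 : 0 <= V := vol_ge0 _.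
(* The errors linear in e: B V T from the divergence and [vol K] from |y| - e <= [soft_abs] y. The
   last 1 keeps W positive. *)
pose W := B * V * T + vol K (d := d) + 1.
have W0 : 0 < W.
  by rewrite ltr_wpDl// addr_ge0// ?vol_ge0// !mulr_ge0.
apply/ler_addgt0Pl => eps eps0.
pose e := eps / W; have e0 : 0 < e by rewrite divr_gt0.
pose N s := \int[lam]_x soft_abs e (psi s x).
pose D := adv_const (K + Xm) * A * V.
have D0 : 0 <= D by rewrite !mulr_ge0// adv_const_ge0.
(* N together with the accumulated right-hand side and divergence error is nondecreasing up to a
   quadratic term: the price of freezing psi is at most of order t - s and is integrated over a step
   of that length. *)
have step s t : 0 <= s -> s <= t -> t <= T ->
    N s + \int[leb]_(r in `[0, s]) L r + B * e * V * s <=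
    N t + \int[leb]_(r in `[0, t]) L r + B * e * V * t + D * (t - s) ^+ 2.
  move=> s0 st tT.
  have sT : 0 <= s <= T by rewrite s0 (le_trans st).
  have := energy_increment e0 adm s0 st tT; rewrite -/(N s) -/(N t).
  rewrite (integral_itv_split intL s0 st).
  set I := (X in _ <= X -> _) => NI.
  suff : I <= \int[leb]_(r in `[s, t]) L r + (B * e * V + D * (t - s)) * (t - s).
    have -> : (B * e * V + D * (t - s)) * (t - s) =
      B * e * V * t - B * e * V * s + D * (t - s) ^+ 2 by ring.
    lra.
  rewrite -(itv_cst_integral (B * e * V + D * (t - s)) st).
  have intLi := integral_itv_integrable `[s, t] intL.
  have intc := itv_cst_integrable (B * e * V + D * (t - s)) s t.
  rewrite -RintegralD//.
  have tchi := test_soft_sign e0 (adm_test adm s).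
  have bG : box A K (fun r x => g r x * soft_sign e (psi s x)).
    apply: boxedP.
    - apply: measurable_funM; first exact: (adm_mg adm).
      exact: (measurableT_comp (test_measurable tchi) measurable_snd).
    - move=> r x; rewrite normrM -[leRHS]mulr1 ler_pM//; first exact: (adm_g_le Hb).
      exact: soft_sign_le1.
    - by move=> r x Kx; rewrite (adm_gvanish Hb)// mul0r.
    - by move=> r x rT; rewrite (adm_out adm)// mul0r.
  apply: integral_itv_le.
  - exact: (boxed_integral_rintegrable measurable_time (measurable_cube K)
      time_finite (lebesgue_cube_lty K) bG).
  - have mi : measurable (`[s, t]%classic : set (measurableTypeR R)) by exact: measurable_itv.
    by have := integrableD mi intLi intc.
  have fae : Filter (almost_everywhere leb) by exact: ae_filter_ringOfSetsType.
  apply: filterS (energy_slope e0 adm Hb sT) => r Hr; rewrite in_itv/= => /andP[sr rt].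
  have rT : 0 <= r <= T by rewrite (le_trans s0 sr) (le_trans rt tT).
  apply: (le_trans (Hr rT)); rewrite -/(L r) -/V -addrA lerD2l lerD2l /D.
  rewrite -!mulrA; do 2 (apply: ler_wpM2l; rewrite ?adv_const_ge0//).
  rewrite mulrC ler_wpM2l// ger0_norm ?subr_ge0// lerD2r//.
have := nonincreasing_of_quadratic T0 step.
rewrite (_ : N T = 0); last first.
  rewrite /N -[RHS](rintegral0 lam); apply: eq_Rintegral => x _.
  by rewrite (adm_end adm) soft_abs0.
rewrite set_itv1 Rintegral_set1 mulr0 !addr0 add0r => N0.
have : \int[lam]_x `|psi 0 x| <= N 0 + e * vol K (d := d).
  have intc : rintegrable lam (fun x => e * \1_(cube K) x).
    exact/rintegrableZ/rintegrable_cube.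
  have ints := soft_abs_psi_integrable 0 e0 adm.
  have -> : e * vol K (d := d) = \int[lam]_x (e * \1_(cube K) x).
    rewrite rintegralZ; last exact: rintegrable_cube.
    rewrite /Rintegral integral_indic//; last exact: measurable_cube.
    by rewrite setIT.
  rewrite -RintegralD//; apply: le_rintegral.
  - exact/rintegrable_norm/(test_integrable (adm_test adm 0)).
  - exact: rintegrableD.
  - move=> x; rewrite indicE; have [xK|xK] := boolP (x \in cube K).
      by rewrite mulr1 -lerBlDr; exact: soft_abs_ge.
    rewrite mulr0 addr0 (adm_vanish Hb) ?normr0 ?soft_abs_ge0//.
    by rewrite notin_setE/= /cube/= in xK; rewrite ltNge; exact/negP.
have eW : e * (B * V * T + vol K (d := d)) <= eps.
  rewrite -[leRHS](divfK (lt0r_neq0 W0)).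
  by rewrite ler_wpM2l ?(ltW e0)// /W lerDl.
have : B * e * V * T + e * vol K (d := d) = e * (B * V * T + vol K (d := d)) by ring.
lra.
Qed.

(** Hahn-Banach needs a linear space, which is why the class consists of general curves and not of
    products theta(t) phi(x) alone. *)
Lemma admissible_linear a g1 psi1 g2 psi2 :
  admissible g1 psi1 -> admissible g2 psi2 ->
  admissible (fun t x => a * g1 t x + g2 t x) (fun t x => a * psi1 t x + psi2 t x).
Proof.
move=> adm1 adm2.
have s1 t := test_smooth (adm_test adm1 t); have s2 t := test_smooth (adm_test adm2 t).
have pE t i x : partial i (fun x => a * psi1 t x + psi2 t x) x =
    a * partial i (psi1 t) x + partial i (psi2 t) x.
  by rewrite (partialD i x (smoothZ a (s1 t)) (s2 t)) (partialZ i a x (s1 t)).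
split.
- by move=> t; exact: (testD (testZ a (adm_test adm1 t)) (adm_test adm2 t)).
- have [A1 [K1 H1]] := adm_bnd adm1; have [A2 [K2 H2]] := adm_bnd adm2.
  have A10 := adm_A0 H1; have A20 := adm_A0 H2.
  have lin (u1 u2 w1 w2 : R) : `|u1| <= w1 -> `|u2| <= w2 -> `|a * u1 + u2| <= `|a| * w1 + w2.
    by move=> h1 h2; rewrite (le_trans (ler_normD _ _))// lerD// normrM ler_wpM2l.
  have van (f1 f2 : 'rV[R]_d -> R) : vanish_out K1 f1 -> vanish_out K2 f2 ->
      vanish_out (Num.max K1 K2) (fun x => a * f1 x + f2 x).
    by move=> v1 v2 x; rewrite gt_max => /andP[/v1 -> /v2 ->]; rewrite mulr0 addr0.
  exists (`|a| * A1 + A2), (Num.max K1 K2); split.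
  + by rewrite addr_ge0// mulr_ge0.
  + by rewrite le_max (adm_K0 H1).
  + by move=> t; apply: van; [exact: (adm_vanish H1)|exact: (adm_vanish H2)].
  + by move=> t; apply: van; [exact: (adm_gvanish H1)|exact: (adm_gvanish H2)].
  + by move=> t x; apply: lin; [exact: (adm_g_le H1)|exact: (adm_g_le H2)].
  + by move=> t x; apply: lin; [exact: (adm_psi_le H1)|exact: (adm_psi_le H2)].
  + by move=> t i x; rewrite pE; apply: lin; [exact: (adm_dpsi_le H1)|exact: (adm_dpsi_le H2)].
  + move=> s t x sT tT; rewrite mulrDl -mulrA.
    rewrite (_ : _ - _ = a * (psi1 s x - psi1 t x) + (psi2 s x - psi2 t x)); last by ring.
    by apply: lin; [exact: (adm_lip H1)|exact: (adm_lip H2)].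
  + move=> s t i x sT tT; rewrite mulrDl -mulrA !pE.
    rewrite (_ : _ - _ = a * (partial i (psi1 s) x - partial i (psi1 t) x) +
      (partial i (psi2 s) x - partial i (psi2 t) x)); last by ring.
    by apply: lin; [exact: (adm_dlip H1)|exact: (adm_dlip H2)].
- by move=> x; rewrite (adm_end adm1) (adm_end adm2) mulr0 addr0.
- by apply: measurable_funD; [apply: measurable_funM => //; exact: (adm_mg adm1)|exact: (adm_mg adm2)].
- by apply: measurable_funD; [apply: measurable_funM => //; exact: (adm_mpsi adm1)|exact: (adm_mpsi adm2)].
- move=> i; under eq_fun do rewrite pE.
  by apply: measurable_funD; [apply: measurable_funM => //; exact: (adm_mdpsi adm1)|exact: (adm_mdpsi adm2)].
- by move=> t x tT; rewrite (adm_out adm1)// (adm_out adm2)// mulr0 addr0.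
- move=> chi s t tchi s0 st tT.
  have [A1 [K1 H1]] := adm_bnd adm1; have [A2 [K2 H2]] := adm_bnd adm2.
  have [C _ chiC] := test_bounded tchi.
  have mchi := test_measurable tchi.
  have intp (p : 'rV[R]_d -> R) : rintegrable lam p -> rintegrable lam (fun x => p x * chi x).
    move=> intpp; have := rintegrable_bddM mchi chiC intpp.
    by rewrite /rintegrable; congr integrable; apply/funext => x /=; rewrite mulrC.
  have i1 : rintegrable lam (fun x => (psi1 s x - psi1 t x) * chi x).
    exact: (intp (fun x => psi1 s x - psi1 t x) (rintegrableB (test_integrable (adm_test adm1 s)) (test_integrable (adm_test adm1 t)))).
  have i2 : rintegrable lam (fun x => (psi2 s x - psi2 t x) * chi x).
    exact: (intp (fun x => psi2 s x - psi2 t x) (rintegrableB (test_integrable (adm_test adm2 s)) (test_integrable (adm_test adm2 t)))).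
  have bG g psi A K : admissible g psi -> admissible_bound g psi A K ->
      boxed (T1 := measurableTypeR R) (T2 := 'rV[R]_d)
        (`[0, T]%classic : set (measurableTypeR R)) (cube K) (A * C) (fun r x => g r x * chi x).
    move=> adm Hb; apply: boxedP.
    - apply: measurable_funM; first exact: (adm_mg adm).
      exact: (measurableT_comp mchi measurable_snd).
    - by move=> r x; rewrite normrM ler_pM//; exact: (adm_g_le Hb).
    - by move=> r x Kx; rewrite (adm_gvanish Hb)// mul0r.
    - by move=> r x rT; rewrite (adm_out adm)// mul0r.
  have mT := measurable_time; have fT := time_finite.
  have I1 := boxed_integral_rintegrable mT (measurable_cube K1) fT (lebesgue_cube_lty K1) (bG _ _ _ _ adm1 H1).
  have I2 := boxed_integral_rintegrable mT (measurable_cube K2) fT (lebesgue_cube_lty K2) (bG _ _ _ _ adm2 H2).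
  transitivity (\int[lam]_x (a * ((psi1 s x - psi1 t x) * chi x) + (psi2 s x - psi2 t x) * chi x)).
    by apply: eq_Rintegral => x _; ring.
  rewrite rintegralZD// (adm_int adm1)// (adm_int adm2)// -integral_itv_linear//.
  apply: eq_Rintegral => r _; rewrite -rintegralZD.
  + by apply: eq_Rintegral => x _; ring.
  + exact: (boxed_section_integrable (measurable_cube K1) (lebesgue_cube_lty K1) r (bG _ _ _ _ adm1 H1)).
  + exact: (boxed_section_integrable (measurable_cube K2) (lebesgue_cube_lty K2) r (bG _ _ _ _ adm2 H2)).
Qed.

Lemma dual_rhs_linear a g1 psi1 g2 psi2 t x :
  admissible g1 psi1 -> admissible g2 psi2 ->
  dual_rhs (fun t x => a * g1 t x + g2 t x) (fun t x => a * psi1 t x + psi2 t x) t x =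
  a * dual_rhs g1 psi1 t x + dual_rhs g2 psi2 t x.
Proof.
move=> adm1 adm2; rewrite /dual_rhs.
have s1 := test_smooth (test_shiftf (- X t) (adm_test adm1 t)).
have s2 := test_smooth (test_shiftf (- X t) (adm_test adm2 t)).
have := adv_linear t a x s1 s2.
rewrite [X in X = _](_ : _ = adv t (shiftf (- X t) (fun x => a * psi1 t x + psi2 t x)) x)//.
by move=> ->; ring.
Qed.

Lemma lipschitz_continuous (f : R -> R) (Q : R) :
  (forall s t, s <= t -> `|f s - f t| <= Q * (t - s)) -> continuous f.
Proof.
move=> fQ; have Q0 : 0 <= Q.
  by have := le_trans (normr_ge0 _) (fQ 0 1 ler01); rewrite subr0 mulr1.
have fl s t : `|f s - f t| <= Q * `|s - t|.
  have [st|ts] := leP s t; first by rewrite [`|s - t|]ler0_norm ?subr_le0// opprB; exact: fQ.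
  by rewrite distrC [`|s - t|]gtr0_norm ?subr_gt0//; exact/fQ/ltW.
move=> s; apply/cvgrPdist_le => e e0.
have d0 : 0 < e / (Q + 1) by rewrite divr_gt0// ltr_wpDl.
apply/nbhs_ballP; exists (e / (Q + 1)) => //= t; rewrite /ball/= => /ltW st.
apply: (le_trans (fl s t)).
rewrite (@le_trans _ _ (Q * (e / (Q + 1))))//; first by rewrite ler_wpM2l.
by rewrite mulrCA ler_piMr ?(ltW e0)// ler_pdivrMr ?ltr_wpDl// mul1r lerDl.
Qed.

(** * Curves of product form *)

Section base.
Variables (theta : R -> R) (Q : R).
Hypotheses (mtheta : measurable_fun [set: measurableTypeR R] theta)
  (theta_le : forall r, `|theta r| <= Q)
  (theta_out : forall r, ~~ (0 <= r < T) -> theta r = 0).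

(** As [theta] vanishes from T on, T included, this is the integral over [t, T] for t <= T and 0
    afterwards. Times phi, it is the curve psi with -dpsi/dt = theta phi and psi_T = 0. *)
Definition tail_integral t := \int[leb]_(r in `[t, +oo[) theta r.

Lemma theta_integrable : rintegrable leb theta.
Proof.
have [] // := support_integrable (measurable_time) (time_finite) mtheta theta_le.
move=> r; rewrite /= in_itv/=; apply: contraNT => rT; apply/eqP; apply: theta_out.
by apply: contraNN rT => /andP[-> /ltW ->].
Qed.

Lemma tail_integral_split s t : s <= t ->
  tail_integral s - tail_integral t = \int[leb]_(r in `[s, t]) theta r.
Proof. by move=> st; rewrite /tail_integral (integral_itv_splity theta_integrable st) addrK. Qed.

Lemma tail_integral_lip s t : s <= t ->
  `|tail_integral s - tail_integral t| <= Q * (t - s).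
Proof.
by move=> st; rewrite tail_integral_split//; apply: integral_itv_bound => //; exact: theta_integrable.
Qed.

Lemma tail_integral_le t : `|tail_integral t| <= \int[leb]_r `|theta r|.
Proof.
have inti := integral_itv_integrable `[t, +oo[ theta_integrable.
rewrite (le_trans (le_normr_Rintegral _ inti))//.
rewrite Rintegral_mkcond; apply: le_rintegral; last 2 first.
- exact/rintegrable_norm/theta_integrable.
- by move=> r; rewrite patchE; case: ifP => _ /=; rewrite ?normr_ge0.
have := rintegrable_norm theta_integrable.
move=> intn; apply: (le_rintegrable _ _ intn).
  apply/(measurable_restrictT _ _).1 => //.
  by apply: measurable_funTS; exact: measurableT_comp.
by move=> r; rewrite patchE; case: ifP => _ /=; rewrite ?normr0 ?normr_ge0.
Qed.

Lemma tail_integral_end : tail_integral T = 0.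
Proof.
transitivity (\int[leb]_(r in `[T, +oo[) (0 : R)).
  apply: eq_Rintegral => r; rewrite inE/= in_itv/= andbT => Tr; apply: theta_out.
  by rewrite negb_and -leNgt Tr orbT.
by rewrite Rintegral_cst ?mul0r.
Qed.

Lemma measurable_tail_integral : measurable_fun [set: measurableTypeR R] tail_integral.
Proof. by apply: continuous_measurable_fun; apply: lipschitz_continuous; exact: tail_integral_lip. Qed.

Lemma admissible_base phi : test_function phi ->
  admissible (fun t x => theta t * phi x) (fun t x => tail_integral t * phi x).
Proof.
move=> tphi; have sphi := test_smooth tphi.
have mphi := test_measurable tphi.
have [K K0 phiK] := test_vanish tphi.
have [A A0 phiA] := test_bounded tphi.
have [A2 A20 [phiA2 dphiA2]] := test_C1_bound tphi.
have Q0 : 0 <= Q by rewrite (le_trans _ (theta_le 0)).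
(* Q bounds theta and the Lipschitz constant of its tail integral, Q' bounds the tail integral
   itself; their sum serves for all bounds at once. *)
pose Q' := \int[leb]_r `|theta r|.
have Q'0 : 0 <= Q' by apply: Rintegral_ge0.
have tlip s t : `|tail_integral s - tail_integral t| <= Q * `|s - t|.
  have [st|ts] := leP s t.
    by rewrite [`|s - t|]ler0_norm ?subr_le0// opprB; exact: tail_integral_lip.
  by rewrite distrC [`|s - t|]gtr0_norm ?subr_gt0//; exact/tail_integral_lip/ltW.
have big (u v w z : R) : 0 <= z -> `|u| <= z * w -> `|v| <= A2 -> z <= Q + Q' -> 0 <= w ->
    `|u * v| <= (Q + Q') * A2 * w.
  move=> z0 uw vA zQ w0; rewrite normrM mulrAC ler_pM//.
  by rewrite (le_trans uw)// ler_wpM2r.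
split.
- by move=> t; exact: testZ.
- exists ((Q + Q') * A2), K; split.
  + by rewrite mulr_ge0// addr_ge0.
  + exact: ltW.
  + by move=> t x Kx; rewrite phiK// mulr0.
  + by move=> t x Kx; rewrite phiK// mulr0.
  + move=> t x; rewrite -[leRHS]mulr1; apply: (big _ _ _ Q) => //; rewrite ?mulr1//.
    by rewrite lerDl.
  + move=> t x; rewrite -[leRHS]mulr1; apply: (big _ _ _ Q') => //; rewrite ?mulr1 ?lerDr//.
    exact: tail_integral_le.
  + move=> t i x; rewrite (partialZ i _ x sphi) -[leRHS]mulr1.
    apply: (big _ _ _ Q') => //; rewrite ?mulr1 ?lerDr//; exact: tail_integral_le.
  + move=> s t x _ _; rewrite -mulrBl; apply: (big _ _ _ Q) => //.
    by rewrite lerDl.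
  + move=> s t i x _ _; rewrite !(partialZ i _ x sphi) -mulrBl; apply: (big _ _ _ Q) => //.
    by rewrite lerDl.
- by move=> x; rewrite tail_integral_end mul0r.
- apply: measurable_funM; first exact: (measurableT_comp mtheta measurable_fst).
  exact: (measurableT_comp mphi measurable_snd).
- apply: measurable_funM; first exact: (measurableT_comp measurable_tail_integral measurable_fst).
  exact: (measurableT_comp mphi measurable_snd).
- move=> i; under eq_fun do rewrite (partialZ i _ _ sphi).
  apply: measurable_funM; first exact: (measurableT_comp measurable_tail_integral measurable_fst).
  exact: (measurableT_comp (test_measurable (test_partial i tphi)) measurable_snd).
- move=> t x tT; rewrite theta_out ?mul0r//.
  by apply: contraNN tT => /andP[-> /ltW ->].
- move=> chi s t tchi s0 st tT.
  have intpc : rintegrable lam (fun x => phi x * chi x).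
    exact: (rintegrable_bddM mphi phiA (test_integrable tchi)).
  under eq_Rintegral do rewrite -mulrBl -mulrA.
  rewrite rintegralZ// tail_integral_split// -RintegralZr//; last first.
    exact: (integral_itv_integrable _ theta_integrable).
  apply: eq_Rintegral => r _; rewrite -rintegralZ//.
  by apply: eq_Rintegral => x _; rewrite mulrA.
Qed.

End base.

Lemma dual_rhs_base (theta : R -> R) phi t x : test_function phi ->
  dual_rhs (fun t x => theta t * phi x) (fun t x => tail_integral theta t * phi x) t x =
  tail_integral theta t * adv t (shiftf (- X t) phi) x - theta t * phi (x + - X t).
Proof.
move=> tphi; rewrite /dual_rhs; congr (_ - _).
have sphi := test_smooth (test_shiftf (- X t) tphi).
have := adv_linear t (tail_integral theta t) x sphi (smooth_cst 0).
rewrite [X in X = _ -> _](_ : _ = adv t (shiftf (- X t) (fun x => tail_integral theta t * phi x)) x); last first.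
  by congr (adv _ _ _); apply/funext => y; rewrite addr0.
move=> ->; rewrite [adv t (cst 0) x]advE mulr0 addr0 big1 ?addr0// => i _.
by rewrite partial_cst mulr0.
Qed.

(** * Existence by duality *)

Variables (u0 : 'rV[R]_d -> R) (M : R).
Hypotheses (mu0 : measurable_fun setT u0) (u0_le : forall x, `|u0 x| <= M).

Let M0 : 0 <= M. Proof. exact: le_trans (u0_le 0). Qed.

(** On the range of [dual_rhs] in L^1 the functional that maps [dual_rhs g psi] to minus the pairing
    of u0 with psi_0 is bounded by M, by [energy_estimate]; u represents its extension. *)
Theorem dual_solution : exists u : R -> 'rV[R]_d -> R,
  [/\ measurable_fun setT (fun p : measurableTypeR R * 'rV[R]_d => u p.1 p.2),
      forall t x, `|u t x| <= M
    & forall g psi, admissible g psi ->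
      \int[(leb \x lam)%E]_p (u p.1 p.2 * dual_rhs g psi p.1 p.2) =
      - \int[lam]_x (u0 x * psi 0 x)].
Proof.
pose I := {gp : (R -> 'rV[R]_d -> R) * (R -> 'rV[R]_d -> R) | admissible gp.1 gp.2}.
pose f (i : I) (p : measurableTypeR R * 'rV[R]_d) := dual_rhs (sval i).1 (sval i).2 p.1 p.2.
pose l (i : I) := - \int[lam]_x (u0 x * (sval i).2 0 x).
have intu0 (i : I) : rintegrable lam (fun x => u0 x * (sval i).2 0 x).
  exact: (rintegrable_bddM mu0 u0_le (test_integrable (adm_test (svalP i) 0))).
have lin a i j : exists k, f k = (fun x => a * f i x + f j x) /\ l k = a * l i + l j.
  exists (exist _ ((fun t x => a * (sval i).1 t x + (sval j).1 t x),
    (fun t x => a * (sval i).2 t x + (sval j).2 t x)) (admissible_linear a (svalP i) (svalP j))).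
  split; first by apply/funext => p; exact: (dual_rhs_linear a p.1 p.2 (svalP i) (svalP j)).
  rewrite /l mulrN -opprD -rintegralZD//; congr (- _).
  by apply: eq_Rintegral => x _ /=; ring.
have adm0 : admissible (fun (t : R) (x : 'rV[R]_d) => (cst 0 : R -> R) t * (cst 0 : 'rV[R]_d -> R) x)
    (fun t x => tail_integral (cst 0) t * (cst 0 : 'rV[R]_d -> R) x).
  apply: (@admissible_base (cst 0) 0) => //; last exact: test0.
  by move=> r; rewrite normr0.
pose i0 : I := exist _ (_, _) adm0.
(* The combination -i0 + i0 serves as the zero of the family, since f and l vanish there by mere
   algebra. *)
have [i1 [f1 l1]] := lin (-1) i0 i0.
have boxf (i : I) := boxed_dual_rhs (svalP i).
have intf (i : I) : rintegrable (leb \x lam)%E (f i).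
  have [M' [K bF]] := boxf i.
  exact: (boxed_integrable (measurable_time) (measurable_cube K) (time_finite) (lebesgue_cube_lty K) bF).
have [|a i j|i|u [mu_ uM uE]] := L1_bounded_functional_prod (l := l) M0 intf.
- by exists i1; rewrite f1 l1; split; [apply/funext => p; ring|ring].
- exact: lin.
- rewrite /l (le_trans (ler_norm _))// normrN.
  rewrite (le_trans (le_normr_Rintegral _ (intu0 i)))//.
  rewrite (@le_trans _ _ (M * \int[lam]_x `|(sval i).2 0 x|))//.
    rewrite -rintegralZ; last exact/rintegrable_norm/(test_integrable (adm_test (svalP i) 0)).
    apply: le_rintegral.
    + exact/rintegrable_norm/intu0.
    + exact/rintegrableZ/rintegrable_norm/(test_integrable (adm_test (svalP i) 0)).
    + by move=> x; rewrite normrM ler_wpM2r.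
  by rewrite ler_wpM2l//; exact: (energy_estimate (svalP i)).
exists (fun t x => u (t, x)); split=> //.
  by rewrite (_ : (fun p => _) = u)//; apply/funext => -[].
move=> g psi adm; rewrite -[RHS](uE (exist _ (g, psi) adm)).
by apply: eq_Rintegral => -[].
Qed.

(** * The equation in the moving frame for almost every time *)

Section moving_frame.
Variable u : R -> 'rV[R]_d -> R.
Hypotheses (mu_ : measurable_fun setT (fun p : measurableTypeR R * 'rV[R]_d => u p.1 p.2))
  (u_le : forall t x, `|u t x| <= M)
  (u_dual : forall g psi, admissible g psi ->
      \int[(leb \x lam)%E]_p (u p.1 p.2 * dual_rhs g psi p.1 p.2) =
      - \int[lam]_x (u0 x * psi 0 x)).

(** This is the time derivative that the transport equation prescribes for u_t(phi(. - X_t)). *)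
Definition source phi r := \int[lam]_x (u r x * adv r (shiftf (- X r) phi) x).



Lemma boxed_source phi K A : test_function phi -> 0 <= K -> 0 <= A -> vanish_out K phi ->
  (forall x, `|phi x| <= A) -> (forall i x, `|partial i phi x| <= A) ->
  box (M * (adv_const (K + Xm) * A)) (K + Xm)
    (fun r x => u r x * adv r (shiftf (- X r) phi) x).
Proof.
move=> tphi K0 A0 Kphi pA dA; apply: boxedP.
- apply: measurable_funM => //.
  apply: (measurable_adv (psi := fun=> phi)).
    exact: (measurableT_comp (test_measurable tphi) measurable_snd).
  by move=> i; exact: (measurableT_comp (test_measurable (test_partial i tphi)) measurable_snd).
- move=> t x; rewrite normrM ler_pM//.
  apply: (adv_bound) => //; first exact: addr_ge0.
  + exact: (vanish_moving).
  + by move=> y; exact: pA.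
  + by move=> i y; rewrite partial_shiftf; exact: dA.
- by move=> t x Kx; rewrite (adv_vanish t (vanish_moving t Kphi) Kx) mulr0.
- by move=> t x tT; rewrite (adv_out)// mulr0.
Qed.

Lemma source_integrable phi : test_function phi -> rintegrable leb (source phi).
Proof.
move=> tphi; have [K K0 Kphi] := test_vanish tphi.
have [A A0 [pA dA]] := test_C1_bound tphi.
exact: (boxed_integral_rintegrable (measurable_time) (measurable_cube _) (time_finite)
  (lebesgue_cube_lty _) (boxed_source tphi (ltW K0) A0 Kphi pA dA)).
Qed.

Lemma source_out phi r : ~~ (0 <= r <= T) -> source phi r = 0.
Proof.
move=> rT; transitivity (\int[lam]_x (0 : R)); last by rewrite rintegral0.
apply: eq_Rintegral => x _; by rewrite (adv_out)// mulr0.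
Qed.

Lemma source_le phi K A r : test_function phi -> 0 <= K -> 0 <= A -> vanish_out K phi ->
  (forall x, `|phi x| <= A) -> (forall i x, `|partial i phi x| <= A) ->
  `|source phi r| <= M * (adv_const (K + Xm) * A) * vol (d := d) (K + Xm).
Proof.
move=> tphi K0 A0 Kphi pA dA.
exact: (boxed_section_le (measurable_cube _) (lebesgue_cube_lty _) r (boxed_source tphi K0 A0 Kphi pA dA)).
Qed.

Definition moved phi t := \int[lam]_x (u t x * phi (x + - X t)).

(** Extended by 0 off the triangle 0 <= r <= t <= T, the source becomes a function on a square, to
    which Fubini's theorem applies. *)
Definition past_source phi t r :=
  if (0 <= t <= T) && (r <= t) then source phi r else 0.

Lemma past_sourceE phi t : 0 <= t <= T ->
  \int[leb]_r past_source phi t r = \int[leb]_(r in `[0, t]) source phi r.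
Proof.
move=> tT; rewrite [RHS]Rintegral_mkcond; apply: eq_Rintegral => r _.
rewrite patchE /past_source tT/=; have [rt|tr] := leP r t.
  case: ifPn => //; rewrite notin_setE/= in_itv/= rt andbT => /negP r0.
  by rewrite source_out// negb_and r0.
by case: ifPn => //; rewrite inE/= in_itv/= => /andP[_]; rewrite leNgt tr.
Qed.

Local Notation time := (`[0, T]%classic : set (measurableTypeR R)).

Lemma boxed_past_source phi : test_function phi -> exists N,
  boxed (T1 := measurableTypeR R) (T2 := measurableTypeR R) time time N (past_source phi).
Proof.
move=> tphi; have [K K0 Kphi] := test_vanish tphi.
have [A A0 [pA dA]] := test_C1_bound tphi.
have sN r := source_le r tphi (ltW K0) A0 Kphi pA dA.
set N := M * _ * _ in sN.
exists N; split.
- apply: measurable_fun_ifT => //.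
  + apply: measurable_and; last first.
      by apply: measurable_fun_ler; [exact: measurable_snd|exact: measurable_fst].
    by apply: measurable_and; apply: measurable_fun_ler => //; exact: measurable_fst.
  + exact: (measurableT_comp (rintegrable_measurable (source_integrable tphi)) measurable_snd).
- move=> t r; rewrite /past_source; case: ifP => _; first exact: sN.
  by rewrite normr0 (le_trans _ (sN 0)).
- move=> t r; rewrite /past_source; case: ifPn => [/andP[tT rt]|_]; last by rewrite eqxx.
  move=> s0; split; rewrite /= in_itv//=; apply: contraNT s0 => rT.
  by rewrite source_out.
Qed.

Lemma boxed_moved phi K A (theta : R -> R) Q :
  test_function phi -> vanish_out K phi -> (forall x, `|phi x| <= A) ->
  measurable_fun [set: measurableTypeR R] theta ->
  (forall r, `|theta r| <= Q) -> (forall r, ~~ (0 <= r <= T) -> theta r = 0) ->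
  box (Q * (M * A)) (K + Xm) (fun r x => theta r * (u r x * phi (x + - X r))).
Proof.
move=> tphi Kphi pA mth thQ th0; apply: boxedP.
- apply: measurable_funM; first exact: (measurableT_comp mth measurable_fst).
  apply: measurable_funM => //.
  have m1 := measurableT_comp (test_measurable tphi) (@measurable_snd _ _ (measurableTypeR R) 'rV[R]_d).
  exact: (measurableT_comp m1 (measurable_moving_frame)).
- by move=> t x; rewrite !normrM ler_pM// ?mulr_ge0// ler_pM.
- by move=> t x Kx; rewrite [phi _](vanish_moving t Kphi Kx) !mulr0.
- by move=> t x tT; rewrite th0// mul0r.
Qed.

Theorem moving_frame phi : test_function phi ->
  {ae leb, forall t, 0 <= t <= T ->
    moved phi t = \int[lam]_x (u0 x * phi x) + \int[leb]_(r in `[0, t]) source phi r}.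
Proof.
move=> tphi; have [K K0 Kphi] := test_vanish tphi.
have [A A0 [pA dA]] := test_C1_bound tphi.
have mT := measurable_time; have fT := time_finite.
have mphi := test_measurable tphi.
have intux t : rintegrable lam (fun x => u t x * phi (x + - X t)).
  apply: (rintegrable_bddM _ (u_le t) (test_integrable (test_shiftf (- X t) tphi))).
  exact: (measurableT_comp mu_ (measurable_pair1 t)).
have [N bG] := boxed_past_source tphi.
pose I := \int[lam]_x (u0 x * phi x).
pose past t := \int[leb]_r past_source phi t r.
have pastN t : `|past t| <= N * fine (leb `[0, T]%classic).
  exact: (boxed_section_le mT fT t bG).
have mpast : measurable_fun [set: measurableTypeR R] past.
  exact: (rintegrable_measurable (boxed_integral_rintegrable mT mT fT fT bG)).
(* u is not assumed to vanish outside [0, T]; the cut-off brings the integrand of [moved phi] into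
   the class [boxed]. *)
pose one (t : R) : R := if 0 <= t <= T then 1 else 0.
have ind1 r : `|one r| <= 1 by rewrite /one; case: ifP; rewrite ?normr1// normr0.
have ind0 r : ~~ (0 <= r <= T) -> one r = 0 by rewrite /one => /negPf ->.
have mone : measurable_fun [set: measurableTypeR R] one.
  by apply: measurable_fun_ifT => //; apply: measurable_and; apply: measurable_fun_ler.
have bV := boxed_moved tphi Kphi pA mone ind1 ind0.
have mV := rintegrable_measurable (boxed_integral_rintegrable mT (measurable_cube _) fT (lebesgue_cube_lty _) bV).
have VN t := boxed_section_le (measurable_cube _) (lebesgue_cube_lty _) t bV.
pose V t := \int[lam]_x (one t * (u t x * phi (x + - X t))).
have {}mV : measurable_fun [set: measurableTypeR R] V by exact: mV.
have {}VN t : `|V t| <= 1 * (M * A) * fine (lam (cube (K + Xm))) by exact: VN.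
have VE t : 0 <= t <= T -> V t = moved phi t.
  by move=> tT; apply: eq_Rintegral => x _; rewrite /one tT mul1r.
pose dif t := V t - I - past t.
(* The test density is the defect of the identity itself, so that the duality
   yields \int theta^2 = 0. *)
pose theta t := if 0 <= t < T then dif t else 0.
have thetaE t : 0 <= t < T -> theta t = moved phi t - I - past t.
  by move=> tT; rewrite /theta tT /dif VE//; case/andP: tT => -> /ltW ->.
have theta_out r : ~~ (0 <= r < T) -> theta r = 0.
  by rewrite /theta => /negPf ->.
have theta_out' r : ~~ (0 <= r <= T) -> theta r = 0.
  by move=> rT; apply: theta_out; apply: contraNN rT => /andP[-> /ltW ->].
have mtheta : measurable_fun [set: measurableTypeR R] theta.
  apply: measurable_fun_ifT => //.
    by apply: measurable_and; [apply: measurable_fun_ler|apply: measurable_fun_ltr].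
  by apply: measurable_funB => //; apply: measurable_funB.
have [Q thetaQ] : exists Q, forall r, `|theta r| <= Q.
  exists (1 * (M * A) * fine (lam (cube (K + Xm))) + `|I| + N * fine (leb `[0, T]%classic)) => r.
  have big : `|dif r| <= 1 * (M * A) * fine (lam (cube (K + Xm))) + `|I| + N * fine (leb `[0, T]%classic).
    by rewrite (le_trans (ler_normB _ _))// lerD// (le_trans (ler_normB _ _))// lerD2r; exact: VN.
  by rewrite /theta; case: ifP => // _; rewrite normr0 (le_trans _ big).
have inttheta := theta_integrable mtheta thetaQ theta_out.
have dual := u_dual (admissible_base mtheta thetaQ theta_out tphi).
have [N' [K' bF]] := boxed_dual_rhs
  (admissible_base mtheta thetaQ theta_out tphi).
have bUF : box (M * N') K' (fun r x => u r x * dual_rhs (fun t x => theta t * phi x)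
    (fun t x => tail_integral theta t * phi x) r x).
  have [mF FN' Fs] := bF; split.
  - exact: measurable_funM.
  - by move=> r x; rewrite normrM ler_pM.
  - by move=> r x; rewrite mulf_eq0 negb_or => /andP[_]; exact: Fs.
have intFx r := boxed_section_integrable (measurable_cube _) (lebesgue_cube_lty _) r (boxed_source tphi (ltW K0) A0 Kphi pA dA).
have secE r : \int[lam]_x (u r x * dual_rhs (fun t x => theta t * phi x)
    (fun t x => tail_integral theta t * phi x) r x) =
    tail_integral theta r * source phi r - theta r * moved phi r.
  transitivity (\int[lam]_x (tail_integral theta r * (u r x * adv r (shiftf (- X r) phi) x) +
     (- theta r) * (u r x * phi (x + - X r)))).
    by apply: eq_Rintegral => x _; rewrite (dual_rhs_base theta r x tphi); ring.
  rewrite rintegralZD//; last exact: rintegrableZ.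
  by rewrite rintegralZ// mulNr.
have eta_source r : tail_integral theta r * source phi r =
    \int[leb]_t (theta t * past_source phi t r).
  have [rT|rT] := boolP (0 <= r <= T); last first.
    rewrite source_out// mulr0 -[LHS](rintegral0 leb); apply: eq_Rintegral => t _.
    by rewrite /past_source source_out//; case: ifP; rewrite mulr0.
  rewrite /tail_integral mulrC Rintegral_mkcond -rintegralZ; last first.
    apply: (le_rintegrable _ _ inttheta).
      apply/(measurable_restrictT _ _).1 => //.
      by apply: measurable_funTS.
    by move=> t; rewrite patchE; case: ifP => _ //=; rewrite normr0.
  apply: eq_Rintegral => t _; rewrite patchE /past_source mem_setE/= in_itv/= andbT.
  have [rt|tr] := leP r t; last by rewrite andbF !mulr0.
  have [tT|tT] := boolP (0 <= t <= T); first by rewrite mulrC.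
  by rewrite theta_out'// mulr0 mul0r.
have bG' : boxed (T1 := measurableTypeR R) (T2 := measurableTypeR R) time time
    (Q * N) (fun t r => theta t * past_source phi t r).
  have [mG GN Gs] := bG; split.
  - by apply: measurable_funM => //; exact: (measurableT_comp mtheta measurable_fst).
  - by move=> t r; rewrite normrM ler_pM.
  - by move=> t r; rewrite mulf_eq0 negb_or => /andP[_]; exact: Gs.
(* The tail integral at r runs over t >= r, so exchanging the integrals over the triangle r <= t
   produces the primitive of the source at t. *)
have int_eta : \int[leb]_r (tail_integral theta r * source phi r) =
    \int[leb]_t (theta t * past t).
  under eq_Rintegral do rewrite eta_source.
  rewrite -(boxed_fubini2 mT mT fT fT bG') (boxed_fubini mT mT fT fT bG').
  apply: eq_Rintegral => t _; rewrite rintegralZ//.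
  exact: (boxed_section_integrable mT fT t bG).
have tail0 : tail_integral theta 0 = \int[leb]_t theta t.
  rewrite /tail_integral Rintegral_mkcond; apply: eq_Rintegral => t _.
  rewrite patchE mem_setE/= in_itv/= andbT; case: ifPn => // t0.
  by rewrite theta_out// negb_and t0.
have int_eta_source : rintegrable leb (fun r => tail_integral theta r * source phi r).
  rewrite (_ : (fun r => _) = (fun r => \int[leb]_t (theta t * past_source phi t r))); last first.
    by apply/funext => r; exact: eta_source.
  have bG'' : boxed (T1 := measurableTypeR R) (T2 := measurableTypeR R) time time
      (Q * N) (fun r t => theta t * past_source phi t r).
    have [mG GN Gs] := bG'; split.
    - exact: (measurableT_comp mG (measurable_fun_pair measurable_snd measurable_fst)).
    - by move=> r t; exact: GN.
    - by move=> r t /Gs[].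
  exact: (boxed_integral_rintegrable mT mT fT fT bG'').
have thetaM t : theta t * moved phi t = theta t * V t.
  have [tT|tT] := boolP (0 <= t <= T); first by rewrite VE.
  by rewrite theta_out'// !mul0r.
have int_theta (h : R -> R) H : measurable_fun [set: measurableTypeR R] h ->
    (forall t, `|h t| <= H) -> rintegrable leb (fun t => theta t * h t).
  move=> mh hH; have := rintegrable_bddM mh hH inttheta.
  by rewrite /rintegrable; congr integrable; apply/funext => t /=; rewrite mulrC.
have int_past := int_theta _ _ mpast pastN.
have int_V := int_theta _ _ mV VN.
(* One factor theta is expanded as V - I - past; the dual identity for the curve built on theta and
   phi says that the three resulting terms cancel. *)
have sq0 : \int[leb]_t (theta t * theta t) = 0.
  transitivity (\int[leb]_t (theta t * V t) - I * \int[leb]_t theta t - \int[leb]_t (theta t * past t)).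
    rewrite -rintegralZ// -rintegralB//; last exact: rintegrableZ.
    rewrite -rintegralB//; last exact: (rintegrableB _ (rintegrableZ _ _)).
    apply: eq_Rintegral => t _; have [tT|tT] := boolP (0 <= t < T); last by rewrite theta_out//; ring.
    by rewrite {2}/theta tT /dif; ring.
  have := dual; rewrite (boxed_fubini mT (measurable_cube K') fT (lebesgue_cube_lty K') bUF).
  under eq_Rintegral do rewrite secE thetaM.
  rewrite rintegralB// int_eta => E.
  have -> : \int[leb]_t (theta t * V t) = \int[leb]_t (theta t * past t) +
      \int[lam]_x (u0 x * (tail_integral theta 0 * phi x)).
    apply/eqP; rewrite addrC -subr_eq -[X in X == _]opprB -[X in _ == X]opprK; apply/eqP.
    by congr (- _); exact: E.
  have -> : \int[lam]_x (u0 x * (tail_integral theta 0 * phi x)) = tail_integral theta 0 * I.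
    rewrite -rintegralZ; last exact: (rintegrable_bddM mu0 u0_le (test_integrable tphi)).
    by apply: eq_Rintegral => x _; ring.
  by rewrite tail0; ring.
have theta0 : {ae leb, forall t, theta t = 0}.
  have mth2 : measurable_fun [set: measurableTypeR R] (fun t => (theta t * theta t)%:E).
    by apply/measurable_EFinP; exact: measurable_funM.
  have := (@ae_eq_integral_abs _ _ _ leb _ measurableT _ mth2).1.
  rewrite (_ : (\int[_]_(x in _) _)%E = 0%E); last first.
    under eq_integral do rewrite gee0_abs ?lee_fin -?expr2 ?sqr_ge0//.
    have := int_theta _ _ mtheta thetaQ => int2.
    by rewrite -rintegralE ?sq0.
  move=> /(_ erefl); have fae : Filter (almost_everywhere leb) by exact: ae_filter_ringOfSetsType.
  apply: filterS => t /(_ Logic.I) [] /eqP; rewrite mulf_eq0 => /orP[] /eqP //.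
(* theta was set to 0 at T, so this single time is left out. *)
have aeT : {ae leb, forall t, t <> T}.
  exists [set T]; split; first exact: measurable_set1.
    by rewrite [LHS]lebesgue_measure_set1.
  by move=> t /contrapT.
have fae : Filter (almost_everywhere leb) by exact: ae_filter_ringOfSetsType.
apply: (filterS2 _ _ theta0 aeT) => t th0 /eqP tT t0T.
rewrite -past_sourceE//; apply/eqP; rewrite -subr_eq0 opprD addrA -/I -/(past t).
by rewrite -thetaE ?th0//; case/andP: t0T => -> tT'; rewrite lt_neqAle tT.
Qed.

End moving_frame.

End transport.

(** * Rough expansions *)

Section linear_functional.
Context {R : realType} {d : nat}.
Implicit Types (phi f : 'rV[R]_d -> R) (x h : 'rV[R]_d).

Lemma test_lincomb (I : finType) (c : I -> R) (F : I -> 'rV[R]_d -> R) :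
  (forall i, test_function (F i)) ->
  test_function (fun x => \sum_i c i * F i x) /\
  forall k x, partial k (fun x => \sum_i c i * F i x) x = \sum_i c i * partial k (F i) x.
Proof.
move=> tF.
elim: (index_enum I) => [|i r [tr pr]].
  rewrite (_ : (fun x => _) = cst 0); last by apply/funext => x; rewrite big_nil.
  by split; [exact: test0|move=> k x; rewrite partial_cst big_nil].
rewrite (_ : (fun x => \sum_(i <- i :: r) c i * F i x) =
  (fun x => c i * F i x + \sum_(i <- r) c i * F i x)); last first.
  by apply/funext => x; rewrite big_cons.
split; first exact: (testD (testZ _ (tF i)) tr).
move=> k x; rewrite (partialD k x (smoothZ _ (test_smooth (tF i))) (test_smooth tr)).
by rewrite (partialZ k _ x (test_smooth (tF i))) pr big_cons.
Qed.

(** The functionals to come are linear on test functions only, so a Taylor remainder is written as a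
    finite combination of test functions: the shifted function ([inl true]), the function itself
    ([inl false]) and its derivatives. *)
Definition taylor1_index := (bool + 'I_d)%type.
Definition taylor1_coef h (i : taylor1_index) : R :=
  match i with inl b => if b then 1 else -1 | inr i => - h ord0 i end.
Definition taylor1_term f h (i : taylor1_index) : 'rV[R]_d -> R :=
  match i with inl b => if b then shiftf h f else f | inr i => partial i f end.

Lemma taylor1_lincomb f h x :
  taylor1 f x h = \sum_i taylor1_coef h i * taylor1_term f h i x.
Proof.
rewrite big_sumType big_bool/= /taylor1 /shiftf mul1r mulN1r; congr (_ + _).
by rewrite -sumrN; apply: eq_bigr => i _; rewrite mulNr.
Qed.

Definition taylor2_index := (taylor1_index + 'I_d * 'I_d)%type.
Definition taylor2_coef h (i : taylor2_index) : R :=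
  match i with inl i => taylor1_coef h i
  | inr p => - 2^-1 * (h ord0 p.1 * h ord0 p.2) end.
Definition taylor2_term f h (i : taylor2_index) : 'rV[R]_d -> R :=
  match i with inl i => taylor1_term f h i | inr p => partial p.2 (partial p.1 f) end.

Lemma taylor2_lincomb f h x :
  taylor2 f x h = \sum_i taylor2_coef h i * taylor2_term f h i x.
Proof.
rewrite big_sumType/= -taylor1_lincomb /taylor2; congr (_ + _).
rewrite pair_bigA/= mulr_sumr -sumrN; apply: eq_bigr => i _.
by rewrite mulrA !mulNr.
Qed.

Lemma test_taylor1_term f h i : test_function f -> test_function (taylor1_term f h i).
Proof.
move=> tf; case: i => [[]|i] /=; [exact: test_shiftf|exact: tf|exact: test_partial].
Qed.

Lemma test_taylor2_term f h i : test_function f -> test_function (taylor2_term f h i).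
Proof.
move=> tf; case: i => [i|i] /=; first exact: test_taylor1_term.
by do 2 apply: test_partial.
Qed.

(** Derivatives commute with shifts and with each other. The gradient of a remainder is needed
    because the functionals will be bounded by a C^1 norm. *)
Lemma partial_taylor1 f h k x : test_function f ->
  partial k (fun x => taylor1 f x h) x = taylor1 (partial k f) x h.
Proof.
move=> tf; have sf := test_smooth tf.
have -> : (fun x => taylor1 f x h) = (fun x => \sum_i taylor1_coef h i * taylor1_term f h i x).
  by apply/funext => y; exact: taylor1_lincomb.
rewrite (test_lincomb _ (fun i => test_taylor1_term h i tf)).2 taylor1_lincomb.
apply: eq_bigr => i _; congr (_ * _); case: i => [[]|i].
- exact: (congr1 (@^~ x) (partial_shiftf h f k)).
- reflexivity.
- exact: (partialC k i x sf).
Qed.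

Lemma partial_taylor2 f h k x : test_function f ->
  partial k (fun x => taylor2 f x h) x = taylor2 (partial k f) x h.
Proof.
move=> tf; have sf := test_smooth tf.
have -> : (fun x => taylor2 f x h) = (fun x => \sum_i taylor2_coef h i * taylor2_term f h i x).
  by apply/funext => y; exact: taylor2_lincomb.
rewrite (test_lincomb _ (fun i => test_taylor2_term h i tf)).2 taylor2_lincomb.
apply: eq_bigr => i _; congr (_ * _); case: i => [[[]|i]|[i j]].
- exact: (congr1 (@^~ x) (partial_shiftf h f k)).
- reflexivity.
- exact: (partialC k i x sf).
- transitivity (partial j (partial k (partial i f)) x).
    exact: (partialC k j x (smooth_partial i sf)).
  apply: (congr1 (fun g => partial j g x)).
  by apply/funext => y; exact: (partialC k i y sf).
Qed.

Lemma vanish_taylor1 f h K : vanish_out K f -> vanish_out (K + `|h|) (fun x => taylor1 f x h).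
Proof.
move=> Kf x Kx; have Kx' : K < `|x| by rewrite (le_lt_trans _ Kx)// lerDl.
rewrite /taylor1 [f (x + h)](vanish_shiftf (a := h) Kf Kx) Kf// big1 ?subrr// => i _.
by rewrite (vanish_partial i Kf Kx') mulr0.
Qed.

Lemma vanish_taylor2 f h K : vanish_out K f -> vanish_out (K + `|h|) (fun x => taylor2 f x h).
Proof.
move=> Kf x Kx; have Kx' : K < `|x| by rewrite (le_lt_trans _ Kx)// lerDl.
rewrite /taylor2 (vanish_taylor1 Kf Kx) big1 ?mulr0 ?subrr// => i _.
by rewrite big1// => j _; rewrite (vanish_partial j (vanish_partial i Kf) Kx') mulr0.
Qed.

Variable L : ('rV[R]_d -> R) -> R.
Hypothesis L_lin : forall a f g, test_function f -> test_function g ->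
  L (fun x => a * f x + g x) = a * L f + L g.

Lemma linear_lincomb (I : finType) (c : I -> R) (F : I -> 'rV[R]_d -> R) :
  (forall i, test_function (F i)) ->
  L (fun x => \sum_i c i * F i x) = \sum_i c i * L (F i).
Proof.
move=> tF.
suff [] : test_function (fun x => \sum_(i <- index_enum I) c i * F i x) /\
  L (fun x => \sum_(i <- index_enum I) c i * F i x) = \sum_(i <- index_enum I) c i * L (F i) by [].
elim: (index_enum I) => [|i r [tr pr]].
  rewrite (_ : (fun x => _) = cst 0); last by apply/funext => x; rewrite big_nil.
  split; first exact: test0; rewrite big_nil.
  have := L_lin 1 (@test0 R d) (@test0 R d).
  rewrite (_ : (fun x => _) = cst 0); last by apply/funext => x /=; rewrite mulr0 addr0.
  by move=> /eqP; rewrite mul1r addrC -subr_eq subrr => /eqP.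
rewrite (_ : (fun x => \sum_(i <- i :: r) c i * F i x) =
  (fun x => c i * F i x + \sum_(i <- r) c i * F i x)); last first.
  by apply/funext => x; rewrite big_cons.
split; first exact: (testD (testZ _ (tF i)) tr).
by rewrite L_lin// pr big_cons.
Qed.


Lemma test_taylor1 f h : test_function f -> test_function (fun x => taylor1 f x h).
Proof.
move=> tf; rewrite (_ : (fun x => _) = (fun x => \sum_i taylor1_coef h i * taylor1_term f h i x)).
  exact: (test_lincomb _ (fun i => test_taylor1_term h i tf)).1.
by apply/funext => y; exact: taylor1_lincomb.
Qed.

Lemma test_taylor2 f h : test_function f -> test_function (fun x => taylor2 f x h).
Proof.
move=> tf; rewrite (_ : (fun x => _) = (fun x => \sum_i taylor2_coef h i * taylor2_term f h i x)).
  exact: (test_lincomb _ (fun i => test_taylor2_term h i tf)).1.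
by apply/funext => y; exact: taylor2_lincomb.
Qed.

(** With a = X_s and h = X_t - X_s this expands L at the shift by X_t around its value at the shift
    by X_s. *)
Lemma linear_taylor1 f a h : test_function f ->
  L (shiftf a (fun x => taylor1 f x h)) =
  L (shiftf (a + h) f) - L (shiftf a f) - \sum_i h ord0 i * L (shiftf a (partial i f)).
Proof.
move=> tf; transitivity (L (fun x => \sum_i taylor1_coef h i * shiftf a (taylor1_term f h i) x)).
  by congr L; apply/funext => x; rewrite /shiftf taylor1_lincomb.
rewrite linear_lincomb; last by move=> i; apply: test_shiftf; exact: test_taylor1_term.
rewrite big_sumType big_bool/= mul1r mulN1r; congr (L _ - _ + _).
  by apply/funext => x; rewrite /shiftf addrA.
by rewrite -sumrN; apply: eq_bigr => i _; rewrite mulNr.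
Qed.

Lemma linear_taylor2 f a h : test_function f ->
  L (shiftf a (fun x => taylor2 f x h)) =
  L (shiftf (a + h) f) - L (shiftf a f) - \sum_i h ord0 i * L (shiftf a (partial i f))
  - 2^-1 * \sum_i \sum_j h ord0 i * h ord0 j * L (shiftf a (partial j (partial i f))).
Proof.
move=> tf; rewrite -linear_taylor1//.
transitivity (L (fun x => \sum_i taylor2_coef h i * shiftf a (taylor2_term f h i) x)).
  by congr L; apply/funext => x; rewrite /shiftf taylor2_lincomb.
rewrite linear_lincomb; last by move=> i; apply: test_shiftf; exact: test_taylor2_term.
rewrite big_sumType/= -linear_lincomb; last by move=> i; apply: test_shiftf; exact: test_taylor1_term.
congr (_ + _).
  by congr L; apply/funext => x; rewrite /shiftf taylor1_lincomb.
rewrite pair_bigA/= mulr_sumr -sumrN; apply: eq_bigr => i _.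
by rewrite !mulrA !mulNr.
Qed.

End linear_functional.

(** Values and gradient are estimated together because [Lam] and [source] are bounded by C^1 norms;
    the difference is written in the form in which linearity is assumed. *)
Lemma shift_difference (R : realType) (d : nat) (f : 'rV[R]_d -> R) :
  test_function f -> exists2 A, 0 <= A & forall v w : 'rV[R]_d,
    (forall x, `|-1 * shiftf v f x + shiftf w f x| <= A * `|w - v|) /\
    (forall i x, `|partial i (fun x => -1 * shiftf v f x + shiftf w f x) x| <= A * `|w - v|).
Proof.
move=> tf; have sf := test_smooth tf.
have [A1 A10 A1f] := test_family_bound (fun i => test_partial i tf).
have [A2 A20 A2f] := test_family_bound (fun ij : 'I_d * 'I_d => test_partial ij.2 (test_partial ij.1 tf)).
have AA0 := addr_ge0 A10 A20.
exists ((A1 + A2) * d%:R) => [|v w]; first by rewrite mulr_ge0.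
have tv := test_shiftf v tf; have tw := test_shiftf w tf.
split=> [x|i x].
  rewrite mulN1r addrC /shiftf.
  have := @lipschitz_bound _ _ f (A1 + A2) sf AA0 _ (x + v) (w - v).
  rewrite -addrA [v + _]addrC subrK; apply.
  by move=> i y; rewrite (le_trans (A1f i y))// lerDl.
rewrite (partialD i x (smoothZ _ (test_smooth tv)) (test_smooth tw)).
rewrite (partialZ i _ x (test_smooth tv)) !partial_shiftf mulN1r addrC /shiftf.
have := @lipschitz_bound _ _ (partial i f) (A1 + A2) (smooth_partial i sf) AA0 _ (x + v) (w - v).
rewrite -addrA [v + _]addrC subrK; apply.
by move=> j y; rewrite (le_trans (A2f (i, j) y))// lerDr.
Qed.

(** * Hoelder norms and superlinear powers *)

Section hoelder_bounds.
Context {R : realType}.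

Lemma mx_norm_le m n (x : 'M[R]_(m, n)) (a : R) :
  0 <= a -> (forall i j, `|x i j| <= a) -> `|x| <= a.
Proof.
move=> a0 xa; rewrite [leLHS]/Num.Def.normr /= mx_normrE.
by apply: bigmax_le => // -[i j] _ /=.
Qed.

Lemma continuous_rV (S : topologicalType) n (g : S -> 'rV[R]_n) :
  (forall i, continuous (fun p => g p ord0 i)) -> continuous g.
Proof.
move=> cg p; apply/cvgrPdist_le => e e0.
have : \forall q \near p, forall i, `|g p ord0 i - g q ord0 i| <= e.
  by apply: filter_forall => i; have /cvgrPdist_le/(_ _ e0) := cg i p.
apply: filterS => q gq; apply: rV_norm_le; first exact: ltW.
by move=> i; rewrite !mxE; exact: gq.
Qed.

Lemma continuous_sum_ord (S : topologicalType) n (g : 'I_n -> S -> R) :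
  (forall i, continuous (g i)) -> continuous (fun p => \sum_i g i p).
Proof.
move=> cg; elim: (index_enum _) => [|i r IH].
  rewrite (_ : (fun _ => _) = cst 0); first by move=> p; exact: cvg_cst.
  by apply/funext => p; rewrite big_nil.
rewrite (_ : (fun _ => _) = (fun p => g i p + \sum_(i <- r) g i p)).
  by move=> p; apply: cvgD; [exact: cg|exact: IH].
by apply/funext => p; rewrite big_cons.
Qed.

Variable T : R.

Lemma hoelder_norm2_lty (V : normedModType R) (nu C : R) (F : R -> R -> V) :
  (forall s t, 0 <= s <= T -> 0 <= t <= T -> `|F s t| <= C * `|t - s| `^ nu) ->
  (hoelder_norm2 T nu F < +oo)%E.
Proof.
move=> HF; apply: (@le_lt_trans _ _ C%:E); last exact: ltry.
apply: ge_ereal_sup => _ [s [t [sT tT st ->]]]; rewrite !in_itv/= in sT tT.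
by rewrite lee_fin ler_pdivrMr ?powR_gt0 ?normr_gt0 ?subr_eq0 1?eq_sym// HF.
Qed.

Lemma hoelder_path_lty (V : normedModType R) (nu C : R) (f : R -> V) :
  (forall s t, 0 <= s <= T -> 0 <= t <= T -> `|f t - f s| <= C * `|t - s| `^ nu) ->
  hoelder_path T nu f.
Proof.
move=> Hf; rewrite /hoelder_path /hoelder_norm lte_add_pinfty ?ltry//.
exact: (@hoelder_norm2_lty _ nu C).
Qed.

(** Since h^p = h h^(p-1), it is enough that h^(p-1) <= e / (C + 1), which gives delta; C + 1 avoids
    a division by 0. *)
Lemma powR_little (C p e : R) : 0 <= C -> 1 < p -> 0 < e ->
  exists2 delta, 0 < delta & forall h, 0 <= h -> h < delta -> C * h `^ p <= e * h.
Proof.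
move=> C0 p1 e0; have C1 : 0 < C + 1 by rewrite ltr_wpDl.
have p0 : 0 < p - 1 by rewrite subr_gt0.
exists ((e / (C + 1)) `^ (p - 1)^-1); first by rewrite powR_gt0// divr_gt0.
move=> h h0 hd; rewrite -(mulr_powRB1 h0) ?(lt_trans ltr01)// mulrCA [leRHS]mulrC ler_wpM2l//.
rewrite (@le_trans _ _ ((C + 1) * (e / (C + 1))))//; last by rewrite mulrCA divff ?mulr1// gt_eqF.
rewrite ler_pM ?powR_ge0// ?lerDl//.
rewrite (@le_trans _ _ (((e / (C + 1)) `^ (p - 1)^-1) `^ (p - 1)))//.
  by rewrite ge0_ler_powR ?(ltW p0)// ?nnegrE ?powR_ge0// ltW.
by rewrite -powRrM mulVf ?gt_eqF// powRr1// divr_ge0// ltW.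
Qed.

End hoelder_bounds.

Lemma rough_sum_cons (R : realType) (d : nat) (X : R -> 'rV[R]_d)
    (XX : R -> R -> 'M[R]_d) (y : R -> 'rV[R]_d) (y' : R -> 'M[R]_d) (s p : R) P :
  rough_sum X XX y y' s (p :: P) =
  dotmul (y s) (increment X s p) + \tr (y' s *m XX s p) + rough_sum X XX y y' p P.
Proof. by rewrite /rough_sum /= big_nat_recl. Qed.

(** * Controlled expansion and rough integral of the solution *)

Section rough_transport.
Context {R : realType} {d : nat}.
Implicit Types (f phi : 'rV[R]_d -> R) (s t a b : R).
Variables (T gamma Xm H : R) (X : R -> 'rV[R]_d).
Variables (Lam : R -> ('rV[R]_d -> R) -> R) (Drift : ('rV[R]_d -> R) -> R -> R).
Hypotheses (T0 : 0 < T) (gamma_gt : 1 / 3 < gamma) (gamma_le : gamma <= 1 / 2).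
Hypotheses (cX : continuous X) (X_le : forall t, `|X t| <= Xm).
Hypothesis X_hoelder : forall s t, 0 <= s <= T -> 0 <= t <= T ->
  `|X t - X s| <= H * `|t - s| `^ gamma.
Hypothesis Lam_lin : forall t (a : R) f phi, test_function f -> test_function phi ->
  Lam t (fun x => a * f x + phi x) = a * Lam t f + Lam t phi.
(** The order is one because the source contains the gradient of the test function. The constant
    depends on the test function through the radius of its support only, hence is uniform over the
    shifts by X_t. *)
Hypothesis Lam_le : forall K, 0 <= K -> exists2 C, 0 <= C &
  forall t f A, test_function f -> vanish_out K f -> 0 <= A ->
    (forall x, `|f x| <= A) -> (forall i x, `|partial i f x| <= A) ->
    `|Lam t f| <= C * A /\ forall s, `|Lam t f - Lam s f| <= C * A * `|t - s|.
(** The first difference keeps the shift at X_t where the drift uses the current X_r; the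
    discrepancy is of order (t - s)^gamma, and integration in time adds 1 to the exponent. *)
Hypothesis Drift_le : forall f, test_function f -> exists2 C, 0 <= C &
  forall s t, 0 <= s -> s <= t -> t <= T ->
    `|Lam t (shiftf (X t) f) - Lam s (shiftf (X t) f) - (Drift f t - Drift f s)| <=
    C * (t - s) `^ (1 + gamma).

Definition rough_value f t := Lam t (shiftf (X t) f).
Local Notation U := rough_value.

Let Xm0 : 0 <= Xm. Proof. exact: le_trans (X_le 0). Qed.

Let gamma0 : 0 < gamma. Proof. by rewrite (lt_trans _ gamma_gt)// divr_gt0. Qed.

Let gamma_le1 : gamma <= 1. Proof. by move: gamma_le; lra. Qed.

Let gamma2_le1 : 2 * gamma <= 1. Proof. by move: gamma_le; lra. Qed.

Lemma Lam_shift_lipschitz f : test_function f -> exists2 C, 0 <= C &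
  forall s (v w : 'rV[R]_d), `|v| <= Xm -> `|w| <= Xm ->
    `|Lam s (shiftf w f) - Lam s (shiftf v f)| <= C * `|w - v|.
Proof.
move=> tf; have [K K0 Kf] := test_vanish tf; have [A A0 HA] := shift_difference tf.
have [C C0 HC] := Lam_le (addr_ge0 (ltW K0) Xm0).
exists (C * A) => [|s v w vX wX]; first by rewrite mulr_ge0.
have tv := test_shiftf v tf; have tw := test_shiftf w tf.
have := Lam_lin s (-1) tv tw; rewrite mulN1r addrC => <-; rewrite -mulrA.
apply: (HC s _ _ _ _ _ _ _).1.
- exact: testD (testZ _ tv) tw.
- have van (a : 'rV[R]_d) : `|a| <= Xm -> vanish_out (K + Xm) (shiftf a f).
    by move=> aX; apply: (vanish_out_le _ (vanish_shiftf (a := a) Kf)); rewrite lerD2l.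
  by move=> x Kx; rewrite (van _ vX)// (van _ wX)// mulr0 addr0.
- exact: mulr_ge0.
- exact: (HA v w).1.
- exact: (HA v w).2.
Qed.

Lemma increment_le s t : `|X t - X s| <= 2 * Xm.
Proof. by rewrite (le_trans (ler_normB _ _))// mulrDl mul1r lerD. Qed.

(** The increment X t - X s costs 2 * Xm and the shift by X s another Xm. *)
Lemma vanish_taylor_moved (F : ('rV[R]_d -> R) -> 'rV[R]_d -> 'rV[R]_d -> R) f K s t :
  vanish_out (K + `|X t - X s|) (fun x => F f x (X t - X s)) ->
  vanish_out (K + 3 * Xm) (shiftf (X s) (fun x => F f x (X t - X s))).
Proof.
move=> /(vanish_shiftf (a := X s)); apply: vanish_out_le.
have := increment_le s t; have := X_le s; lra.
Qed.

(** [Lam] also sees the gradient of the remainder, so derivatives of f one order higher (A3) enter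
    beside those that bound the remainder itself (A2). *)
Lemma Lam_taylor1 f : test_function f -> exists2 C, 0 <= C & forall s t,
  `|Lam s (shiftf (X t) f) - U f s - \sum_i (X t - X s) ord0 i * U (partial i f) s| <=
  C * `|X t - X s| ^+ 2.
Proof.
move=> tf; have [K K0 Kf] := test_vanish tf; have sf := test_smooth tf.
have [A2 A20 A2f] := test_family_bound (fun ij : 'I_d * 'I_d => test_partial ij.2 (test_partial ij.1 tf)).
have [A3 A30 A3f] := test_family_bound (fun ij : 'I_d * ('I_d * 'I_d) =>
  test_partial ij.2.2 (test_partial ij.2.1 (test_partial ij.1 tf))).
have KX0 : 0 <= K + 3 * Xm by rewrite addr_ge0 ?(ltW K0)// mulr_ge0.
have [C C0 HC] := Lam_le KX0.
have AA0 := addr_ge0 A20 A30.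
exists (C * ((A2 + A3) * d%:R ^+ 2)) => [|s t].
  by rewrite !mulr_ge0// exprn_ge0.
have := linear_taylor1 (Lam_lin s) (X s) (X t - X s) tf.
rewrite [X s + _]addrC subrK => <-; rewrite -[leRHS]mulrA.
apply: (HC s _ _ _ _ _ _ _).1.
- exact/test_shiftf/test_taylor1.
- exact/vanish_taylor_moved/vanish_taylor1.
- by rewrite !mulr_ge0// exprn_ge0.
- move=> x; rewrite /shiftf; apply: (taylor1_bound sf AA0) => i j y.
  by rewrite (le_trans (A2f (i, j) y))// lerDl.
- move=> k x; rewrite partial_shiftf {1}/shiftf partial_taylor1//.
  apply: taylor1_bound => //; first exact: smooth_partial.
  by move=> i j y; rewrite (le_trans (A3f (k, (i, j)) y))// lerDr.
Qed.

Lemma Lam_taylor2 f : test_function f -> exists2 C, 0 <= C & forall s t,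
  `|Lam s (shiftf (X t) f) - U f s - \sum_i (X t - X s) ord0 i * U (partial i f) s
    - 2^-1 * \sum_i \sum_j (X t - X s) ord0 i * (X t - X s) ord0 j * U (partial j (partial i f)) s| <=
  C * `|X t - X s| ^+ 3.
Proof.
move=> tf; have [K K0 Kf] := test_vanish tf; have sf := test_smooth tf.
have [A2 A20 A2f] := test_family_bound (fun ij : 'I_d * ('I_d * 'I_d) =>
  test_partial ij.2.2 (test_partial ij.2.1 (test_partial ij.1 tf))).
have [A3 A30 A3f] := test_family_bound (fun ij : 'I_d * ('I_d * ('I_d * 'I_d)) =>
  test_partial ij.2.2.2 (test_partial ij.2.2.1 (test_partial ij.2.1 (test_partial ij.1 tf)))).
have KX0 : 0 <= K + 3 * Xm by rewrite addr_ge0 ?(ltW K0)// mulr_ge0.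
have [C C0 HC] := Lam_le KX0.
have AA0 := addr_ge0 A20 A30.
exists (C * ((A2 + A3) * d%:R ^+ 3)) => [|s t].
  by rewrite !mulr_ge0// exprn_ge0.
have := linear_taylor2 (Lam_lin s) (X s) (X t - X s) tf.
rewrite [X s + _]addrC subrK => <-; rewrite -[leRHS]mulrA.
apply: (HC s _ _ _ _ _ _ _).1.
- exact/test_shiftf/test_taylor2.
- exact/vanish_taylor_moved/vanish_taylor2.
- by rewrite !mulr_ge0// exprn_ge0.
- move=> x; rewrite /shiftf; apply: (taylor2_bound sf AA0) => i j l y.
  by rewrite (le_trans (A2f (i, (j, l)) y))// lerDl.
- move=> k x; rewrite partial_shiftf {1}/shiftf partial_taylor2//.
  apply: taylor2_bound => //; first exact: smooth_partial.
  by move=> i j l y; rewrite (le_trans (A3f (k, (i, (j, l))) y))// lerDr.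
Qed.

Lemma Lam_time_lipschitz f : test_function f -> exists2 C, 0 <= C & forall s t r,
  `|Lam t (shiftf (X r) f) - Lam s (shiftf (X r) f)| <= C * `|t - s|.
Proof.
move=> tf; have [K K0 Kf] := test_vanish tf.
have [A A0 [fA dfA]] := test_C1_bound tf.
have [C C0 HC] := Lam_le (addr_ge0 (ltW K0) Xm0).
exists (C * A) => [|s t r]; first exact: mulr_ge0.
apply: (HC t (shiftf (X r) f) A _ _ _ _ _).2.
- exact: test_shiftf.
- by apply: (vanish_out_le _ (vanish_shiftf (a := X r) Kf)); rewrite lerD2l.
- exact: A0.
- by move=> x; exact: fA.
- by move=> i x; rewrite partial_shiftf; exact: dfA.
Qed.


(** The change of time at the fixed shift X_t is separated from the change of shift at the fixed
    time s: the first is Lipschitz in time, the second is expanded by Taylor's formula. *)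
Lemma rough_value_diff f s t : U f t - U f s =
  (Lam t (shiftf (X t) f) - Lam s (shiftf (X t) f)) + (Lam s (shiftf (X t) f) - U f s).
Proof. by rewrite addrA subrK. Qed.

Lemma rough_value_lipschitz f : test_function f -> exists2 C, 0 <= C & forall s t,
  `|U f t - U f s| <= C * (`|t - s| + `|X t - X s|).
Proof.
move=> tf; have [C1 C10 H1] := Lam_time_lipschitz tf.
have [C2 C20 H2] := Lam_shift_lipschitz tf.
exists (C1 + C2) => [|s t]; first exact: addr_ge0.
rewrite rough_value_diff (le_trans (ler_normD _ _))// mulrDr lerD//.
  by rewrite (le_trans (H1 _ _ _))// ler_wpM2r// lerDl.
by rewrite (le_trans (H2 _ _ _ _ _))// ler_wpM2r// lerDr.
Qed.

Lemma rough_value_continuous f : test_function f -> continuous (U f).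
Proof.
move=> tf; have [C C0 HC] := rough_value_lipschitz tf => s.
apply/cvgrPdist_le => e e0; have e1 : 0 < e / (2 * (C + 1)).
  by rewrite divr_gt0// mulr_gt0// ltr_wpDl.
have dX : \forall t \near s, `|X s - X t| <= e / (2 * (C + 1)).
  by have /cvgrPdist_le/(_ _ e1) := @cX s.
have ds : \forall t \near s, `|s - t| <= e / (2 * (C + 1)).
  have : t @[t --> s] --> s by exact: cvg_id.
  by move=> /cvgrPdist_le/(_ _ e1).
apply: filterS2 dX ds => t dX ds; rewrite (le_trans (HC t s))//.
rewrite (@le_trans _ _ ((C + 1) * (e / (2 * (C + 1)) + e / (2 * (C + 1)))))//.
  by rewrite ler_pM ?addr_ge0 ?lerD// lerDl.
rewrite le_eqVlt; apply/orP; left; apply/eqP; field.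
by apply/eqP; lra.
Qed.

Lemma le_powR_time (beta h : R) : 0 <= h <= T -> beta <= 1 ->
  h <= T `^ (1 - beta) * h `^ beta.
Proof.
case/andP; rewrite le_eqVlt => /orP[/eqP <- _ _|h0 hT b1].
  by rewrite mulr_ge0// powR_ge0.
rewrite -[leLHS](powRr1 (ltW h0)) -{1}(subrK beta 1) powRD; last by rewrite (gt_eqF h0) implybT.
rewrite ler_wpM2r ?powR_ge0// ge0_ler_powR// ?subr_ge0// nnegrE; exact: ltW.
Qed.

Let time_diff s t : 0 <= s <= T -> 0 <= t <= T -> 0 <= `|t - s| <= T.
Proof.
move=> /andP[s0 sT] /andP[t0 tT]; rewrite normr_ge0/= ler_norml; apply/andP; split; lra.
Qed.

Lemma increment_powR n s t : 0 <= s <= T -> 0 <= t <= T ->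
  `|X t - X s| ^+ n <= `|H| ^+ n * `|t - s| `^ (n%:R * gamma).
Proof.
move=> sT tT; rewrite mulrC [n%:R * _]mulrC powRrM powR_mulrn ?powR_ge0// mulrC -exprMn.
rewrite lerXn2r// ?nnegrE ?mulr_ge0 ?powR_ge0// (le_trans (X_hoelder sT tT))//.
by rewrite ler_wpM2r ?powR_ge0// ler_norm.
Qed.

Lemma rough_value_hoelder f : test_function f -> exists2 C, 0 <= C &
  forall s t, 0 <= s <= T -> 0 <= t <= T -> `|U f t - U f s| <= C * `|t - s| `^ gamma.
Proof.
move=> tf; have [C C0 HC] := rough_value_lipschitz tf.
exists (C * (T `^ (1 - gamma) + `|H|)) => [|s t sT tT].
  by rewrite mulr_ge0// addr_ge0// powR_ge0.
rewrite (le_trans (HC s t))// -mulrA ler_wpM2l// mulrDl lerD//.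
  exact: (le_powR_time (time_diff sT tT) gamma_le1).
rewrite (le_trans (X_hoelder sT tT))// ler_wpM2r ?powR_ge0//; exact: ler_norm.
Qed.

(** As 2 gamma <= 1, the Lipschitz contribution of time is absorbed into |t - s|^(2 gamma); the
    Taylor remainder is quadratic in the increment of X. *)
Lemma rough_value_controlled f : test_function f -> exists2 C, 0 <= C &
  forall s t, 0 <= s <= T -> 0 <= t <= T ->
  `|U f t - U f s - \sum_i (X t - X s) ord0 i * U (partial i f) s| <=
  C * `|t - s| `^ (2 * gamma).
Proof.
move=> tf; have [C1 C10 H1] := Lam_time_lipschitz tf; have [C2 C20 H2] := Lam_taylor1 tf.
exists (C1 * T `^ (1 - 2 * gamma) + C2 * `|H| ^+ 2) => [|s t sT tT].
  by rewrite addr_ge0// mulr_ge0// ?powR_ge0// exprn_ge0.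
rewrite rough_value_diff -addrA (le_trans (ler_normD _ _))// mulrDl lerD//.
  rewrite (le_trans (H1 _ _ _))// -mulrA ler_wpM2l//.
  exact: (le_powR_time (time_diff sT tT) gamma2_le1).
by rewrite (le_trans (H2 _ _))// -mulrA ler_wpM2l// increment_powR.
Qed.

(** The exponent 1 + gamma comes from the drift, 3 gamma from the cubic Taylor remainder. *)
Lemma rough_value_expansion f : test_function f -> exists2 C, 0 <= C &
  forall s t, 0 <= s -> s <= t -> t <= T ->
  `|U f t - U f s - (Drift f t - Drift f s) - \sum_i (X t - X s) ord0 i * U (partial i f) s
    - 2^-1 * \sum_i \sum_j (X t - X s) ord0 i * (X t - X s) ord0 j * U (partial j (partial i f)) s| <=
  C * ((t - s) `^ (1 + gamma) + (t - s) `^ (3 * gamma)).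
Proof.
move=> tf; have [C1 C10 H1] := Drift_le tf; have [C2 C20 H2] := Lam_taylor2 tf.
exists (C1 + C2 * `|H| ^+ 3) => [|s t s0 st tT].
  by rewrite addr_ge0// mulr_ge0// exprn_ge0.
have ts0 : 0 <= t - s by rewrite subr_ge0.
have sI : 0 <= s <= T by rewrite s0 (le_trans st).
have tI : 0 <= t <= T by rewrite tT (le_trans s0).
set S1 := \sum_i (_ * U (partial i f) s); set S2 := 2^-1 * _.
rewrite (_ : _ - S2 = (Lam t (shiftf (X t) f) - Lam s (shiftf (X t) f) - (Drift f t - Drift f s))
  + (Lam s (shiftf (X t) f) - U f s - S1 - S2)); last first.
  by rewrite /rough_value; ring.
rewrite (le_trans (ler_normD _ _))// mulrDr lerD//.
  rewrite (le_trans (H1 _ _ _ _ _))// ler_wpM2r ?powR_ge0// lerDl.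
  by rewrite mulr_ge0// exprn_ge0.
rewrite (le_trans (H2 _ _))// (le_trans (ler_wpM2l C20 (increment_powR 3 sI tI)))//.
by rewrite (ger0_norm ts0) mulrA ler_wpM2r ?powR_ge0// lerDr.
Qed.


(** Used with a single function for u(phi) and with the d partial derivatives for u(grad phi). *)
Lemma controlled_rough_value k (F : 'I_k -> 'rV[R]_d -> R) : (forall i, test_function (F i)) ->
  controlled T gamma X (fun t => \row_i U (F i) t)
    (fun t => \matrix_(i, j) U (partial j (F i)) t).
Proof.
move=> tF.
(* Summing the constants over a finite index set makes them uniform in the component. *)
have uniform (I : finType) (Q : I -> R -> R -> R) nu :
    (forall i, exists2 C, 0 <= C & forall s t, 0 <= s <= T -> 0 <= t <= T -> Q i s t <= C * `|t - s| `^ nu) ->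
    exists2 C, 0 <= C & forall i s t, 0 <= s <= T -> 0 <= t <= T -> Q i s t <= C * `|t - s| `^ nu.
  move=> HQ; have /choice[C HC] : forall i, exists C, 0 <= C /\
      forall s t, 0 <= s <= T -> 0 <= t <= T -> Q i s t <= C * `|t - s| `^ nu.
    by move=> i; have [C C0 H1] := HQ i; exists C.
  exists (\sum_i C i) => [|i s t sT tT]; first by apply: sumr_ge0 => i _; have [] := HC i.
  rewrite (le_trans ((HC i).2 s t sT tT))// ler_wpM2r ?powR_ge0// (bigD1 i)//= lerDl.
  by apply: sumr_ge0 => j _; have [] := HC j.
have [C1 C10 H1] := uniform _ _ _ (fun i => rough_value_hoelder (tF i)).
have [C2 C20 H2] := uniform _ _ _ (fun ij : 'I_k * 'I_d => rough_value_hoelder (test_partial ij.2 (tF ij.1))).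
have [C3 C30 H3] := uniform _ _ _ (fun i => rough_value_controlled (tF i)).
split.
- apply: (@hoelder_path_lty _ T _ gamma C1) => s t sT tT.
  apply: mx_norm_le => [|i j]; first by rewrite mulr_ge0// powR_ge0.
  by rewrite !mxE; exact: H1.
- apply: (@hoelder_path_lty _ T _ gamma C2) => s t sT tT.
  apply: mx_norm_le => [|i j]; first by rewrite mulr_ge0// powR_ge0.
  by rewrite !mxE; exact: (H2 (i, j)).
have rE s t i : ((\row_i U (F i) t - \row_i U (F i) s) -
    ((\matrix_(i, j) U (partial j (F i)) s) *m (increment X s t)^T)^T) ord0 i =
    U (F i) t - U (F i) s - \sum_j (X t - X s) ord0 j * U (partial j (F i)) s.
  by rewrite !mxE; congr (_ - _); apply: eq_bigr => j _; rewrite !mxE mulrC.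
exists (fun s t => (\row_i U (F i) t - \row_i U (F i) s) -
    ((\matrix_(i, j) U (partial j (F i)) s) *m (increment X s t)^T)^T); last first.
  by move=> s t _ _; rewrite addrCA subrr addr0.
split.
- apply: continuous_subspaceT; apply: continuous_rV => i.
  rewrite (_ : (fun p => _) = (fun p : R * R => U (F i) p.2 - U (F i) p.1 -
    \sum_j (X p.2 - X p.1) ord0 j * U (partial j (F i)) p.1)); last first.
    by apply/funext => p; rewrite rE.
  have c1 f : test_function f -> continuous (fun p : R * R => U f p.1).
    by move=> tf p; apply: (@continuous_comp _ _ _ fst (U f)); [exact: cvg_fst|exact: rough_value_continuous].
  have c2 f : test_function f -> continuous (fun p : R * R => U f p.2).
    by move=> tf p; apply: (@continuous_comp _ _ _ snd (U f)); [exact: cvg_snd|exact: rough_value_continuous].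
  have cXj j : continuous (fun t : R => X t ord0 j).
    by move=> t; apply: (@continuous_comp _ _ _ X (fun v : 'rV[R]_d => v ord0 j)); [exact: cX|exact: coord_continuous].
  have cX1 j : continuous (fun p : R * R => X p.1 ord0 j).
    by move=> p; apply: (@continuous_comp _ _ _ fst (fun t => X t ord0 j)); [exact: cvg_fst|exact: cXj].
  have cX2 j : continuous (fun p : R * R => X p.2 ord0 j).
    by move=> p; apply: (@continuous_comp _ _ _ snd (fun t => X t ord0 j)); [exact: cvg_snd|exact: cXj].
  move=> p; apply: cvgB; first by apply: cvgB; [exact: c2|exact: c1].
  apply: continuous_sum_ord => j {}p.
  under eq_fun do rewrite !mxE.
  apply: cvgM; last exact: (c1 _ (test_partial j (tF i)) p).
  by apply: cvgB; [exact: cX2|exact: cX1].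
- move=> t _; apply/rowP => i; rewrite rE subrr sub0r mxE.
  by rewrite big1 ?oppr0// => j _; rewrite subrr mxE mul0r.
- apply: (@hoelder_norm2_lty _ T _ (2 * gamma) C3) => s t sT tT.
  apply: rV_norm_le => [|i]; first by rewrite mulr_ge0// powR_ge0.
  by rewrite rE; exact: H3.
Qed.

Variable XX : R -> R -> 'M[R]_d.
Hypothesis XX_sym : forall s t, 0 <= s -> s <= t -> t <= T ->
  XX s t + (XX s t)^T = tensor (increment X s t) (increment X s t).

Local Notation U1 f := (fun t => \row_i U (partial i f) t).
Local Notation U2 f := (fun t => \matrix_(i, j) U (partial j (partial i f)) t).
Local Notation germ f a b :=
  (dotmul (U1 f a) (increment X a b) + \tr (U2 f a *m XX a b)).

(** Against a symmetric A the antisymmetric part of B has trace 0, and C / 2 is its symmetric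
    part. *)
Lemma trace_symmetric (A B C : 'M[R]_d) : A^T = A -> B + B^T = C ->
  \tr (A *m B) = 2^-1 * \sum_i \sum_j C i j * A i j.
Proof.
move=> Asym BC; have tE : \tr (A *m B) = \sum_i \sum_j A i j * B j i.
  by rewrite /mxtrace; apply: eq_bigr => i _; rewrite mxE.
have tE' : \tr (A *m B) = \sum_i \sum_j A i j * B i j.
  rewrite tE exchange_big/=; apply: eq_bigr => i _; apply: eq_bigr => j _.
  by rewrite -{1}Asym mxE.
have -> : \sum_i \sum_j C i j * A i j = \tr (A *m B) + \tr (A *m B).
  rewrite {1}tE tE' -big_split/=; apply: eq_bigr => i _.
  rewrite -big_split/=; apply: eq_bigr => j _; rewrite -BC !mxE; ring.
by field.
Qed.

Lemma germE f s t : test_function f -> 0 <= s -> s <= t -> t <= T ->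
  germ f s t = \sum_i (X t - X s) ord0 i * U (partial i f) s +
    2^-1 * \sum_i \sum_j (X t - X s) ord0 i * (X t - X s) ord0 j * U (partial j (partial i f)) s.
Proof.
move=> tf s0 st tT; congr (_ + _).
  by apply: eq_bigr => i _; rewrite mxE mulrC.
rewrite (trace_symmetric _ (XX_sym s0 st tT)).
  congr (_ * _); apply: eq_bigr => i _; apply: eq_bigr => j _.
  by rewrite !mxE big_ord1 !mxE.
apply/matrixP => i j; rewrite !mxE.
apply: (congr1 (fun g => U g s)).
by apply/funext => x; exact: (partialC i j x (test_smooth tf)).
Qed.

(** Both exponents 1 + gamma and 3 gamma exceed 1, so each error takes half of e once the step is
    short. *)
Lemma germ_little f e : test_function f -> 0 < e -> exists2 delta, 0 < delta &
  forall s t, 0 <= s -> s <= t -> t <= T -> t - s < delta ->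
  `|germ f s t - ((U f t - Drift f t) - (U f s - Drift f s))| <= e * (t - s).
Proof.
move=> tf e0; have [C C0 HC] := rough_value_expansion tf.
have e2 : 0 < e / 2 by rewrite divr_gt0.
have p1 : 1 < 1 + gamma by rewrite ltrDl.
have p2 : 1 < 3 * gamma by move: gamma_gt; lra.
have [d1 d10 H1] := powR_little C0 p1 e2.
have [d2 d20 H2] := powR_little C0 p2 e2.
exists (Num.min d1 d2) => [|s t s0 st tT]; first by rewrite lt_min d10.
have ts0 : 0 <= t - s by rewrite subr_ge0.
rewrite lt_min => /andP[td1 td2]; rewrite distrC germE//.
have := HC s t s0 st tT; set S1 := \sum_i (_ * U (partial i f) s); set S2 := 2^-1 * _ => HC'.
rewrite (_ : _ - (S1 + S2) = U f t - U f s - (Drift f t - Drift f s) - S1 - S2); last by ring.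
rewrite (le_trans HC')// mulrDr.
rewrite [e * _](_ : _ = e / 2 * (t - s) + e / 2 * (t - s)); last by field.
by rewrite lerD// ?H1// H2.
Qed.

(** The germ is compared with increments of the explicit candidate [U f - Drift f], which telescope
    along the partition. As the limit is known in advance, no sewing argument is called for. *)
Lemma rough_sum_bound f e delta : (forall s t, 0 <= s -> s <= t -> t <= T -> t - s < delta ->
    `|germ f s t - ((U f t - Drift f t) - (U f s - Drift f s))| <= e * (t - s)) ->
  forall P s t, 0 <= s -> t <= T -> itv_partition s t P ->
    (forall k, (k < size P)%N -> nth 0 (s :: P) k.+1 - nth 0 (s :: P) k < delta) ->
  `|rough_sum X XX (U1 f) (U2 f) s P - ((U f t - Drift f t) - (U f s - Drift f s))| <= e * (t - s).
Proof.
move=> Hg; elim=> [|p P IH] s t s0 tT Ps mesh.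
  by rewrite (itv_partition_nil Ps) /rough_sum big_geq// !subrr normr0 mulr0.
have Pp := itv_partition_cons Ps; have pt := itv_partition_le Pp.
have sp : s < p by case: Ps => /= /andP[].
have p0 : 0 <= p by rewrite (le_trans s0)// ltW.
have I1 := Hg s p s0 (ltW sp) (le_trans pt tT) (mesh 0 isT).
have I2 := IH p t p0 tT Pp (fun k kP => mesh k.+1 kP).
rewrite rough_sum_cons.
set g := dotmul _ _ + _ in I1 *; set r := rough_sum _ _ _ _ _ _ in I2 *.
rewrite [X in `|X|](_ : _ = (g - (U f p - Drift f p - (U f s - Drift f s))) +
   (r - (U f t - Drift f t - (U f p - Drift f p)))); last by ring.
rewrite (le_trans (ler_normD _ _))// [e * _](_ : _ = e * (p - s) + e * (t - p)); last by ring.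
exact: lerD.
Qed.

Theorem rough_value_integral f t : test_function f -> 0 <= t <= T ->
  is_rough_integral X XX (U1 f) (U2 f) 0 t ((U f t - Drift f t) - (U f 0 - Drift f 0)).
Proof.
move=> tf /andP[t0 tT] e e0.
(* Dividing by T + 1 instead of T makes the final inequality strict. *)
have e' : 0 < e / (T + 1) by rewrite divr_gt0// ltr_wpDl// ltW.
have [delta d0 Hg] := germ_little tf e'.
exists delta => // P Pt mesh.
rewrite (le_lt_trans (rough_sum_bound Hg (lexx 0) tT Pt mesh))// subr0.
have T1 : 0 < T + 1 by rewrite ltr_wpDl// ltW.
by rewrite mulrAC (ltr_pdivrMr _ _ T1) (ltr_pM2l e0) (le_lt_trans tT)// ltrDl.
Qed.

End rough_transport.

(** * The symmetric part of a geometric rough path *)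

Section geometric.
Context {R : realType} {d : nat}.
Local Notation leb := (@lebesgue_measure R).
Implicit Types (s t r : R).
Variable T : R.

Section C1.
Variables (Y Y' : R -> 'rV[R]_d).
Hypothesis C1Y : C1_path T Y Y'.

Lemma C1_quotient t (k : 'I_d) e : 0 <= t <= T -> 0 < e -> exists2 delta, 0 < delta &
  forall r, `|t - r| < delta -> r != t -> 0 <= r <= T ->
    `|Y' t ord0 k - (r - t)^-1 * (Y r ord0 k - Y t ord0 k)| <= e.
Proof.
move=> tT e0; have := C1Y.2 t; rewrite in_itv/= => /(_ tT).
move=> /cvgrPdist_le/(_ _ e0)/nbhs_ballP[delta/= d0 Hd].
exists delta => // r rt nrt rT; have := Hd r rt nrt; rewrite /= in_itv/= => /(_ rT).
by move=> H1; rewrite (le_trans _ H1)// (le_trans _ (coord_le_norm _ k))// !mxE.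
Qed.

Lemma C1_is_derive s t (k : 'I_d) : 0 < t < T ->
  is_derive t (1 : R) (fun r => (Y r - Y s) ord0 k) (Y' t ord0 k).
Proof.
move=> /andP[t0 tT].
have H : h^-1 *: (((fun r => (Y r - Y s) ord0 k) \o shift t) (h *: 1) - (Y t - Y s) ord0 k)
    @[h --> 0^'] --> Y' t ord0 k.
  apply/cvgrPdist_le => e e0.
  have tI : 0 <= t <= T by rewrite !ltW.
  have [delta d0 Hd] := C1_quotient k tI e0.
  have m0 : 0 < Num.min delta (Num.min t (T - t)) by rewrite !lt_min d0 t0 subr_gt0.
  apply/nbhs_ballP; exists (Num.min delta (Num.min t (T - t))) => //= h.
  rewrite /ball/= sub0r normrN !lt_min => /and3P[hd ht hT] h0.
  have := Hd (h + t); rewrite opprD addrCA subrr addr0 normrN addrK => /(_ hd).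
  rewrite -subr_eq0 addrK => /(_ h0).
  move=> H1; rewrite /= !mxE /GRing.scale/= mulr1.
  rewrite (_ : Y (h + t) ord0 k + - Y s ord0 k - (Y t ord0 k + - Y s ord0 k) = Y (h + t) ord0 k - Y t ord0 k); last by ring.
  apply: H1; move: ht hT; rewrite !ltr_norml => /andP[? ?] /andP[? ?]; apply/andP; split; lra.
apply: DeriveDef; first by apply/cvg_ex; exists (Y' t ord0 k).
exact: cvg_lim H.
Qed.

Lemma C1_continuous s t (k : 'I_d) e : 0 <= t <= T -> 0 < e -> exists2 delta, 0 < delta &
  forall r, `|t - r| < delta -> 0 <= r <= T ->
   `|(Y t - Y s) ord0 k - (Y r - Y s) ord0 k| <= e.
Proof.
move=> tT e0; have [delta d0 Hd] := C1_quotient k tT ltr01.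
(* Near t the difference quotient is within 1 of the derivative, so |Y r - Y t| <= M |r - t| in this
   coordinate. *)
pose M := `|Y' t ord0 k| + 1; have M0 : 0 < M by rewrite ltr_wpDl.
have m0 : 0 < Num.min delta (e / M) by rewrite lt_min d0 divr_gt0.
exists (Num.min delta (e / M)) => // r; rewrite lt_min => /andP[rd re] rT.
have [->|nrt] := eqVneq r t; first by rewrite subrr normr0 ltW.
rewrite distrC !mxE (_ : _ - _ = Y r ord0 k - Y t ord0 k); last by ring.
have rt0 : r - t != 0 by rewrite subr_eq0.
have : `|(r - t)^-1 * (Y r ord0 k - Y t ord0 k)| <= M.
  have := Hd r rd nrt rT; rewrite distrC => /(le_trans (lerB_normD _ _)).
  by rewrite normrN /M; lra.
rewrite normrM normfV mulrC ler_pdivrMr ?normr_gt0// => H1.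
rewrite (le_trans H1)// distrC (le_trans (ler_wpM2l (ltW M0) (ltW re)))//.
by rewrite mulrCA divff ?mulr1// gt_eqF.
Qed.

(** The derivative is one-sided at 0 and T, so two-sided derivability is claimed inside the interval
    only; this is the form that integration by parts takes as hypothesis. *)
Lemma C1_LRcontinuous s t (k : 'I_d) : 0 <= s -> s < t -> t <= T ->
  derivable_oo_LRcontinuous (fun r => (Y r - Y s) ord0 k) s t.
Proof.
move=> s0 st tT.
have sI : 0 <= s <= T by rewrite s0 (le_trans (ltW st)).
have tI : 0 <= t <= T by rewrite tT (le_trans s0 (ltW st)).
have ts0 : 0 < t - s by rewrite subr_gt0.
split.
- move=> r; rewrite in_itv/= => /andP[sr rt].
  have rI : 0 < r < T by rewrite (le_lt_trans s0 sr) (lt_le_trans rt tT).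
  by have [] := C1_is_derive s k rI.
- apply/cvgrPdist_le => e e0; have [delta d0 Hd] := C1_continuous s k sI e0.
  apply/nbhs_ballP; exists (Num.min delta (t - s)); first by rewrite /= lt_min d0.
  move=> r; rewrite /ball/= lt_min => /andP[rd rts] sr; apply: Hd => //.
  by move: rts; rewrite ltr_norml => /andP[? ?]; apply/andP; split; lra.
- apply/cvgrPdist_le => e e0; have [delta d0 Hd] := C1_continuous s k tI e0.
  apply/nbhs_ballP; exists (Num.min delta (t - s)); first by rewrite /= lt_min d0.
  move=> r; rewrite /ball/= lt_min => /andP[rd rts] sr; apply: Hd => //.
  by move: rts; rewrite ltr_norml => /andP[? ?]; apply/andP; split; lra.
Qed.

Lemma C1_derivative_continuous s t (k : 'I_d) : 0 <= s -> t <= T ->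
  {within `[s, t], continuous (fun r => Y' r ord0 k)}.
Proof.
move=> s0 tT.
have sub : `[s, t]%classic `<=` `[0, T]%classic.
  by move=> r /=; rewrite !in_itv/= => /andP[sr rt]; rewrite (le_trans s0 sr) (le_trans rt tT).
have c1 := continuous_subspaceW sub C1Y.1.
move=> r; apply: (@continuous_comp _ _ _ (Y' : subspace `[s, t] -> _) (fun v : 'rV[R]_d => v ord0 k)).
  exact: c1.
exact: coord_continuous.
Qed.

(** Integration by parts for two coordinates of Y - Y_s, whose boundary term at s vanishes. *)
Lemma natural_lift_symmetric s t : 0 <= s -> s <= t -> t <= T ->
  natural_lift Y Y' s t + (natural_lift Y Y' s t)^T =
  tensor (increment Y s t) (increment Y s t).
Proof.
move=> s0 st tT; apply/matrixP => i j; rewrite !mxE big_ord1 !mxE /oriented_int st.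
have E k l : \int[leb]_(r in `[s, t]) tensor (increment Y s r) (Y' r) k l =
    \int[leb]_(r in `[s, t]) ((Y r - Y s) ord0 k * Y' r ord0 l).
  by apply: eq_Rintegral => r _; rewrite !mxE big_ord1 !mxE.
rewrite !E; move: st; rewrite le_eqVlt => /orP[/eqP <-|st].
  by rewrite set_itv1 !Rintegral_set1 subrr mul0r addr0.
have F k := C1_LRcontinuous k s0 st tT.
have f k : {within `[s, t], continuous (fun r => Y' r ord0 k)} := C1_derivative_continuous (k := k) s0 tT.
have dF k : {in `]s, t[, derive1 (fun r => (Y r - Y s) ord0 k) =1 (fun r => Y' r ord0 k)}.
  move=> r; rewrite in_itv/= => /andP[sr rt].
  have rI : 0 < r < T by rewrite (le_lt_trans s0 sr) (lt_le_trans rt tT).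
  by rewrite derive1E; have := C1_is_derive s k rI => H1; rewrite derive_val.
have int k l : leb.-integrable `[s, t] (EFin \o (fun r => (Y r - Y s) ord0 k * Y' r ord0 l)).
  apply: continuous_compact_integrable; first exact: segment_compact.
  move=> r; apply: cvgM; first exact: (derivable_oo_LRcontinuous_within (F k)).
  exact: f.
have parts := integration_by_parts st (f i) (F i) (dF i) (f j) (F j) (dF j).
have mI : measurable (`[s, t]%classic : set (measurableTypeR R)) by exact: measurable_itv.
have fin1 := integrable_fin_num mI (int i j).
have fin2 := integrable_fin_num mI (int j i).
rewrite /Rintegral -fineD//.
rewrite [X in fine (X + _)%E]parts.
rewrite [X in (_ - X + _)%E](_ : _ = \int[leb]_(r in `[s, t]) (((Y r - Y s) ord0 j * Y' r ord0 i)%:E))%E; last first.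
  by apply: eq_integral => r _; rewrite mulrC.
by rewrite subeK//= !mxE !subrr mul0r subr0.
Qed.

End C1.

Lemma hoelder_norm2_ge (V : normedModType R) (nu q : R) (F : R -> R -> V) s t :
  (hoelder_norm2 T nu F <= q%:E)%E -> 0 <= s <= T -> 0 <= t <= T -> s != t ->
  `|F s t| <= q * `|t - s| `^ nu.
Proof.
move=> Fq sT tT st.
have p0 : 0 < `|t - s| `^ nu by rewrite powR_gt0// normr_gt0 subr_eq0 eq_sym.
rewrite -ler_pdivrMr// -lee_fin; apply: le_trans Fq.
by apply: ereal_sup_ubound; exists s, t; rewrite !in_itv.
Qed.

Lemma hoelder_norm2_ge0 (V : normedModType R) (nu : R) (F : R -> R -> V) :
  0 < T -> (0 <= hoelder_norm2 T nu F)%E.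
Proof.
move=> T0; apply: (@le_trans _ _ (`|F 0 T| / `|T - 0| `^ nu)%:E).
  by rewrite lee_fin divr_ge0// powR_ge0.
apply: ereal_sup_ubound; exists 0, T.
by rewrite !in_itv/= !lexx !ltW// lt_eqF.
Qed.

(** The identity holds for natural lifts and both sides are continuous for the rough distance; a
    single lift close enough bounds the defect by e. *)
Lemma geometric_symmetric gamma (X : R -> 'rV[R]_d) (XX : R -> R -> 'M[R]_d) s t :
  0 < T -> geometric_rough_path T gamma X XX -> 0 <= s -> s <= t -> t <= T ->
  XX s t + (XX s t)^T = tensor (increment X s t) (increment X s t).
Proof.
move=> T0 [[X0 X_h [_ XX0 _] _] [Y [Y' [C1Y cv]]]] s0 st tT.
have sI : 0 <= s <= T by rewrite s0 (le_trans st).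
have tI : 0 <= t <= T by rewrite tT (le_trans s0).
(* The Hoelder norms control only s != t, so the diagonal is settled by the condition that XX
   vanishes there. *)
move: st; rewrite le_eqVlt => /orP[/eqP <-|st].
  rewrite XX0 ?in_itv//= trmx0 addr0; apply/matrixP => i j.
  by rewrite !mxE big_ord1 !mxE subrr mul0r.
apply/matrixP => i j; apply/eqP; rewrite -subr_eq0 -normr_le0; apply/ler_addgt0Pl => e e0.
rewrite addr0.
set h := increment X s t; set P1 := `|t - s| `^ gamma; set P2 := `|t - s| `^ (2 * gamma).
have P10 : 0 <= P1 by exact: powR_ge0.
have P20 : 0 <= P2 by exact: powR_ge0.
(* When the rough distance is below q, the defect is at most q (2 P2 + P1 (2 |h| + q P1)); q <= 1
   bounds this by q M, and q <= e / M bounds that by e. *)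
pose M := 2 * P2 + P1 * (2 * `|h| + P1) + 1.
have M1 : 1 <= M by rewrite lerDr addr_ge0 ?mulr_ge0// addr_ge0// mulr_ge0.
have M0 : 0 < M by rewrite (lt_le_trans _ M1).
pose q := Num.min 1 (e / M).
have q0 : 0 < q by rewrite lt_min ltr01 divr_gt0.
have q1 : q <= 1 by rewrite ge_min lexx.
have [n Hn] : exists n, (rough_dist T gamma X XX (Y n) (natural_lift (Y n) (Y' n)) < q%:E)%E.
  have nb : nbhs (0%E : \bar R) [set x | (x < q%:E)%E].
    by apply: open_nbhs_nbhs; split; [exact: open_ereal_lt_ereal|rewrite /= lte_fin].
  have [N _ HN] := cv _ nb.
  by exists N; apply: HN => /=.
have sym := natural_lift_symmetric (C1Y n).2 s0 (ltW st) tT.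
have nge1 := hoelder_norm2_ge0 gamma (increment (fun t => X t - Y n t)) T0.
have nge2 := hoelder_norm2_ge0 (2 * gamma) (fun s t => XX s t - natural_lift (Y n) (Y' n) s t) T0.
have nst : s != t by rewrite lt_eqF.
have B1 : `|increment (fun t => X t - Y n t) s t| <= q * P1.
  apply: hoelder_norm2_ge => //; apply: le_trans (ltW Hn).
  by rewrite /rough_dist (le_trans _ (leeDl _ nge2))// /hoelder_norm leeDr.
have B2 : `|XX s t - natural_lift (Y n) (Y' n) s t| <= q * P2.
  apply: (hoelder_norm2_ge (F := fun s t => XX s t - natural_lift (Y n) (Y' n) s t)) => //.
  apply: le_trans (ltW Hn).
  by rewrite /rough_dist leeDr// /hoelder_norm adde_ge0.
have entry k l : `|XX s t k l - natural_lift (Y n) (Y' n) s t k l| <= q * P2.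
  rewrite (le_trans _ B2)// [leRHS]/Num.Def.normr /= mx_normrE.
  by apply: le_trans (le_bigmax _ _ (k, l)); rewrite /= !mxE.
set L := natural_lift _ _ _ _ in sym entry.
set k := increment (Y n) s t in sym.
have hk l : `|h ord0 l - k ord0 l| <= q * P1.
  rewrite (le_trans _ B1)// (le_trans _ (coord_le_norm _ l))// !mxE.
  by rewrite le_eqVlt; apply/orP; left; apply/eqP; congr `|_|; ring.
have symij : L i j + L j i = k ord0 i * k ord0 j.
  by have := congr1 (fun A : 'M[R]_d => A i j) sym; rewrite !mxE big_ord1 !mxE.
rewrite !mxE big_ord1 !mxE.
(* Subtracting the identity of the lift leaves only the differences XX - L and h - k. *)
rewrite (_ : XX s t i j + XX s t j i - _ =
  (XX s t i j - L i j) + (XX s t j i - L j i) - ((h ord0 i - k ord0 i) * h ord0 j +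
   (h ord0 j - k ord0 j) * (h ord0 i - (h ord0 i - k ord0 i)))); last first.
  have -> : XX s t i j - L i j + (XX s t j i - L j i) = XX s t i j + XX s t j i - (L i j + L j i) by ring.
  by rewrite symij /h !mxE; ring.
have hl l : `|h ord0 l| <= `|h| by exact: coord_le_norm.
rewrite (@le_trans _ _ (q * P2 + q * P2 + (q * P1 * `|h| + q * P1 * (`|h| + q * P1))))//.
  rewrite (le_trans (ler_normB _ _))// lerD//.
    by rewrite (le_trans (ler_normD _ _))// lerD.
  rewrite (le_trans (ler_normD _ _))// !normrM lerD// ler_pM//.
  by rewrite (le_trans (ler_normB _ _))// lerD.
rewrite (@le_trans _ _ (q * M))//.
  rewrite (_ : _ + _ = q * (2 * P2 + P1 * (2 * `|h| + q * P1))); last by ring.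
  rewrite ler_wpM2l ?(ltW q0)// /M -addrA lerD2l.
  rewrite (@le_trans _ _ (P1 * (2 * `|h| + P1)))// ?lerDl//.
  by rewrite ler_wpM2l// lerD2l ler_piMl.
by rewrite -ler_pdivlMr// /q ge_min lexx orbT.
Qed.

End geometric.

(** * The solution *)

Section time_primitive.
Context {R : realType}.
Local Notation leb := (@lebesgue_measure R).
Variables (T S : R) (h : R -> R).
Hypotheses (T0 : 0 <= T) (inth : rintegrable leb h)
  (h_out : forall r, ~~ (0 <= r <= T) -> h r = 0) (h_le : forall r, `|h r| <= S).
Implicit Types s t : R.

(** The projection onto [0, T]. Composing with it extends paths and primitives by constants, so that
    bounds on [0, T] hold at all real times. *)
Definition clamp t := Num.max 0 (Num.min t T).

Lemma clamp_itv t : 0 <= clamp t <= T.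
Proof. by rewrite /clamp le_max lexx ge_max T0 ge_min lexx orbT. Qed.

Lemma clamp_id t : 0 <= t <= T -> clamp t = t.
Proof. by case/andP=> t0 tT; rewrite /clamp min_l// max_r. Qed.

Lemma clamp_lipschitz s t : `|clamp t - clamp s| <= `|t - s|.
Proof.
wlog st : s t / s <= t => [th|].
  by have [ts|/ltW] := leP s t; [exact: th|rewrite distrC [`|t - s|]distrC; exact: th].
have := T0; rewrite [`|t - s|]ger0_norm ?subr_ge0// ler_norml /clamp /Num.max /Num.min => T0'.
by case: (ltP t T) => tT; case: (ltP s T) => sT; case: ltP => ?; case: ltP => ?;
  apply/andP; split; lra.
Qed.

Lemma primitive_clamp t :
  \int[leb]_(r in `[0, t]) h r = \int[leb]_(r in `[0, clamp t]) h r.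
Proof.
have [t0|t0] := leP 0 t; last first.
  rewrite /clamp (min_l (le_trans (ltW t0) T0)) max_l ?(ltW t0)//.
  rewrite set_itv1 Rintegral_set1 (_ : `[0, t]%classic = set0) ?Rintegral_set0//.
  by apply/seteqP; split => r //=; rewrite in_itv/= => /andP[r0 rt]; have := le_lt_trans (le_trans r0 rt) t0; rewrite ltxx.
have [tT|Tt] := leP t T; first by rewrite clamp_id// t0.
rewrite /clamp (min_r (ltW Tt)) max_r// [LHS]Rintegral_mkcond [RHS]Rintegral_mkcond.
apply: eq_Rintegral => r _; rewrite !patchE !mem_setE !in_itv/=.
have [rT|Tr] := leP r T; first by rewrite (le_trans rT (ltW Tt)).
rewrite andbF h_out; first by case: ifP.
by rewrite negb_and [r <= T]leNgt Tr orbT.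
Qed.

(** Both times are first clamped, which leaves the primitives unchanged because h vanishes outside
    [0, T]. *)
Lemma primitive_lipschitz s t :
  `|\int[leb]_(r in `[0, t]) h r - \int[leb]_(r in `[0, s]) h r| <= S * `|t - s|.
Proof.
have S0 : 0 <= S by rewrite (le_trans _ (h_le 0)).
rewrite [X in `|X - _|]primitive_clamp [X in `|_ - X|]primitive_clamp.
apply: (@le_trans _ _ (S * `|clamp t - clamp s|)); last first.
  by rewrite ler_wpM2l// clamp_lipschitz.
have ct := clamp_itv t; have cs := clamp_itv s.
move: (clamp t) (clamp s) ct cs => a b /andP[a0 aT] /andP[b0 bT].
wlog ba : a b a0 aT b0 bT / b <= a => [th|].
  have [ba|ab] := leP b a; first exact: th.
  by rewrite distrC [`|a - b|]distrC th// ltW.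
rewrite (integral_itv_split inth b0 ba) addrC addKr [`|a - b|]ger0_norm ?subr_ge0//.
exact: integral_itv_bound.
Qed.

Lemma primitive_le t : `|\int[leb]_(r in `[0, t]) h r| <= S * T.
Proof.
have S0 : 0 <= S by rewrite (le_trans _ (h_le 0)).
rewrite primitive_clamp; case/andP: (clamp_itv t) => c0 cT.
rewrite (le_trans (integral_itv_bound inth c0 (fun r _ => h_le r)))// subr0.
by rewrite ler_wpM2l.
Qed.

End time_primitive.

(** * The moving-frame functional and the drift *)

Section rough_flow.
Context {R : realType} {d : nat}.
Local Notation leb := (@lebesgue_measure R).
Local Notation lam := (@lebesgue_rV R d).
Variables (T B Xm H gamma M : R) (X : R -> 'rV[R]_d).
Variables (b : R -> 'rV[R]_d -> 'rV[R]_d) (c : R -> 'rV[R]_d -> R).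
Variables (u0 : 'rV[R]_d -> R) (u : R -> 'rV[R]_d -> R).
Hypotheses (T0 : 0 < T) (B0 : 0 <= B) (gamma0 : 0 < gamma) (cX : continuous X)
  (X_le : forall t, `|X t| <= Xm)
  (X_hoelder : forall s t, 0 <= s <= T -> 0 <= t <= T ->
    `|X t - X s| <= H * `|t - s| `^ gamma)
  (mb : forall i, measurable_fun setT
    (fun p : measurableTypeR R * 'rV[R]_d => b p.1 p.2 ord0 i))
  (mc : measurable_fun setT (fun p : measurableTypeR R * 'rV[R]_d => c p.1 p.2))
  (b_le : forall t x, `|b t x| <= B * (1 + `|x|))
  (c_le : forall t x, `|c t x| <= B)
  (b_out : forall t x, ~~ (0 <= t <= T) -> b t x = 0)
  (c_out : forall t x, ~~ (0 <= t <= T) -> c t x = 0)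
  (mu0 : measurable_fun setT u0) (u0_le : forall x, `|u0 x| <= M)
  (mu_ : measurable_fun setT (fun p : measurableTypeR R * 'rV[R]_d => u p.1 p.2))
  (u_le : forall t x, `|u t x| <= M)
  (frame : forall phi, test_function phi ->
    {ae leb, forall t, 0 <= t <= T -> moved X u phi t =
      \int[lam]_x (u0 x * phi x) + \int[leb]_(r in `[0, t]) source X b c u phi r}).
Implicit Types (phi f : 'rV[R]_d -> R) (s t r : R).

(* By [frame], the version of u_t(f(. - X_t)) that is Lipschitz in t. *)
Definition frozen t f :=
  \int[lam]_x (u0 x * f x) + \int[leb]_(r in `[0, t]) source X b c u f r.

Definition drift f t :=
  \int[leb]_(r in `[0, t]) \int[lam]_x (u r x * adv b c r f x).

Let Xm0 : 0 <= Xm. Proof. exact: le_trans (X_le 0). Qed.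
Let T_ge0 : 0 <= T. Proof. exact: ltW. Qed.
Let M0 : 0 <= M. Proof. exact: le_trans (u0_le 0). Qed.
Let c0 : continuous (fun _ : R => 0 : 'rV[R]_d). Proof. by move=> t; exact: cvg_cst. Qed.
Let n0 t : `|(fun _ : R => 0 : 'rV[R]_d) t| <= 0. Proof. by rewrite normr0. Qed.

Let u0_integrable f : test_function f -> rintegrable lam (fun x => u0 x * f x).
Proof. by move=> tf; exact: (rintegrable_bddM mu0 u0_le (test_integrable tf)). Qed.

Let src_integrable f := @source_integrable R d T B Xm X b c B0 cX X_le mb mc b_le c_le b_out c_out M u mu_ u_le f.

(** The integrand of the drift is the source for the zero path, so its integrability is an instance
    of [source_integrable]. *)
Lemma source_static r f :
  source (fun=> 0) b c u f r = \int[lam]_x (u r x * adv b c r f x).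
Proof.
apply: eq_Rintegral => x _; congr (_ * adv _ _ _ _ _).
by apply/funext => y; rewrite /shiftf subr0.
Qed.

Let static_integrable f : test_function f ->
  rintegrable leb (fun r => \int[lam]_x (u r x * adv b c r f x)).
Proof.
move=> tf; have := source_integrable B0 c0 n0 mb mc b_le c_le b_out c_out mu_ u_le tf.
have -> // : source (fun=> 0) b c u f = (fun r => \int[lam]_x (u r x * adv b c r f x)).
by apply/funext => r; exact: source_static.
Qed.

Lemma source_linear (a : R) r f phi : test_function f -> test_function phi ->
  source X b c u (fun x => a * f x + phi x) r =
  a * source X b c u f r + source X b c u phi r.
Proof.
move=> tf tphi.
have int g : test_function g -> rintegrable lam (fun x => u r x * adv b c r (shiftf (- X r) g) x).
  move=> tg; have [K K0 Kg] := test_vanish tg; have [A A0 [gA dgA]] := test_C1_bound tg.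
  exact: (boxed_section_integrable (measurable_cube _) (lebesgue_cube_lty _) r
    (boxed_source B0 cX X_le mb mc b_le c_le b_out c_out mu_ u_le tg (ltW K0) A0 Kg gA dgA)).
rewrite /source -rintegralZD; [|exact: int..].
apply: eq_Rintegral => x _.
have -> : adv b c r (shiftf (- X r) (fun x => a * f x + phi x)) x =
    a * adv b c r (shiftf (- X r) f) x + adv b c r (shiftf (- X r) phi) x.
  exact: (adv_linear b c r a x (test_smooth (test_shiftf (- X r) tf)) (test_smooth (test_shiftf (- X r) tphi))).
by ring.
Qed.

Lemma frozen_linear t (a : R) f phi : test_function f -> test_function phi ->
  frozen t (fun x => a * f x + phi x) = a * frozen t f + frozen t phi.
Proof.
move=> tf tphi; rewrite /frozen.
have -> : \int[lam]_x (u0 x * (a * f x + phi x)) =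
    a * \int[lam]_x (u0 x * f x) + \int[lam]_x (u0 x * phi x).
  rewrite -rintegralZD; [|exact: u0_integrable..].
  by apply: eq_Rintegral => x _; ring.
have -> : \int[leb]_(r in `[0, t]) source X b c u (fun x => a * f x + phi x) r =
    a * \int[leb]_(r in `[0, t]) source X b c u f r + \int[leb]_(r in `[0, t]) source X b c u phi r.
  rewrite -integral_itv_linear; [|exact: src_integrable..].
  by apply: eq_Rintegral => r _; exact: source_linear.
by ring.
Qed.

Lemma frozen_le K : 0 <= K -> exists2 C, 0 <= C &
  forall t f A, test_function f -> vanish_out K f -> 0 <= A ->
    (forall x, `|f x| <= A) -> (forall i x, `|partial i f x| <= A) ->
    `|frozen t f| <= C * A /\ forall s, `|frozen t f - frozen s f| <= C * A * `|t - s|.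
Proof.
(* S bounds the source per unit of the C^1 norm, the cube of radius K + Xm containing all shifted
   supports. In the witness below, M vol K and S T bound the initial datum and the source, and the
   last S is the Lipschitz constant in time. *)
move=> K0; pose S := M * adv_const (d := d) B (K + Xm) * vol (d := d) (K + Xm).
have S0 : 0 <= S by rewrite !mulr_ge0 ?vol_ge0// adv_const_ge0// addr_ge0.
have MV : 0 <= M * vol (d := d) K by rewrite mulr_ge0 ?vol_ge0.
have ST : 0 <= S * T by rewrite mulr_ge0.
exists (M * vol (d := d) K + S * T + S) => [|t f A tf Kf A0 fA dfA].
  by rewrite addr_ge0// addr_ge0.
have srcS r : `|source X b c u f r| <= S * A.
  rewrite (le_trans (source_le B0 cX X_le mb mc b_le c_le b_out c_out mu_ u_le r tf K0 A0 Kf fA dfA))//.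
  by rewrite le_eqVlt; apply/orP; left; apply/eqP; rewrite /S; ring.
have out r : ~~ (0 <= r <= T) -> source X b c u f r = 0 by exact: source_out.
split=> [|s].
  rewrite !mulrDl -[leRHS]addrA (le_trans (ler_normD _ _))// lerD//.
    have := @bounded_support_le R d (fun x => u0 x * f x) (M * A) K.
    rewrite mulrAC; apply.
    - by apply: measurable_funM => //; exact: test_measurable.
    - by move=> x; rewrite normrM ler_pM.
    - by move=> x Kx; rewrite Kf// mulr0.
  rewrite (le_trans (primitive_le (ltW T0) (src_integrable tf) out srcS t))//.
  by rewrite mulrAC lerDl mulr_ge0.
rewrite /frozen opprD addrACA subrr add0r.
rewrite (le_trans (primitive_lipschitz (ltW T0) (src_integrable tf) out srcS s t))//.
by rewrite ler_wpM2r// ler_wpM2r// lerDr addr_ge0.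
Qed.

(** By linearity the integrand at time r is the source of f(. + X_t) - f(. + X_r), whose C^1 norm is
    of order |X_t - X_r|. The radius K + 2 Xm accounts for these shifts and for the one inside
    [source]. *)
Lemma frozen_drift f : test_function f -> exists2 C, 0 <= C &
  forall s t, 0 <= s -> s <= t -> t <= T ->
    `|frozen t (shiftf (X t) f) - frozen s (shiftf (X t) f) - (drift f t - drift f s)| <=
    C * (t - s) `^ (1 + gamma).
Proof.
move=> tf; have [K K0 Kf] := test_vanish tf; have [A A0 HA] := shift_difference tf.
pose S := M * adv_const (d := d) B (K + Xm + Xm) * vol (d := d) (K + Xm + Xm).
have KX0 : 0 <= K + Xm by rewrite addr_ge0// ltW.
have S0 : 0 <= S by rewrite !mulr_ge0 ?vol_ge0// adv_const_ge0// addr_ge0.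
exists (S * A * `|H|) => [|s t s0 st tT]; first by rewrite mulr_ge0// mulr_ge0.
have tst r := test_shiftf (X r) tf.
rewrite /frozen opprD addrACA subrr add0r /drift.
have prim h : rintegrable leb h ->
    \int[leb]_(r in `[0, t]) h r - \int[leb]_(r in `[0, s]) h r = \int[leb]_(r in `[s, t]) h r.
  by move=> inth; rewrite (integral_itv_split inth s0 st) addrC addKr.
rewrite (prim _ (src_integrable (tst t))) (prim _ (static_integrable tf)).
have -> : \int[leb]_(r in `[s, t]) source X b c u (shiftf (X t) f) r -
    \int[leb]_(r in `[s, t]) \int[lam]_x (u r x * adv b c r f x) =
    \int[leb]_(r in `[s, t]) (-1 * \int[lam]_x (u r x * adv b c r f x) + source X b c u (shiftf (X t) f) r).
  rewrite integral_itv_linear; [by ring|exact: static_integrable|exact/src_integrable].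
have dif r : -1 * \int[lam]_x (u r x * adv b c r f x) + source X b c u (shiftf (X t) f) r =
    source X b c u (fun x => -1 * shiftf (X r) f x + shiftf (X t) f x) r.
  rewrite source_linear//; congr (_ * _ + _); apply: eq_Rintegral => x _.
  congr (_ * adv _ _ _ _ _); apply/funext => y.
  by rewrite /shiftf subrK.
rewrite (le_trans (integral_itv_bound (M := S * A * (`|H| * (t - s) `^ gamma)) _ st _))//.
- exact: (rintegrableD (rintegrableZ (-1) (static_integrable tf)) (src_integrable (tst t))).
- move=> r /andP[sr rt]; rewrite dif.
  have r0 := le_trans s0 sr; have rI : 0 <= r <= T by rewrite r0 (le_trans rt).
  have tI : 0 <= t <= T by rewrite tT (le_trans s0 st).
  have D0 : 0 <= A * `|X t - X r| by rewrite mulr_ge0.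
  have van a : vanish_out (K + Xm) (shiftf (X a) f).
    by apply: (vanish_out_le _ (vanish_shiftf (a := X a) Kf)); rewrite lerD2l.
  have := @source_le R d T B Xm X b c B0 cX X_le mb mc b_le c_le b_out c_out M u mu_ u_le
    (fun x => -1 * shiftf (X r) f x + shiftf (X t) f x) (K + Xm) (A * `|X t - X r|) r
    (testD (testZ _ (tst r)) (tst t)) KX0 D0 _ (HA _ _).1 (HA _ _).2.
  move=> H1; rewrite (le_trans (H1 _))//.
    by move=> x Kx; rewrite !van// mulr0 addr0.
  rewrite (_ : _ * vol _ = S * A * `|X t - X r|); last by rewrite /S; ring.
  apply: ler_wpM2l; first exact: mulr_ge0.
  rewrite (le_trans (X_hoelder rI tI))//.
  apply: (@le_trans _ _ (`|H| * `|t - r| `^ gamma)).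
    by rewrite ler_wpM2r ?powR_ge0// ler_norm.
  rewrite ler_wpM2l// ge0_ler_powR ?(ltW gamma0)// ?nnegrE ?subr_ge0// ger0_norm ?subr_ge0//.
  by rewrite lerD2l lerN2.
- rewrite powRD; last by rewrite gt_eqF// addr_gt0.
  rewrite powRr1 ?subr_ge0// le_eqVlt; apply/orP; left; apply/eqP; ring.
Qed.


Lemma rat_rV_dense n (v : 'rV[R]_n) (e : R) : 0 < e ->
  exists q : 'rV[rat]_n, `|map_mx ratr q - v| <= e.
Proof.
move=> e0; have /choice[q Hq] : forall i, exists q : rat, `|ratr q - v ord0 i| <= e.
  move=> i; have [q] := @rat_in_itvoo R (v ord0 i) (v ord0 i + e) (ltr_pwDr e0 (lexx _)).
  rewrite in_itv/= => /andP[q1 q2]; exists q.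
  by rewrite ger0_norm ?subr_ge0 ?(ltW q1)// lerBlDl (ltW q2).
exists (\row_i q i); apply: rV_norm_le; first exact: ltW.
by move=> i; rewrite !mxE.
Qed.

(** The null set in [frame] depends on the test function, whereas f(. + X_t) varies with t. Off one
    null set the identity holds for all shifts by rational vectors, and both sides are continuous in
    the shift. *)
Lemma frozen_pairing f : test_function f ->
  {ae leb, forall t, 0 <= t <= T -> frozen t (shiftf (X t) f) = pairing (u t) f}.
Proof.
move=> tf; have [K K0 Kf] := test_vanish tf; have [A A0 HA] := shift_difference tf.
have mf := test_measurable tf.
(* Room for rational vectors at distance at most 1 from X t. *)
have X_le' t : `|X t| <= Xm + 1 by rewrite (le_trans (X_le t))// lerDl.
have [C C0 HC] := Lam_shift_lipschitz X_le' frozen_linear frozen_le tf.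
(* Rational vectors are enumerated by their codes; a number that codes none carries no condition. *)
pose P (n : nat) (t : R) := match (unpickle n : option 'rV[rat]_d) with
  | Some q => 0 <= t <= T -> moved X u (shiftf (map_mx ratr q) f) t = frozen t (shiftf (map_mx ratr q) f)
  | None => True end.
have : {ae leb, forall t, forall n, P n t}.
  apply: ae_foralln => n; rewrite /P; case: (unpickle n) => [q|]; last first.
    exact: aeW.
  exact: (frame (test_shiftf (map_mx ratr q) tf)).
have fae : Filter (almost_everywhere leb) by exact: ae_filter_ringOfSetsType.
apply: filterS => t Pt tT.
have Pq q : moved X u (shiftf (map_mx ratr q) f) t = frozen t (shiftf (map_mx ratr q) f).
  by have := Pt (pickle q); rewrite /P pickleK; apply.
pose D := C + M * A * vol (d := d) (K + 1) + 1.
have D1 : 1 <= D by rewrite lerDr addr_ge0// mulr_ge0 ?vol_ge0// mulr_ge0.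
have D0 : 0 < D by rewrite (lt_le_trans _ D1).
apply/eqP; rewrite -subr_eq0 -normr_le0; apply/ler_addgt0Pl => e e0; rewrite addr0.
have de : 0 < Num.min 1 (e / D) by rewrite lt_min ltr01 divr_gt0.
have [q] := rat_rV_dense (X t) de; rewrite le_min => /andP[q1 qe].
set v := map_mx ratr q in q1 qe.
have vX : `|v| <= Xm + 1.
  by rewrite -(subrK (X t) v) (le_trans (ler_normD _ _))// addrC lerD.
have E1 : `|frozen t (shiftf (X t) f) - frozen t (shiftf v f)| <= C * `|v - X t|.
  by rewrite distrC; apply: HC.
have E2 : `|frozen t (shiftf v f) - pairing (u t) f| <= M * (A * `|v - X t|) * vol (d := d) (K + 1).
  rewrite -Pq /moved /pairing.
  have mut : measurable_fun setT (u t) by exact: (measurableT_comp mu_ (measurable_pair1 t)).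
  have intg g : test_function g -> rintegrable lam (fun x => u t x * g x).
    by move=> tg; exact: (rintegrable_bddM mut (u_le t) (test_integrable tg)).
  have tg := test_shiftf (v - X t) tf.
  rewrite (_ : _ - _ = \int[lam]_x (u t x * (-1 * shiftf 0 f x + shiftf (v - X t) f x))); last first.
    transitivity (\int[lam]_x (-1 * (u t x * f x) + u t x * shiftf (v - X t) f x)).
      rewrite rintegralZD; [|exact: intg..].
      rewrite [RHS]addrC mulN1r; congr (_ - _); apply: eq_Rintegral => x _.
      by rewrite /shiftf addrAC addrA.
    by apply: eq_Rintegral => x _; rewrite [shiftf 0 f x]/shiftf addr0; ring.
  have := HA 0 (v - X t); rewrite subr0 => -[HA1 _].
  apply: bounded_support_le.
  - apply: measurable_funM => //; apply: measurable_funD.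
      by apply: measurable_funM => //; exact: (test_measurable (test_shiftf 0 tf)).
    exact: (test_measurable tg).
  - by move=> x; rewrite normrM ler_pM.
  - move=> x Kx; rewrite [shiftf 0 f x]/shiftf addr0 Kf; last by rewrite (le_lt_trans _ Kx)// lerDl.
    rewrite (vanish_out_le _ (vanish_shiftf (a := v - X t) Kf) Kx) ?lerD2l//.
    by rewrite mulr0 addr0 mulr0.
rewrite -(subrK (frozen t (shiftf v f)) (frozen t (shiftf (X t) f))) -addrA.
rewrite (le_trans (ler_normD _ _))// (le_trans (lerD E1 E2))//.
rewrite (_ : _ + _ = (C + M * A * vol (d := d) (K + 1)) * `|v - X t|); last by ring.
rewrite (@le_trans _ _ (D * (e / D)))//.
  rewrite ler_pM// ?lerDl// addr_ge0// mulr_ge0 ?vol_ge0//; exact: mulr_ge0.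
by rewrite mulrCA divff ?mulr1// gt_eqF.
Qed.

End rough_flow.

(** * Essential bounds *)

Section essential_bounds.
Context d (S : measurableType d) (R : realType) (mu : {measure set S -> \bar R}).

(** The norm is defined by cases on the total mass; when that is 0, everything holds almost
    everywhere. *)
Lemma Lnorm_oo_ae (f : S -> \bar R) (B : R) :
  ('N[mu]_(+oo)[f] <= B%:E)%E -> {ae mu, forall x, (`|f x| <= B%:E)%E}.
Proof.
rewrite unlock; case: ifPn => [_ /ess_supP//|muT _].
have muT0 : mu setT = 0%E by apply/eqP; rewrite eq_le measure_ge0 andbT leNgt.
by exists setT; split.
Qed.

Lemma Lnorm_oo_le (f : S -> R) (B : R) : 0 <= B ->
  (forall x, `|f x| <= B) -> ('N[mu]_(+oo)[EFin \o f] <= B%:E)%E.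
Proof.
move=> B0 fB; rewrite unlock; case: ifPn => // _.
by apply/ess_supP; apply: aeW => x /=; rewrite lee_fin.
Qed.

Lemma lty_real_bound (x : \bar R) : (x < +oo)%E -> exists2 B : R, 0 <= B & (x <= B%:E)%E.
Proof.
case: x => [r| |] // _; first by exists `|r|; rewrite ?lee_fin ?ler_norm.
by exists 0; rewrite ?leNye.
Qed.

End essential_bounds.

Lemma ess_bounded_in_time_ae (R : realType) (T : R) (N : R -> \bar R) :
  ess_bounded_in_time T N -> exists2 B : R, 0 <= B &
  {ae lebesgue_measure, forall t, 0 <= t <= T -> (N t <= B%:E)%E}.
Proof.
move=> /lty_real_bound[B B0 /ess_supP NB]; exists B => //.
have fae : Filter (almost_everywhere (@lebesgue_measure R)) by exact: ae_filter_ringOfSetsType.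
apply: filterS NB => t; rewrite patchE => + tT.
by rewrite mem_set//= in_itv.
Qed.

Section section_integral.
Context d1 d2 (S1 : measurableType d1) (S2 : measurableType d2) (R : realType)
  (m2 : {sigma_finite_measure set S2 -> \bar R}).

(** Tonelli's theorem treats the positive and negative parts, and [fine] keeps measurability where
    the integral is infinite. This covers the pairings with the field before truncation. *)
Lemma measurable_section_Rintegral (F : S1 * S2 -> R) : measurable_fun setT F ->
  measurable_fun setT (fun x => \int[m2]_y F (x, y)).
Proof.
move=> mF; have mFE : measurable_fun setT (EFin \o F) by exact/measurable_EFinP.
rewrite /Rintegral; apply: (measurableT_comp (fine_measurable measurableT)).
under eq_fun do rewrite integralE.
apply: emeasurable_funB.
  have := measurable_fun_fubini_tonelli_F (m2 := m2) _ (measurable_funepos mFE) (fun p => funepos_ge0 _ p).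
  congr measurable_fun; apply/funext => x; apply: eq_integral => y _ /=.
  by rewrite !funeposE.
have := measurable_fun_fubini_tonelli_F (m2 := m2) _ (measurable_funeneg mFE) (fun p => funeneg_ge0 _ p).
congr measurable_fun; apply/funext => x; apply: eq_integral => y _ /=.
by rewrite !funenegE.
Qed.

End section_integral.

(** * Truncation of the field and of its divergence *)

Section truncation.
Context {R : realType} {d : nat}.
Variables (T B : R) (b : R -> 'rV[R]_d -> 'rV[R]_d) (c : R -> 'rV[R]_d -> R).
Hypotheses (B0 : 0 <= B)
  (mb : measurable_fun (`[0, T] `*` [set: 'rV[R]_d]) (fun p => b p.1 p.2))
  (mc : measurable_fun (`[0, T] `*` [set: 'rV[R]_d]) (fun p => c p.1 p.2)).

Definition in_time (V : nmodType) (v : R -> 'rV[R]_d -> V) t x :=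
  if 0 <= t <= T then v t x else 0.

(** The data satisfy their bounds almost everywhere, while the transport equation was solved for
    data bounded everywhere and vanishing outside [0, T]. For almost every t in [0, T] the
    truncation alters them on a null set of x only. *)
Definition truncate_field t x :=
  if `|in_time b t x| <= B * (1 + `|x|) then in_time b t x else 0.

Definition truncate_scalar t x :=
  if `|in_time c t x| <= B then in_time c t x else 0.

Let mD : measurable (`[0, T] `*` [set: 'rV[R]_d] : set (measurableTypeR R * 'rV[R]_d)).
Proof. by apply: measurableX => //; exact: measurable_itv. Qed.

Lemma measurable_in_time (f : R -> 'rV[R]_d -> R) :
  measurable_fun (`[0, T] `*` [set: 'rV[R]_d]) (fun p => f p.1 p.2) ->
  measurable_fun setT (fun p : measurableTypeR R * 'rV[R]_d => in_time f p.1 p.2).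
Proof.
move=> /(measurable_restrictT _ mD).1; congr measurable_fun.
apply/funext => -[t x]; rewrite patchE /in_time/=; have [tT|tT] := boolP (0 <= t <= T).
  by rewrite mem_set//= in_itv.
have nin : ~ (`[0, T] `*` [set: 'rV[R]_d]) (t, x).
  by move=> [/= + _]; rewrite in_itv/=; exact/negP.
by rewrite (memNset nin).
Qed.

Lemma measurable_truncate_scalar : measurable_fun setT
  (fun p : measurableTypeR R * 'rV[R]_d => truncate_scalar p.1 p.2).
Proof.
have m1 := measurable_in_time mc.
apply: measurable_fun_ifT => //.
by apply: measurable_fun_ler => //; exact: measurableT_comp.
Qed.

Lemma measurable_in_time_field i : measurable_fun setT
  (fun p : measurableTypeR R * 'rV[R]_d => in_time b p.1 p.2 ord0 i).
Proof.
have := @measurable_in_time (fun t x => b t x ord0 i) _.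
have -> : (fun p : measurableTypeR R * 'rV[R]_d => in_time b p.1 p.2 ord0 i) =
  (fun p => in_time (fun t x => b t x ord0 i) p.1 p.2).
  by apply/funext => p; rewrite /in_time; case: ifP => // _; rewrite mxE.
by apply; exact: (measurableT_comp (measurable_coord i) mb).
Qed.

Lemma measurable_truncate_field i : measurable_fun setT
  (fun p : measurableTypeR R * 'rV[R]_d => truncate_field p.1 p.2 ord0 i).
Proof.
have m1 : measurable_fun setT (fun p : measurableTypeR R * 'rV[R]_d => in_time b p.1 p.2).
  by apply: measurable_fun_rVP; exact: measurable_in_time_field.
have -> : (fun p : measurableTypeR R * 'rV[R]_d => truncate_field p.1 p.2 ord0 i) =
    (fun p => if `|in_time b p.1 p.2| <= B * (1 + `|p.2|) then in_time b p.1 p.2 ord0 i else 0).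
  by apply/funext => p; rewrite /truncate_field; case: ifP => // _; rewrite mxE.
apply: measurable_fun_ifT => //; last exact: measurable_in_time_field.
apply: measurable_fun_ler; first exact: (measurableT_comp measurable_norm_rV m1).
apply: measurable_funM => //; apply: measurable_funD => //.
exact: (measurableT_comp measurable_norm_rV measurable_snd).
Qed.

Lemma truncate_field_le t x : `|truncate_field t x| <= B * (1 + `|x|).
Proof. by rewrite /truncate_field; case: ifP => // _; rewrite normr0 mulr_ge0// addr_ge0. Qed.

Lemma truncate_scalar_le t x : `|truncate_scalar t x| <= B.
Proof. by rewrite /truncate_scalar; case: ifP => // _; rewrite normr0. Qed.

Lemma truncate_field_out t x : ~~ (0 <= t <= T) -> truncate_field t x = 0.
Proof. by rewrite /truncate_field /in_time => /negPf ->; case: ifP. Qed.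

Lemma truncate_scalar_out t x : ~~ (0 <= t <= T) -> truncate_scalar t x = 0.
Proof. by rewrite /truncate_scalar /in_time => /negPf ->; case: ifP. Qed.

Lemma truncate_fieldE t x : 0 <= t <= T -> `|b t x| <= B * (1 + `|x|) -> truncate_field t x = b t x.
Proof. by rewrite /truncate_field /in_time => -> ->. Qed.

Lemma truncate_scalarE t x : 0 <= t <= T -> `|c t x| <= B -> truncate_scalar t x = c t x.
Proof. by rewrite /truncate_scalar /in_time => -> ->. Qed.

End truncation.

(** * Extension of the path by constants *)

Section hoelder_clamp.
Context {R : realType} {V : normedModType R}.
Variables (T gamma H : R) (X : R -> V).
Hypotheses (T0 : 0 < T) (gamma0 : 0 < gamma)
  (X_hoelder : forall s t, 0 <= s <= T -> 0 <= t <= T ->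
    `|X t - X s| <= H * `|t - s| `^ gamma).

Let T_ge0 : 0 <= T. Proof. exact: ltW. Qed.

Lemma clamp_hoelder s t : `|X (clamp T t) - X (clamp T s)| <= `|H| * `|t - s| `^ gamma.
Proof.
rewrite (le_trans (X_hoelder (clamp_itv T_ge0 s) (clamp_itv T_ge0 t)))//.
apply: (@le_trans _ _ (`|H| * `|clamp T t - clamp T s| `^ gamma)).
  by rewrite ler_wpM2r ?powR_ge0// ler_norm.
by rewrite ler_wpM2l// ge0_ler_powR ?(ltW gamma0)// ?nnegrE// clamp_lipschitz.
Qed.

Lemma clamp_continuous : continuous (fun t => X (clamp T t)).
Proof.
move=> s; apply/cvgrPdist_le => e e0.
have H1 : 0 < `|H| + 1 by rewrite ltr_wpDl.
have eH : 0 < e / (`|H| + 1) by rewrite divr_gt0.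
have d0 : 0 < (e / (`|H| + 1)) `^ gamma^-1 by rewrite powR_gt0.
apply/nbhs_ballP; exists ((e / (`|H| + 1)) `^ gamma^-1) => //= t; rewrite /ball/= => st.
rewrite (le_trans (clamp_hoelder t s))//.
rewrite (@le_trans _ _ ((`|H| + 1) * (e / (`|H| + 1))))//; last first.
  by rewrite mulrCA divff ?mulr1// gt_eqF.
rewrite ler_pM ?powR_ge0// ?lerDl//.
apply: (@le_trans _ _ (((e / (`|H| + 1)) `^ gamma^-1) `^ gamma)).
  by rewrite ge0_ler_powR ?(ltW gamma0)// ?nnegrE ?powR_ge0// ltW.
by rewrite -powRrM mulVf ?gt_eqF// powRr1// ltW.
Qed.

Lemma clamp_bounded t : `|X (clamp T t)| <= `|X 0| + `|H| * T `^ gamma.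
Proof.
have := clamp_itv T_ge0 t; move: (clamp T t) => r rT; have /andP[r0 rT'] := rT.
rewrite -(subrK (X 0) (X r)) addrC (le_trans (ler_normD _ _))// lerD2l.
have I0 : 0 <= (0 : R) <= T by rewrite lexx.
rewrite (le_trans (X_hoelder I0 rT))// subr0 (ger0_norm r0).
apply: (@le_trans _ _ (`|H| * r `^ gamma)); first by rewrite ler_wpM2r ?powR_ge0// ler_norm.
by rewrite ler_wpM2l// ge0_ler_powR ?(ltW gamma0)// nnegrE.
Qed.

End hoelder_clamp.

(** * Controlled paths and rough integrals see the path on [0, T] only *)

Section same_path_in_time.
Context {R : realType} {d : nat}.
Variables (T gamma : R) (X X' : R -> 'rV[R]_d).
Hypothesis XX' : forall t, 0 <= t <= T -> X' t = X t.

Lemma controlled_eq k (y : R -> 'rV[R]_k) y' :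
  controlled T gamma X' y y' -> controlled T gamma X y y'.
Proof.
move=> [hy hy' [r hr E]]; split=> //; exists r => // s t sT tT; rewrite E// /increment.
by move: sT tT; rewrite !in_itv/= => sT tT; rewrite !XX'.
Qed.

Lemma rough_sum_eq (XX : R -> R -> 'M[R]_d) y y' s t P :
  0 <= s -> t <= T -> itv_partition s t P ->
  rough_sum X' XX y y' s P = rough_sum X XX y y' s P.
Proof.
elim: P s => [|p P IH] s s0 tT Ps; first by rewrite /rough_sum !big_geq.
have Pp := itv_partition_cons Ps; have pt := itv_partition_le Pp.
have sp : s < p by case: Ps => /= /andP[].
have p0 : 0 <= p by rewrite (le_trans s0)// ltW.
have pT := le_trans pt tT.
rewrite !rough_sum_cons IH// /increment !XX'// ?p0// s0.
by rewrite (le_trans (ltW sp)).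
Qed.

Lemma is_rough_integral_eq (XX : R -> R -> 'M[R]_d) y y' t I : t <= T ->
  is_rough_integral X' XX y y' 0 t I -> is_rough_integral X XX y y' 0 t I.
Proof.
move=> tT HI e e0; have [delta d0 Hd] := HI e e0; exists delta => // P Pt mesh.
by rewrite -(rough_sum_eq XX y y' (lexx 0) tT Pt) Hd.
Qed.

End same_path_in_time.

Lemma hoelder_path_bound (R : realType) (V : normedModType R) (T gamma : R) (X : R -> V) :
  0 < T -> hoelder_path T gamma X -> exists H : R, forall s t, 0 <= s <= T -> 0 <= t <= T ->
    `|X t - X s| <= H * `|t - s| `^ gamma.
Proof.
move=> T0 hX; have hX2 : (hoelder_norm2 T gamma (increment X) < +oo)%E.
  by apply: le_lt_trans hX; rewrite /hoelder_norm leeDr.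
have [H H0 XH] := lty_real_bound hX2; exists H => s t sT tT.
have [->|st] := eqVneq s t; first by rewrite !subrr normr0 mulr_ge0// powR_ge0.
exact: (hoelder_norm2_ge XH sT tT st).
Qed.

(** * Return from the truncated data to the original ones *)

Section original_data.
Context {R : realType} {d : nat}.
Local Notation leb := (@lebesgue_measure R).
Local Notation lam := (@lebesgue_rV R d).
Variables (T B : R) (b : R -> 'rV[R]_d -> 'rV[R]_d) (c : R -> 'rV[R]_d -> R).
Hypotheses (B0 : 0 <= B)
  (mb : measurable_fun (`[0, T] `*` [set: 'rV[R]_d]) (fun p => b p.1 p.2))
  (mc : measurable_fun (`[0, T] `*` [set: 'rV[R]_d]) (fun p => c p.1 p.2))
  (bB : {ae leb, forall t, 0 <= t <= T -> (lin_norm (b t) <= B%:E)%E})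
  (cB : {ae leb, forall t, 0 <= t <= T -> ('N[lam]_(+oo)[EFin \o c t] <= B%:E)%E}).

Let b' := truncate_field T B b.
Let c' := truncate_scalar T B c.

Lemma truncate_ae : {ae leb, forall t, 0 <= t <= T ->
  {ae lam, forall x, b' t x = b t x /\ c' t x = c t x}}.
Proof.
have fae : Filter (almost_everywhere leb) by exact: ae_filter_ringOfSetsType.
apply: filterS2 bB cB => t bt ct tT.
have fal : Filter (almost_everywhere lam) by exact: ae_filter_ringOfSetsType.
apply: filterS2 (Lnorm_oo_ae (bt tT)) (Lnorm_oo_ae (ct tT)) => x /=.
rewrite !lee_fin => bx cx; split.
  apply: truncate_fieldE => //; move: bx.
  have x1 : 0 < 1 + `|x| by rewrite ltr_pwDl.
  by rewrite ger0_norm ?divr_ge0 ?(ltW x1)// ler_pdivrMr.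
exact: truncate_scalarE.
Qed.

Let measurable_in_time_section t : 0 <= t <= T ->
  (forall i, measurable_fun setT (fun x => b t x ord0 i)) /\ measurable_fun setT (c t).
Proof.
move=> tT; split=> [i|].
  have := measurableT_comp (measurable_in_time_field mb i) (measurable_pair1 (t : measurableTypeR R)).
  by congr measurable_fun; apply/funext => x; rewrite /= /in_time tT.
have := measurableT_comp (measurable_in_time mc) (measurable_pair1 (t : measurableTypeR R)).
by congr measurable_fun; apply/funext => x; rewrite /= /in_time tT.
Qed.

Lemma measurable_dotmul_gradient (v : 'rV[R]_d -> 'rV[R]_d) phi :
  (forall i, measurable_fun setT (fun x => v x ord0 i)) -> test_function phi ->
  measurable_fun setT (fun x => dotmul (v x) (gradient phi x)).
Proof.
move=> mv tphi; apply: measurable_sum => i.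
under eq_fun do rewrite mxE.
by apply: measurable_funM => //; exact: (test_measurable (test_partial i tphi)).
Qed.

Let measurable_truncate_section t :
  (forall i, measurable_fun setT (fun x => b' t x ord0 i)) /\ measurable_fun setT (c' t).
Proof.
split=> [i|].
  exact: (measurableT_comp (measurable_truncate_field B mb i) (measurable_pair1 (t : measurableTypeR R))).
exact: (measurableT_comp (measurable_truncate_scalar B mc) (measurable_pair1 (t : measurableTypeR R))).
Qed.

Lemma truncate_weak_div :
  {ae leb, forall t, t \in `[0, T] -> weak_div (b t) (c t)} ->
  {ae leb, forall t, t \in `[0, T] -> weak_div (b' t) (c' t)}.
Proof.
have fae : Filter (almost_everywhere leb) by exact: ae_filter_ringOfSetsType.
move=> bc; apply: filterS2 bc truncate_ae => t bct bt tT phi tphi.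
have tI : 0 <= t <= T by move: tT; rewrite in_itv.
have [mbt mct] := measurable_in_time_section tI.
have [mbt' mct'] := measurable_truncate_section t.
have mphi := test_measurable tphi.
have fal : Filter (almost_everywhere lam) by exact: ae_filter_ringOfSetsType.
transitivity (\int[lam]_x dotmul (b t x) (gradient phi x)).
  apply: ae_rintegral; [exact: measurable_dotmul_gradient..|].
  by apply: filterS (bt tI) => x [-> _].
rewrite (bct tT phi tphi); congr (- _); apply: ae_rintegral.
- exact: measurable_funM.
- exact: measurable_funM.
- by apply: filterS (bt tI) => x [_ ->].
Qed.

(** For almost every s the two sets of data agree almost everywhere in x, so the inner integrals
    agree; both being measurable in s, so do the outer ones. *)
Lemma truncate_drift (u : R -> 'rV[R]_d -> R) phi t :
  measurable_fun setT (fun p : measurableTypeR R * 'rV[R]_d => u p.1 p.2) ->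
  test_function phi -> t <= T ->
  \int[leb]_(s in `[0, t]) \int[lam]_x (u s x * adv b' c' s phi x) =
  \int[leb]_(s in `[0, t]) pairing (u s)
    (fun x => dotmul (b s x) (gradient phi x) + c s x * phi x).
Proof.
move=> mu_ tphi tT; have mphi := test_measurable tphi.
have fae : Filter (almost_everywhere leb) by exact: ae_filter_ringOfSetsType.
have fal : Filter (almost_everywhere lam) by exact: ae_filter_ringOfSetsType.
pose F (v : R -> 'rV[R]_d -> 'rV[R]_d) (w : R -> 'rV[R]_d -> R) (p : measurableTypeR R * 'rV[R]_d) :=
  u p.1 p.2 * (dotmul (v p.1 p.2) (gradient phi p.2) + w p.1 p.2 * phi p.2).
have mF (v : R -> 'rV[R]_d -> 'rV[R]_d) (w : R -> 'rV[R]_d -> R) : (forall i, measurable_fun setT (fun p : measurableTypeR R * 'rV[R]_d => v p.1 p.2 ord0 i)) ->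
    measurable_fun setT (fun p : measurableTypeR R * 'rV[R]_d => w p.1 p.2) ->
    measurable_fun setT (F v w).
  move=> mv mw; apply: measurable_funM => //; apply: measurable_funD; last first.
    by apply: measurable_funM => //; exact: (measurableT_comp mphi measurable_snd).
  apply: measurable_sum => i; under eq_fun do rewrite mxE.
  apply: measurable_funM; first exact: mv.
  exact: (measurableT_comp (test_measurable (test_partial i tphi)) measurable_snd).
have m1 := measurable_section_Rintegral lam (mF _ _ (measurable_truncate_field B mb) (measurable_truncate_scalar B mc)).
have m2 := measurable_section_Rintegral lam (mF _ _ (measurable_in_time_field mb) (measurable_in_time mc)).
have inT s : s \in `[0, t]%classic -> 0 <= s <= T.
  by rewrite inE/= in_itv/= => /andP[-> st]; rewrite (le_trans st).
transitivity (\int[leb]_(s in `[0, t]) \int[lam]_x F (in_time T b) (in_time T c) (s, x)); last first.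
  apply: eq_Rintegral => s /inT sT; apply: eq_Rintegral => x _.
  by rewrite /F /in_time /= sT.
rewrite /Rintegral; congr fine; apply: ae_eq_integral.
- by have := measurable_itv `[0, t].
- by apply/measurable_EFinP; apply: measurable_funTS; exact: m1.
- by apply/measurable_EFinP; apply: measurable_funTS; exact: m2.
apply: filterS truncate_ae => s bs; rewrite -inE => /inT sT; congr EFin.
have [mbt mct] := measurable_in_time_section sT.
have [mbt' mct'] := measurable_truncate_section s.
apply: ae_rintegral.
- exact: (measurableT_comp (mF _ _ (measurable_truncate_field B mb) (measurable_truncate_scalar B mc)) (measurable_pair1 (s : measurableTypeR R))).
- exact: (measurableT_comp (mF _ _ (measurable_in_time_field mb) (measurable_in_time mc)) (measurable_pair1 (s : measurableTypeR R))).
- by apply: filterS (bs sT) => x [E1 E2]; rewrite /F /= /in_time sT -/b' -/c' /adv E1 E2.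
Qed.

End original_data.

Theorem theorem3p6 (R : realType) (d : nat) (hd : (0 < d)%N)
  (T gamma : R) (hT : 0 < T) (hgamma1 : 1 / 3 < gamma) (hgamma2 : gamma <= 1 / 2)
  (b : R -> 'rV[R]_d -> 'rV[R]_d) (hb : Linfty_Lin T b)
  (divb : R -> 'rV[R]_d -> R)
  (hdivb : {ae lebesgue_measure, forall t : R,
     t \in `[0, T] -> weak_div (b t) (divb t)})
  (hdivb_bounded : Linfty_Linfty T divb)
  (X : R -> 'rV[R]_d) (XX : R -> R -> 'M[R]_d)
  (hX : geometric_rough_path T gamma X XX)
  (u0 : 'rV[R]_d -> R) (hu0 : u0 \in Lfun (lebesgue_rV d) +oo%E) :
  exists u : R -> 'rV[R]_d -> R,
    weak_controlled_solution T gamma b divb X XX u0 u.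
Proof.
have gamma0 : 0 < gamma by rewrite (lt_trans _ hgamma1)// divr_gt0.
have T_ge0 := ltW hT.
have I0 : 0 <= (0 : R) <= T by rewrite lexx.
have [mb /ess_bounded_in_time_ae[B1 B10 bB1]] := hb.
have [mc /ess_bounded_in_time_ae[B2 B20 cB2]] := hdivb_bounded.
have fae : Filter (almost_everywhere (@lebesgue_measure R)) by exact: ae_filter_ringOfSetsType.
pose B := B1 + B2; have B0 : 0 <= B by rewrite addr_ge0.
have bB : {ae lebesgue_measure, forall t, 0 <= t <= T -> (lin_norm (b t) <= B%:E)%E}.
  by apply: filterS bB1 => t bt tT; rewrite (le_trans (bt tT))// lee_fin lerDl.
have cB : {ae lebesgue_measure, forall t, 0 <= t <= T ->
    ('N[lebesgue_rV d]_(+oo)[EFin \o divb t] <= B%:E)%E}.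
  by apply: filterS cB2 => t ct tT; rewrite (le_trans (ct tT))// lee_fin lerDr.
have mb' := measurable_truncate_field B mb.
have mc' := measurable_truncate_scalar B mc.
have b'_le := truncate_field_le T b B0; have c'_le := truncate_scalar_le T divb B0.
have b'_out := truncate_field_out (T := T) B b; have c'_out := truncate_scalar_out (T := T) B divb.
have bc' := truncate_weak_div mb mc bB cB hdivb.
move/andP: hu0; rewrite !inE /= => -[mu0 /lty_real_bound[M M0 /Lnorm_oo_ae u0M]].
(* The initial datum is changed on a null set so that its bound holds everywhere. *)
pose u0' x := if `|u0 x| <= M then u0 x else 0.
have mu0' : measurable_fun setT u0'.
  apply: measurable_fun_ifT => //; apply: measurable_fun_ler => //; exact: measurableT_comp.
have u0'_le x : `|u0' x| <= M by rewrite /u0'; case: ifP => // _; rewrite normr0.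
have u0E phi : test_function phi ->
    \int[lebesgue_rV d]_x (u0' x * phi x) = pairing u0 phi.
  move=> tphi; have mphi := test_measurable tphi.
  have fal : Filter (almost_everywhere (@lebesgue_rV R d)) by exact: ae_filter_ringOfSetsType.
  apply: ae_rintegral; [exact: measurable_funM..|].
  by apply: filterS u0M => x /=; rewrite lee_fin /u0' => ->.
have [[X0 hX1 _ _] _] := hX.
have [H XH] := hoelder_path_bound hT hX1.
(* The extension by constants is continuous and bounded on all of R, as the transport equation
   requires. *)
pose X' t := X (clamp T t).
have cX' : continuous X' by exact: (clamp_continuous hT gamma0 XH).
have X'_le t : `|X' t| <= `|X 0| + `|H| * T `^ gamma := clamp_bounded hT gamma0 XH t.
have X'E t : 0 <= t <= T -> X' t = X t by move=> tT; rewrite /X' clamp_id.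
have X'H s t : 0 <= s <= T -> 0 <= t <= T -> `|X' t - X' s| <= H * `|t - s| `^ gamma.
  by move=> sT tT; rewrite !X'E//; exact: XH.
have X'_sym s t : 0 <= s -> s <= t -> t <= T ->
    XX s t + (XX s t)^T = tensor (increment X' s t) (increment X' s t).
  move=> s0 st tT; rewrite (geometric_symmetric hT hX s0 st tT) /increment.
  by rewrite !X'E// ?tT ?s0 ?(le_trans s0 st) ?(le_trans st tT).
have [u [mu_ u_le u_dual]] := dual_solution T_ge0 B0 cX' X'_le mb' mc' b'_le c'_le
  b'_out c'_out bc' mu0' u0'_le.
have frame phi (tphi : test_function phi) := moving_frame B0 cX' X'_le mb' mc' b'_le c'_le
  b'_out c'_out mu0' u0'_le mu_ u_le u_dual tphi.
pose Lam := frozen X' (truncate_field T B b) (truncate_scalar T B divb) u0' u.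
pose Drift := drift (truncate_field T B b) (truncate_scalar T B divb) u.
have Lam_lin := frozen_linear B0 cX' X'_le mb' mc' b'_le c'_le b'_out c'_out mu0' u0'_le mu_ u_le.
have Lam_le := frozen_le hT B0 cX' X'_le mb' mc' b'_le c'_le b'_out c'_out mu0' u0'_le mu_ u_le.
have Drift_le := frozen_drift B0 gamma0 cX' X'_le X'H mb' mc' b'_le c'_le b'_out c'_out u0'_le mu_ u_le.
exists u; split.
  apply/andP; split; rewrite inE /=.
    apply: (measurable_restrictT _ _).1.
      by apply: measurableX => //; exact: measurable_itv.
    exact: measurable_funTS.
  rewrite /finite_norm (le_lt_trans (Lnorm_oo_le _ (B := M) _ _))// ?ltry//.
  by move=> p; rewrite patchE; case: ifP => _ //; rewrite normr0.
exists (rough_value X' Lam) => U1 U2 phi tphi.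
split.
- split; first by apply: continuous_subspaceT; exact: (rough_value_continuous cX' X'_le Lam_lin Lam_le tphi).
  have := frozen_pairing hT B0 cX' X'_le mb' mc' b'_le c'_le b'_out c'_out mu0' u0'_le mu_ u_le frame tphi.
  by apply: filterS => t + tT; apply; move: tT; rewrite /= in_itv.
(* The case of one component: a scalar matrix of size 1 is a row with a single entry. *)
- have := controlled_rough_value hT hgamma2 cX' X'_le X'H Lam_lin Lam_le (fun _ : 'I_1 => tphi).
  move=> /(controlled_eq X'E) ctrl; eexists.
  rewrite (_ : (fun t => _) = (fun t => \row_i0 rough_value X' Lam phi t)); first exact: ctrl.
  by apply/funext => t; apply/rowP => i; rewrite !mxE ord1.
- apply: (controlled_eq X'E).
  exact: (controlled_rough_value hT hgamma2 cX' X'_le X'H Lam_lin Lam_le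
    (fun i => test_partial i tphi)).
move=> t; rewrite in_itv/= => tT; have /andP[t0 tT'] := tT.
exists (rough_value X' Lam phi t - Drift phi t - (rough_value X' Lam phi 0 - Drift phi 0)).
  apply: (is_rough_integral_eq X'E tT').
  exact: (rough_value_integral hT hgamma1 X'_le X'H Lam_lin Lam_le Drift_le X'_sym tphi tT).
have Drift0 : Drift phi 0 = 0 by rewrite /Drift /drift set_itv1 Rintegral_set1.
(* Since the path starts at 0, the shift is trivial at time 0. *)
have U0 : rough_value X' Lam phi 0 = pairing u0 phi.
  rewrite /rough_value /Lam /frozen set_itv1 Rintegral_set1 addr0 -u0E//.
  by apply: eq_Rintegral => x _; rewrite /shiftf X'E// X0 addr0.
rewrite -(truncate_drift mb mc bB cB mu_ tphi tT') -/(drift _ _ _ phi t) -/(Drift phi t).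
rewrite U0 Drift0; ring.
Qed.
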